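(* Let $q,p\in C^2([0,L])$, $\delta_q>0$, $\delta_p\in(0,\delta_q/2)$ satisfy the requirements (Q) and (P) of the context, let $$0<\varepsilon_1<\min\left\{\frac{1}{2C_3},\ \left(\|q\|_{L^\infty}+\frac{L}{\pi}\|p\|_{L^\infty}\right)^{-1}\right\},$$ and let $C_0$, $V_1$ and $\gamma$ be as in the context. Define, for $(f,g)\in\left(H^2(0,L)\cap H^1_0(0,L)\right)\times H^1_0(0,L)$, the functional (containing only local terms) $$V_{\mathrm{s}}(f,g):=V_1\left(g,\,f_{xx}-a(x)g\right)+C_0E(f,g).$$ Then $V_{\mathrm{s}}$ is a strict Lyapunov function for the damped wave equation in $\left(H^2(0,L)\cap H^1_0(0,L)\right)\times H^1_0(0,L)$, in the following sense. (i) There exists $C_6>0$ such that, for every $(f,g)\in\left(H^2(0,L)\cap H^1_0(0,L)\right)\times H^1_0(0,L)$, $$\frac1{C_6}\left(\|f\|_{H^2}^2+\|g\|_{H^1}^2\right)\le V_{\mathrm{s}}(f,g)\le C_6\left(\|f\|_{H^2}^2+\|g\|_{H^1}^2\right).$$ (ii) For every $(y_0,y_1)\in\left(H^2(0,L)\cap H^1_0(0,L)\right)\times H^1_0(0,L)$, if $y$ is the (strong) solution with initial data $(y_0,y_1)$ and $V_{\mathrm{s}}(t):=V_{\mathrm{s}}(y(t),y_t(t))$, then $$\dot V_{\mathrm{s}}\le-\gamma V_{\mathrm{s}}\quad\text{in }\mathcal{D}'(0,+\infty).$$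
   Context: Standing assumptions. $L>0$; $a\in L^\infty(0,L)$ with $a\ge0$ almost everywhere; there are $0\le x_0<x_1\le L$ and $a_{\min}\in(0,+\infty)$ with $a(x)\ge a_{\min}$ for almost every $x\in(x_0,x_1)$. Equation. The damped wave equation is $$y_{tt}-y_{xx}+a(x)y_t=0\ \ (t\ge0,\ x\in(0,L)),\qquad y(t,0)=y(t,L)=0,\qquad y(0)=y_0,\ y_t(0)=y_1,$$ where $y(t)=y(t,\cdot)$. For $(y_0,y_1)\in H^1_0(0,L)\times L^2(0,L)$, a weak solution is a function $y\in C^0([0,+\infty);H^1_0(0,L))\cap C^1([0,+\infty);L^2(0,L))$ with $y_{tt}\in C^0([0,+\infty);H^{-1}(0,L))$, $y(0)=y_0$, $y_t(0)=y_1$, such that for every $v\in H^1_0(0,L)$ and every $t\ge0$, $$\langle y_{tt}(t),v\rangle_{H^{-1},H^1_0}+\int_0^Ly_x(t)v_x\,dx+\int_0^La(x)y_t(t)v\,dx=0.$$ It is classical that there is a unique weak solution for each such $(y_0,y_1)$, and that for every $T>0$ it depends continuously on $(y_0,y_1)$ as an element of $C^0([0,T];H^1_0(0,L))\cap C^1([0,T];L^2(0,L))$. If moreover $y_0\in H^2(0,L)\cap H^1_0(0,L)$ and $y_1\in H^1_0(0,L)$, then $y\in C^0([0,+\infty);H^2(0,L)\cap H^1_0(0,L))\cap C^1([0,+\infty);H^1_0(0,L))\cap C^2([0,+\infty);L^2(0,L))$; such solutions are called strong solutions. Requirements on $q$ and $p$ (both in $C^2([0,L])$): (Q) $q(0)\ge0$,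 $q(L)\le0$, $\delta_q>0$, and $q'(x)\ge\delta_q$ for all $x\in[0,x_0]\cup[x_1,L]$. (P) $p(x)=0$ for all $x\in[0,x_0]\cup[x_1,L]$, $\delta_p\in(0,\delta_q/2)$, and $p(x)+\frac12q'(x)\ge\delta_p$ for all $x\in[x_0,x_1]$. Functionals, for $(f,g)\in H^1_0(0,L)\times L^2(0,L)$: $$E(f,g):=\frac12\int_0^L(f_x^2+g^2)\,dx,\qquad M(f,g):=\int_0^Lp(x)fg\,dx+\int_0^Lq(x)gf_x\,dx,$$ $$V_1:=E+\varepsilon_1M,\qquad E_0(f,g):=E(\mathcal{L}(f,g),f),\qquad V:=V_1+C_0E_0,$$ where $h=\mathcal{L}(f,g)\in H^1_0(0,L)$ is the unique solution of $h_{xx}=a(x)f+g$ in $H^{-1}(0,L)$. Constants: $$C_1:=\frac12\left(1+\|p''\|_{L^\infty}\right),\qquad C_2(\eta):=\|a\|_{L^\infty}\left(\frac{\|q\|_{L^\infty}^2}{4\eta}+\frac{\|p\|_{L^\infty}^2}{2}\right)\ (\eta>0),$$ $$K:=\max_{x\in[0,L]}\left(p(x)-\frac12q'(x)\right)_+,\qquad C_3:=\frac{K}{a_{\min}}+C_2(\delta_p/2),\qquad C_0:=\frac{\varepsilon_1C_1}{a_{\min}},$$ $$\delta_1:=\frac{\varepsilon_1\delta_p}{2},\qquad\delta_2:=\min\left\{\frac{a_{\min}}{2},\frac{\varepsilon_1\delta_q}{2}\right\},\qquad\gamma:=\frac{2\min\{\delta_1,\delta_2\}}{C_5},$$ where $(s)_+=\max\{s,0\}$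 and $C_5>0$ is any constant such that $V(f,g)\le C_5E(f,g)$ for all $(f,g)\in H^1_0(0,L)\times L^2(0,L)$ (such a constant exists). $\mathcal{D}'(0,+\infty)$ is the space of distributions on $(0,+\infty)$; an inequality in $\mathcal{D}'(0,+\infty)$ means that it holds after testing against every nonnegative $\varphi\in C_c^\infty(0,+\infty)$, and $\dot V_{\mathrm{s}}$ is the distributional derivative of the continuous function $t\mapsto V_{\mathrm{s}}(t)$. *)

(* Defs.v *)
From HB Require Import structures.
From mathcomp Require Import all_boot all_order all_algebra.
From mathcomp Require Import all_classical all_reals all_analysis.

Set Implicit Arguments.
Unset Strict Implicit.
Unset Printing Implicit Defensive.

Import Order.TTheory GRing.Theory Num.Theory.
Import numFieldNormedType.Exports.

Local Open Scope classical_set_scope.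
Local Open Scope ring_scope.

(* Elements of L^2(0,L), H^1(0,L), etc. are represented by functions R -> R
   whose values outside `]0, L[ are irrelevant; two functions represent the
   same element when they agree almost everywhere on `]0, L[. *)

(** * Test functions and Lebesgue spaces *)

(* C_c^infty(A), for A open *)
Definition test_function (R : realType) (A : set R) (phi : R -> R) : Prop :=
  (forall n x, derivable (derive1n n phi) x 1) /\
  exists K : set R, [/\ compact K, K `<=` A & forall x, ~ K x -> phi x = 0].

Definition int0L (R : realType) (L : R) (f : R -> R) : R :=
  \int[lebesgue_measure]_(x in `]0, L[) f x.

Definition ae0L (R : realType) (L : R) (P : R -> Prop) : Prop :=
  {ae lebesgue_measure, forall x : R, x \in `]0, L[ -> P x}.

(* f \_ D is the extension by zero of the restriction of f to D, so that
   L^p(0,L) is read off the library's L^p space on the whole line. *)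
Definition L2 (R : realType) (L : R) (f : R -> R) : Prop :=
  (f \_ (`]0, L[ : set R) : R -> R) \in Lfun (@lebesgue_measure R) 2%:E.

Definition Linfty (R : realType) (L : R) (f : R -> R) : Prop :=
  (f \_ (`]0, L[ : set R) : R -> R) \in Lfun (@lebesgue_measure R) +oo%E.

Definition L2norm (R : realType) (L : R) (f : R -> R) : R :=
  Num.sqrt (int0L L (fun x => f x ^+ 2)).

Definition Linfty_norm (R : realType) (L : R) (f : R -> R) : R :=
  fine ('N[lebesgue_measure]_+oo[EFin \o (f \_ (`]0, L[ : set R))%R]%E).

(** * Sobolev spaces on (0,L) *)

Definition is_weak_derivative (R : realType) (L : R) (f g : R -> R) : Prop :=
  L2 L g /\
  forall phi, test_function `]0, L[ phi ->
    int0L L (fun x => f x * derive1 phi x) = - int0L L (fun x => g x * phi x).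

Definition H1 (R : realType) (L : R) (f : R -> R) : Prop :=
  L2 L f /\ exists g, is_weak_derivative L f g.

(* A representative of the weak derivative of f, for f in H^1(0,L);
   the zero function when f has no weak derivative in L^2(0,L). *)
Definition Dx (R : realType) (L : R) (f : R -> R) : R -> R :=
  xget (fun=> 0) [set g | is_weak_derivative L f g].

Definition H1norm (R : realType) (L : R) (f : R -> R) : R :=
  Num.sqrt (L2norm L f ^+ 2 + L2norm L (Dx L f) ^+ 2).

(* closure of C_c^infty(0,L) in H^1(0,L) *)
Definition H10 (R : realType) (L : R) (f : R -> R) : Prop :=
  H1 L f /\
  forall e : R, 0 < e ->
    exists2 phi, test_function `]0, L[ phi & H1norm L (f - phi) < e.

Definition H2 (R : realType) (L : R) (f : R -> R) : Prop :=
  H1 L f /\ H1 L (Dx L f).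

Definition H2norm (R : realType) (L : R) (f : R -> R) : R :=
  Num.sqrt (L2norm L f ^+ 2 + L2norm L (Dx L f) ^+ 2 +
            L2norm L (Dx L (Dx L f)) ^+ 2).

(* H^{-1}(0,L), the dual of H^1_0(0,L); only the values of F on H^1_0(0,L)
   matter. *)
Definition Hm1 (R : realType) (L : R) (F : (R -> R) -> R) : Prop :=
  (forall (c : R) (v w : R -> R), H10 L v -> H10 L w ->
     F (c *: v + w) = c * F v + F w) /\
  exists C : R, forall v, H10 L v -> `|F v| <= C * H1norm L v.

Definition Hm1norm (R : realType) (L : R) (F : (R -> R) -> R) : R :=
  sup [set `|F v| | v in [set v | H10 L v /\ H1norm L v <= 1]].

(* the embedding of L^2(0,L) into H^{-1}(0,L) *)
Definition L2_to_Hm1 (R : realType) (L : R) (f : R -> R) : (R -> R) -> R :=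
  fun v => int0L L (fun x => f x * v x).

(** * Functions of time with values in a normed space, on [0,+oo[ *)

(* u \in C^0([0,+oo[; X), where X is a subset of V and N the norm on X *)
Definition C0time (R : realType) (V : lmodType R) (X : V -> Prop) (N : V -> R)
    (u : R -> V) : Prop :=
  forall t : R, 0 <= t ->
    X (u t) /\ N (u s - u t) @[s --> within `[0, +oo[ (nbhs t)] --> (0 : R).

(* u is differentiable on [0,+oo[ for the norm N, with derivative u' (one-sided
   at t = 0) *)
Definition time_derivative (R : realType) (V : lmodType R) (N : V -> R)
    (u u' : R -> V) : Prop :=
  forall t : R, 0 <= t ->
    N ((s - t)^-1 *: (u s - u t) - u' t) @[s --> within `[0, +oo[ t^']
      --> (0 : R).

(** * The damped wave equation *)

(* y is the weak solution with initial data (y0, y1), and yt is its time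
   derivative. *)
Definition weak_solution (R : realType) (L : R) (a y0 y1 : R -> R)
    (y yt : R -> (R -> R)) : Prop :=
  [/\ C0time (H10 L) (H1norm L) y,
      C0time (L2 L) (L2norm L) yt /\ time_derivative (L2norm L) y yt,
      ae0L L (fun x => y 0 x = y0 x),
      ae0L L (fun x => yt 0 x = y1 x) &
      exists ytt : R -> ((R -> R) -> R),
        [/\ C0time (Hm1 L) (Hm1norm L) ytt,
            time_derivative (Hm1norm L) (fun t => L2_to_Hm1 L (yt t)) ytt &
            forall v, H10 L v -> forall t : R, 0 <= t ->
              ytt t v + int0L L (fun x => Dx L (y t) x * Dx L v x)
                + int0L L (fun x => a x * yt t x * v x) = 0]].

Definition strong_solution (R : realType) (L : R) (a y0 y1 : R -> R)
    (y yt : R -> (R -> R)) : Prop :=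
  [/\ weak_solution L a y0 y1 y yt,
      C0time (fun f => H2 L f /\ H10 L f) (H2norm L) y,
      C0time (H10 L) (H1norm L) yt /\ time_derivative (H1norm L) y yt &
      exists ytt : R -> (R -> R),
        C0time (L2 L) (L2norm L) ytt /\ time_derivative (L2norm L) yt ytt].

(** * The coefficients q and p *)

(* f \in C^2([0,L]), with first and second derivatives f' and f''; at the
   endpoints these are the continuous extensions. *)
Definition C2 (R : realType) (L : R) (f f' f'' : R -> R) : Prop :=
  [/\ {within `[0, L], continuous f},
      {within `[0, L], continuous f'},
      {within `[0, L], continuous f''} &
      forall x, x \in `]0, L[ -> is_derive x 1 f (f' x) /\
                                 is_derive x 1 f' (f'' x)].

Definition condQ (R : realType) (L x0 x1 : R) (q q' : R -> R) (deltaq : R)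
    : Prop :=
  [/\ 0 <= q 0, q L <= 0, 0 < deltaq &
      forall x, x \in `[0, x0] \/ x \in `[x1, L] -> deltaq <= q' x].

Definition condP (R : realType) (L x0 x1 : R) (q' p : R -> R)
    (deltaq deltap : R) : Prop :=
  [/\ forall x, x \in `[0, x0] \/ x \in `[x1, L] -> p x = 0,
      0 < deltap < deltaq / 2 &
      forall x, x \in `[x0, x1] -> deltap <= p x + q' x / 2].

(** * Functionals *)

Definition energy (R : realType) (L : R) (f g : R -> R) : R :=
  int0L L (fun x => Dx L f x ^+ 2 + g x ^+ 2) / 2.

Definition Mfun (R : realType) (L : R) (p q f g : R -> R) : R :=
  int0L L (fun x => p x * f x * g x) + int0L L (fun x => q x * g x * Dx L f x).

Definition V1 (R : realType) (L : R) (p q : R -> R) (eps1 : R) (f g : R -> R)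
    : R :=
  energy L f g + eps1 * Mfun L p q f g.

(* A representative of the unique h in H^1_0(0,L) with h_xx = a f + g in
   H^{-1}(0,L), where <h_xx, v> = - \int h_x v_x. *)
Definition Lop (R : realType) (L : R) (a f g : R -> R) : R -> R :=
  xget (fun=> 0) [set h | H10 L h /\
    forall v, H10 L v ->
      - int0L L (fun x => Dx L h x * Dx L v x) =
      int0L L (fun x => (a x * f x + g x) * v x)].

Definition E0 (R : realType) (L : R) (a f g : R -> R) : R :=
  energy L (Lop L a f g) f.

Definition V (R : realType) (L : R) (a p q : R -> R) (eps1 C0 : R)
    (f g : R -> R) : R :=
  V1 L p q eps1 f g + C0 * E0 L a f g.

Definition Vs (R : realType) (L : R) (a p q : R -> R) (eps1 C0 : R)
    (f g : R -> R) : R :=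
  V1 L p q eps1 g (fun x => Dx L (Dx L f) x - a x * g x) + C0 * energy L f g.

(** * Constants *)

Definition cstC1 (R : realType) (L : R) (p'' : R -> R) : R :=
  (1 + Linfty_norm L p'') / 2.

Definition cstC2 (R : realType) (L : R) (a p q : R -> R) (eta : R) : R :=
  Linfty_norm L a *
  (Linfty_norm L q ^+ 2 / (4 * eta) + Linfty_norm L p ^+ 2 / 2).

Definition cstK (R : realType) (L : R) (p q' : R -> R) : R :=
  sup [set Num.max (p x - q' x / 2) 0 | x in `[0, L]].

Definition cstC3 (R : realType) (L : R) (a p q q' : R -> R) (amin deltap : R)
    : R :=
  cstK L p q' / amin + cstC2 L a p q (deltap / 2).

Definition cstC0 (R : realType) (L : R) (p'' : R -> R) (amin eps1 : R) : R :=
  eps1 * cstC1 L p'' / amin.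

Definition cst_delta1 (R : realType) (eps1 deltap : R) : R :=
  eps1 * deltap / 2.

Definition cst_delta2 (R : realType) (amin eps1 deltaq : R) : R :=
  Num.min (amin / 2) (eps1 * deltaq / 2).

Definition cst_gamma (R : realType) (amin eps1 deltap deltaq C5 : R) : R :=
  2 * Num.min (cst_delta1 eps1 deltap) (cst_delta2 amin eps1 deltaq) / C5.

(** * Differential inequalities in D'(0,+oo) *)

(* u is continuous on [0,+oo[ (so that it defines a distribution) and its
   distributional derivative satisfies u' <= w in D'(0,+oo). *)
Definition distr_derivative_le (R : realType) (u w : R -> R) : Prop :=
  {within `[0, +oo[, continuous u} /\
  forall phi : R -> R, test_function `]0, +oo[ phi ->
    (forall t, 0 <= phi t) ->
    - (\int[lebesgue_measure]_(t in `]0, +oo[) (u t * derive1 phi t)) <=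
    \int[lebesgue_measure]_(t in `]0, +oo[) (w t * phi t).

(* Main.v *)
(** The time derivative of a strong solution y is a weak solution with data (y_t, y_tt),
    and L (y_t, y_tt) = y, so that V_s (y, y_t) is the functional V evaluated at (y_t, y_tt).
    Since y_tt is merely continuous in time with values in L^2, it is not differentiated;
    the argument is run on the difference quotient w = (y (t + h) - y t) / h instead, which is
    again a strong solution. For it, V_1 (w, w_t) is differentiable in t; integrating by parts
    in x and absorbing the cross terms bounds its derivative by - 2 min (delta_1, delta_2) E (w, w_t)
    plus eps_1 C_1 times the integral of w ^ 2 over ]x_0, x_1[. This last term is compensated by
    C_0 times the average of t |-> E (y, y_t) over [t, t + h]: the derivative of this average
    is the difference quotient of the energy, which is at most - a_min times the same integral.
    Integrating in time and letting h tend to 0 (Fatou) gives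
    V_s (t_2) - V_s (t_1) <= - 2 min (delta_1, delta_2) times the integral of E (y_t, y_tt), and
    E (y_t, y_tt) >= V_s / C_5. Part (i) only uses the sharp Poincare inequality
    and the bound on eps_1. *)

From HB Require Import structures.
Require Import Defs.
From mathcomp Require Import all_boot all_order all_algebra.
From mathcomp Require Import all_classical all_reals all_analysis.
From mathcomp Require Import measurable_realfun ess_sup_inf ring lra.
Set Implicit Arguments.
Unset Strict Implicit.
Unset Printing Implicit Defensive.
Import Order.TTheory GRing.Theory Num.Theory.
Import numFieldNormedType.Exports.
Local Open Scope classical_set_scope.
Local Open Scope ring_scope.

(** * Smooth cutoff functions *)

Section smooth.
Variable R : realType.
Implicit Types f g : R -> R.

(** [Dx] is only determined up to null sets, while boundary terms need point values. Through the
    lemma of du Bois-Reymond every H^1 function gets an absolutely continuous representative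
    ([prim]), for which the product rule is a case of Fubini; all integrations by parts in x rest on
    it. In time the obstacle is that the energy derivative sees y_t at single instants, whereas w is
    the mean of y_t over [t, t + h]. Averaging the energy over the same window makes the two
    comparable, since the square of a mean is at most the mean of the squares. Constants: eps_1 C_3
    <= 1/2 spends half of the damping a w_t^2 on the cross terms, and the other half leaves a_min /
    2 in delta_2; the Young weight eta = delta_p / 2 leaves delta_p / 2 in delta_1; the w^2 term
    collects 1/2 from Young and |p''| / 2 from integrating p w w_xx by parts twice, whence C_1; and
    C_0 = eps_1 C_1 / a_min is the multiple of the energy that cancels this term. *)

Fixpoint Dn (n : nat) f : Prop :=
  (forall x : R, derivable f x 1) /\ (if n is m.+1 then Dn m (derive1 f) else True).

(** [Dn] differentiates before recursing, the form in which closure under sums, products and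
    inverses goes by induction with f generalised; this lemma returns to the form used by
    [test_function]. *)
Lemma DnP f : (forall n, Dn n f) <-> (forall n x, derivable (derive1n n f) x 1).
Proof.
split.
  move=> h n; move: f h; elim: n => [|n ih] f h.
    by have [] := h 0%N.
  rewrite derive1Sn; apply: ih => n0; by have [] := h n0.+1.
move=> h n; move: f h; elim: n => [|n ih] f h /=; first by split=> //; exact: (h 0%N).
split; first exact: (h 0%N).
by apply: ih => k x; rewrite -derive1Sn; exact: h.
Qed.

Lemma Dn_ext n f g : f =1 g -> Dn n f -> Dn n g.
Proof. by move=> /funext ->. Qed.

Lemma DnW n f : Dn n.+1 f -> Dn n f.
Proof.
elim: n f => [|n ih] f /= [df h]; first by split.
by split=> //; apply: ih.
Qed.

Lemma DnS n f f' : (forall x : R, is_derive x 1 f (f' x)) -> Dn n f' -> Dn n.+1 f.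
Proof.
move=> h hf' /=; split; first by move=> x; have := h x.
apply: Dn_ext hf' => x; rewrite derive1E; symmetry.
by have h1 := h x; rewrite derive_val.
Qed.

Lemma Dn_cst n (c : R) : Dn n (fun=> c).
Proof.
elim: n c => [|n ih] c; first by split => // x; exact: derivable_cst.
by apply: (@DnS _ _ (fun=> 0)) => // x; apply: is_derive_cst.
Qed.

Lemma DnD n f g : Dn n f -> Dn n g -> Dn n (fun x => f x + g x).
Proof.
elim: n f g => [|n ih] f g /= [df hf] [dg hg].
  by (split; last by []); move=> x; exact: (derivableD (df x) (dg x)).
split; first by move=> x; exact: (derivableD (df x) (dg x)).
apply: Dn_ext (ih _ _ hf hg) => x /=.
by rewrite !derive1E deriveD.
Qed.

Lemma DnM n f g : Dn n f -> Dn n g -> Dn n (fun x => f x * g x).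
Proof.
elim: n f g => [|n ih] f g.
  by case=> df _ [dg _]; (split; last by []); move=> x; exact: (derivableM (df x) (dg x)).
move=> Hf Hg; have [df hf] := Hf; have [dg hg] := Hg.
split; first by move=> x; exact: (derivableM (df x) (dg x)).
apply: Dn_ext (DnD (ih _ _ (DnW Hf) hg) (ih _ _ (DnW Hg) hf)) => x /=.
by rewrite !derive1E deriveM.
Qed.

Lemma is_derive_comp f g (x a b : R) : is_derive (g x) (1 : R) f a ->
  is_derive x (1 : R) g b -> is_derive x (1 : R) (fun y : R => f (g y)) (a * b).
Proof. move=> hf hg; exact: (is_derive1_comp hf hg). Qed.

Lemma is_derive_affine (c d x : R) : is_derive x (1 : R) (fun y : R => c * y + d) c.
Proof.
have h1 : is_derive x (1 : R) (fun y : R => c * y) c.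
  by have := is_deriveZ c (is_derive_id x (1 : R)); rewrite /GRing.scale /= mulr1.
have := is_deriveD h1 (is_derive_cst d x (1 : R)).
by rewrite addr0.
Qed.

Lemma Dn_affine n f (c d : R) : Dn n f -> Dn n (fun x => f (c * x + d)).
Proof.
have dcomp (g : R -> R) : (forall x : R, derivable g x 1) ->
    forall x : R, is_derive x 1 (fun y => g (c * y + d)) ((derive1 g) (c * x + d) * c).
  move=> dg x; have h : is_derive (c * x + d) (1 : R) g (derive1 g (c * x + d)).
    by rewrite derive1E; exact: derivableP.
  exact: (@is_derive_comp g (fun y => c * y + d) x _ _ h (is_derive_affine c d x)).
elim: n f => [|n ih] f [df hf].
  by (split; last by []); move=> x; have [] := dcomp _ df x.
by apply: (DnS (dcomp _ df)); apply: DnM; [exact: ih | exact: Dn_cst].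
Qed.

(** The derivative - f' / f^2 contains 1 / f itself, but only at the lower order covered by the
    induction. *)
Lemma DnV n f : (forall x, f x != 0) -> Dn n f -> Dn n (fun x => (f x)^-1).
Proof.
move=> f0; elim: n => [|n ih].
  by move=> [df _]; (split; last by []); move=> x; apply: derivableV.
move=> Hf; have [df hf] := Hf.
have dV (x : R) : is_derive x (1 : R) (fun x => (f x)^-1) (-1 * derive1 f x * ((f x)^-1 * (f x)^-1)).
  apply: DeriveDef; first exact: derivableV.
  rewrite deriveV// derive1E /GRing.scale/=.
  by rewrite -exprVn expr2; ring.
have h : Dn n (fun x => -1 * derive1 f x * ((f x)^-1 * (f x)^-1)).
  apply: DnM; first by apply: DnM => //; exact: Dn_cst.
  by apply: DnM; exact: ih (DnW Hf).
exact: (DnS dV h).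
Qed.

(* x |-> P (1 / x) exp (- 1 / x), extended by 0 to x <= 0: a class of functions closed under
   differentiation. *)
Definition flat (P : {poly R}) (x : R) : R :=
  if 0 < x then P.[x^-1] * expR (- x^-1) else 0.

(** The exponential series gives exp y >= y^(n+2) / (n+2)!, so a monomial y^n exp (- y) is at most
    (n+2)! / y^2; take y = 1 / x. A bound quadratic in x is what forces the derivative at 0 to
    vanish. *)
Lemma flat_bound P : exists C : R, forall x, `|flat P x| <= C * x ^+ 2.
Proof.
have mono n (y : R) : 0 < y -> y ^+ n * expR (- y) <= n.+2`!%:R * (y^-1) ^+ 2.
  move=> y0; rewrite expRN exprVn.
  have h := expR_ge1Dxn n.+1 (ltW y0).
  have h2 : y ^+ n.+2 <= n.+2`!%:R * expR y.
    rewrite -ler_pdivrMl ?ltr0n ?fact_gt0// mulrC.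
    by apply: le_trans h; rewrite lerDr.
  rewrite ler_pdivrMr ?expR_gt0// mulrAC ler_pdivlMr ?exprn_gt0//.
  by rewrite -exprD addn2.
exists (\sum_(i < size P) `|P`_i| * i.+2`!%:R) => x; rewrite /flat.
case: ifPn => x0; last first.
  rewrite normr0; apply: mulr_ge0; last exact: sqr_ge0.
  by apply: sumr_ge0 => i _; apply: mulr_ge0.
rewrite normrM (ger0_norm (expR_ge0 _)) horner_coef.
apply: (le_trans (ler_wpM2r (expR_ge0 _) (ler_norm_sum _ _ _))).
rewrite !mulr_suml; apply: ler_sum => i _.
rewrite normrM normrX [`|x^-1|]gtr0_norm ?invr_gt0// -mulrA -[leRHS]mulrA.
apply: ler_wpM2l => //.
have := @mono i x^-1; rewrite invr_gt0 invrK; exact.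
Qed.

Lemma is_derive0_sqr_bound f (C : R) :
  (forall x, `|f x| <= C * x ^+ 2) -> is_derive (0 : R) (1 : R) f 0.
Proof.
move=> h; have C0 : 0 <= C by have := h 1; rewrite expr1n mulr1; exact: le_trans.
have f0 : f 0 = 0 by apply/normr0_eq0/le_anti; rewrite normr_ge0 andbT (le_trans (h 0))// expr0n mulr0.
have cv : h^-1 *: (f (h *: (1:R) + 0) - f 0) @[h --> (0:R)^'] --> (0:R).
  apply/cvgr0Pnorm_le => e e0.
  near=> k; rewrite f0 subr0 /GRing.scale /= mulr1 addr0 normrM normfV.
  have k0 : k != 0 by near: k; exact: nbhs_dnbhs_neq.
  rewrite ler_pdivrMl ?normr_gt0//.
  apply: (le_trans (h k)); rewrite -[k ^+ 2]real_normK ?num_real// expr2 mulrA [leRHS]mulrC ler_wpM2r//.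
  have : `|k| <= e / (C + 1).
    near: k; apply: dnbhs0_le; rewrite divr_gt0// ltr_wpDl//.
  rewrite ler_pdivlMr ?ltr_wpDl// => hk; apply: le_trans hk.
  by rewrite mulrDr mulr1 mulrC lerDl.
apply: DeriveDef; last exact/cvg_lim.
by apply/cvg_ex; exists 0.
Unshelve. all: by end_near. Qed.

(** With u = 1 / x the chain rule gives u^2 (P u - P' u) exp (- u), of the same form again; at 0 the
    quadratic bound takes over. *)
Lemma is_derive_flat P x :
  is_derive x (1 : R) (flat P) (flat ('X ^+ 2 * (P - P^`())) x).
Proof.
have [x0|x0|->] := ltgtP x 0.
- rewrite {2}/flat ltNge (ltW x0)/=.
  apply: (@near_eq_is_derive _ _ _ (cst 0)) => //.
    near=> y; rewrite /flat ifF//; apply/negbTE; rewrite -leNgt ltW//.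
    by near: y; exact: lt_nbhsl.
- rewrite {2}/flat x0.
  have xn0 : x != 0 by rewrite gt_eqF.
  have dV : is_derive x (1 : R) (fun y : R => y^-1) (- x ^- 2).
    have := is_deriveV (f := id) xn0 (is_derive_id x (1 : R)).
    by rewrite /GRing.scale/= mulr1.
  have dN : is_derive x (1 : R) (fun y : R => - y^-1) (x ^- 2).
    by rewrite -[x ^- 2]opprK; apply: is_deriveN.
  have dP : is_derive x (1 : R) (fun y : R => P.[y^-1]) (P^`().[x^-1] * - x ^- 2).
    exact: (is_derive1_comp (is_derive_poly P x^-1) dV).
  have dE : is_derive x (1 : R) (fun y : R => expR (- y^-1)) (expR (- x^-1) * x ^- 2).
    exact: (@is_derive_comp expR (fun y => - y^-1) x _ _ (is_derive_expR (- x^-1)) dN).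
  have dPE := is_deriveM dP dE.
  have nE : \near x, P.[x^-1] * expR (- x^-1) = flat P x.
    by near=> y; rewrite /flat ifT//; near: y; exact: lt_nbhsr.
  refine (@is_derive_eq _ _ _ _ _ _ _ _ (@near_eq_is_derive _ _ _ _ (flat P) x 1 _ nE dPE) _).
  rewrite /GRing.scale/= hornerM hornerXn hornerD hornerN exprVn.
  ring.
- rewrite {2}/flat ltxx.
  have [C hC] := flat_bound P.
  exact: is_derive0_sqr_bound hC.
Unshelve. all: by end_near. Qed.

Lemma Dn_flat n P : Dn n (flat P).
Proof.
elim: n P => [|n ih] P.
  by split => // x; have [] := is_derive_flat P x.
by apply: (DnS (is_derive_flat P)); exact: ih.
Qed.

Definition smooth_step (x : R) : R :=
  flat 1 x / (flat 1 x + flat 1 (1 - x)).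

Lemma flat1_gt0 (x : R) : 0 < x -> 0 < flat 1 x.
Proof. by move=> x0; rewrite /flat x0 hornerC mul1r expR_gt0. Qed.

Lemma flat_le0 P (x : R) : x <= 0 -> flat P x = 0.
Proof. by move=> x0; rewrite /flat ltNge x0. Qed.

Lemma flat1_ge0 (x : R) : 0 <= flat 1 x.
Proof. by have [/flat1_gt0/ltW|/flat_le0 ->] := ltP 0 x. Qed.

Lemma smooth_step_den (x : R) : 0 < flat 1 x + flat 1 (1 - x).
Proof.
have [x0|x0] := ltP 0 x; first by rewrite ltr_pwDl ?flat1_gt0 ?flat1_ge0.
by rewrite ltr_wpDl ?flat1_ge0// flat1_gt0//; lra.
Qed.

Lemma smooth_step_le0 (x : R) : x <= 0 -> smooth_step x = 0.
Proof. by move=> x0; rewrite /smooth_step flat_le0// mul0r. Qed.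

Lemma smooth_step_ge1 (x : R) : 1 <= x -> smooth_step x = 1.
Proof.
move=> x1; rewrite /smooth_step (@flat_le0 _ (1 - x)) ?addr0; last lra.
by rewrite divff// gt_eqF// flat1_gt0//; lra.
Qed.

Lemma smooth_step_bound (x : R) : 0 <= smooth_step x <= 1.
Proof.
rewrite /smooth_step divr_ge0 ?flat1_ge0 ?(ltW (smooth_step_den _))//=.
by rewrite ler_pdivrMr ?smooth_step_den// mul1r lerDl flat1_ge0.
Qed.

Lemma Dn_smooth_step n : Dn n smooth_step.
Proof.
apply: DnM; first exact: Dn_flat.
apply: DnV; first by move=> x; rewrite gt_eqF// smooth_step_den.
apply: DnD; first exact: Dn_flat.
apply: (@Dn_ext _ (fun x => flat 1 (-1 * x + 1))); first by move=> x /=; congr flat; lra.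
by apply: Dn_affine; exact: Dn_flat.
Qed.

(** The ramps start at b and end at c and have width 1 / n; the support stays in [b, c] for every n,
    while the indicator of ]b, c[ appears in the limit. *)
Definition plateau (b c : R) (n : nat) (x : R) : R :=
  smooth_step (n%:R * (x - b)) * smooth_step (n%:R * (c - x)).

Lemma plateau_bound b c n x : 0 <= plateau b c n x <= 1.
Proof.
have /andP[a1 a2] := smooth_step_bound (n%:R * (x - b)).
have /andP[b1 b2] := smooth_step_bound (n%:R * (c - x)).
by rewrite /plateau mulr_ge0//= mulr_ile1.
Qed.

Lemma plateau_out b c n x : ~~ (b < x < c) -> plateau b c n x = 0.
Proof.
rewrite negb_and -!leNgt /plateau => /orP[h|h].
  by rewrite smooth_step_le0 ?mul0r// mulr_ge0_le0// subr_le0.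
by rewrite [X in _ * X]smooth_step_le0 ?mulr0// mulr_ge0_le0// subr_le0.
Qed.

Lemma plateau_test (A : set R) b c n : `[b, c] `<=` A -> test_function A (plateau b c n).
Proof.
move=> bcA; split.
  apply/DnP => k; apply: DnM.
    apply: (@Dn_ext _ (fun x => smooth_step (n%:R * x + - (n%:R * b)))).
      by move=> x; rewrite mulrBr.
    by apply: Dn_affine; exact: Dn_smooth_step.
  apply: (@Dn_ext _ (fun x => smooth_step (- n%:R * x + n%:R * c))).
    by move=> x; congr smooth_step; ring.
  by apply: Dn_affine; exact: Dn_smooth_step.
exists `[b, c]%classic; split => //; first exact: segment_compact.
move=> x /= /negP h; apply: plateau_out; apply: contra h => /andP[h1 h2].
by rewrite in_itv/= !ltW.
Qed.

Lemma plateau_cvg b c x : plateau b c n x @[n --> \oo] --> (\1_(`]b, c[ : set R) x : R).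
Proof.
rewrite indicE; case: (boolP (x \in _)) => [|h]; last first.
  rewrite (_ : (fun n => _) = cst (0 : R)); first exact: cvg_cst.
  apply/funext => n; apply: plateau_out; apply: contra h => h.
  by rewrite inE /= in_itv.
rewrite inE /= in_itv /= => /andP[bx xc].
apply: cvg_near_cst; near=> n.
have h1 : 1 <= n%:R * (x - b).
  rewrite -ler_pdivrMr ?subr_gt0//; near: n; exact: nbhs_infty_ger.
have h2 : 1 <= n%:R * (c - x).
  rewrite -ler_pdivrMr ?subr_gt0//; near: n; exact: nbhs_infty_ger.
by rewrite /plateau !smooth_step_ge1// mulr1.
Unshelve. all: by end_near. Qed.

End smooth.

(** * Square-integrable functions *)

Section integrals.
Variable R : realType.
Local Notation mu := (@lebesgue_measure R).
Implicit Types (A : set (measurableTypeR R)) (f g m : R -> R).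

Lemma aeS (P Q : R -> Prop) : (forall x, P x -> Q x) ->
  {ae mu, forall x : R, P x} -> {ae mu, forall x : R, Q x}.
Proof. by move=> PQ; apply: (@filterS _ _ (ae_filter_ringOfSetsType mu)). Qed.

Lemma aeS2 (P Q S : R -> Prop) : (forall x, P x -> Q x -> S x) ->
  {ae mu, forall x : R, P x} -> {ae mu, forall x : R, Q x} -> {ae mu, forall x : R, S x}.
Proof. by move=> h; apply: (@filterS2 _ _ (ae_filter_ringOfSetsType mu)). Qed.

Lemma aeS3 (P Q S T : R -> Prop) : (forall x, P x -> Q x -> S x -> T x) ->
  {ae mu, forall x : R, P x} -> {ae mu, forall x : R, Q x} -> {ae mu, forall x : R, S x} ->
  {ae mu, forall x : R, T x}.
Proof. by move=> h; apply: (@filterS3 _ _ (ae_filter_ringOfSetsType mu)). Qed.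

Lemma aeA (P : R -> Prop) : (forall x, P x) -> {ae mu, forall x : R, P x}.
Proof. by move=> h; exact: aeW. Qed.

Definition intg A f := mu.-integrable A (EFin \o f).

Variable A : set (measurableTypeR R).
Hypothesis mA : measurable A.

Lemma intg_meas f : intg A f -> measurable_fun A f.
Proof. by move=> /measurable_int /measurable_EFinP. Qed.

Lemma intgD f g : intg A f -> intg A g -> intg A (fun x => f x + g x).
Proof. by move=> hf hg; have := integrableD mA hf hg. Qed.

Lemma intgN f : intg A f -> intg A (fun x => - f x).
Proof. by move=> hf; have := integrableN hf. Qed.

Lemma intgB f g : intg A f -> intg A g -> intg A (fun x => f x - g x).
Proof. by move=> hf hg; apply: intgD => //; exact: intgN. Qed.

Lemma intgZ c f : intg A f -> intg A (fun x => c * f x).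
Proof. by move=> hf; have := integrableZl mA c hf. Qed.

Lemma intg_le_ae f g : measurable_fun A f ->
  {ae mu, forall x, A x -> `|f x| <= `|g x|} -> intg A g -> intg A f.
Proof.
move=> mf fg /integrableP[mg goo]; apply/integrableP; split.
  exact/measurable_EFinP.
apply: le_lt_trans goo; apply: ae_ge0_le_integral => //.
- by apply: measurableT_comp => //; apply/measurable_EFinP.
- by apply: measurableT_comp.
Qed.

Lemma intg_eq_ae f g : measurable_fun A f ->
  {ae mu, forall x, A x -> f x = g x} -> intg A g -> intg A f.
Proof.
move=> mf fg; apply: intg_le_ae => //.
by apply: filterS fg => x h Ax; rewrite h.
Qed.

Lemma intgM_bdd m f (C : R) : measurable_fun A m ->
  {ae mu, forall x, A x -> `|m x| <= C} -> intg A f -> intg A (fun x => m x * f x).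
Proof.
move=> mm mC hf; apply: (intg_le_ae (g := fun x => C * f x)); last exact: intgZ.
  by apply: measurable_funM => //; exact: intg_meas.
apply: filterS mC => x h Ax; rewrite !normrM; apply: ler_wpM2r => //.
by apply: le_trans (h Ax) _; exact: ler_norm.
Qed.

Lemma intD f g : intg A f -> intg A g ->
  \int[mu]_(x in A) (f x + g x) = \int[mu]_(x in A) f x + \int[mu]_(x in A) g x.
Proof. by move=> hf hg; exact: RintegralD. Qed.

Lemma intB f g : intg A f -> intg A g ->
  \int[mu]_(x in A) (f x - g x) = \int[mu]_(x in A) f x - \int[mu]_(x in A) g x.
Proof. by move=> hf hg; exact: RintegralB. Qed.

Lemma intZ c f : intg A f ->
  \int[mu]_(x in A) (c * f x) = c * \int[mu]_(x in A) f x.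
Proof. by move=> hf; exact: RintegralZl. Qed.

Lemma intN f : intg A f ->
  \int[mu]_(x in A) (- f x) = - \int[mu]_(x in A) f x.
Proof.
move=> hf; rewrite -mulN1r -intZ//; apply: eq_Rintegral => x _.
by rewrite mulN1r.
Qed.

Lemma int_eq_ae f g : measurable_fun A f -> measurable_fun A g ->
  {ae mu, forall x, A x -> f x = g x} ->
  \int[mu]_(x in A) f x = \int[mu]_(x in A) g x.
Proof.
move=> mf mg fg; congr fine; apply: ae_eq_integral => //.
- exact/measurable_EFinP.
- exact/measurable_EFinP.
- by apply: filterS fg => x h Ax; rewrite h.
Qed.

Lemma int_ge0_ae f : intg A f -> {ae mu, forall x, A x -> 0 <= f x} ->
  0 <= \int[mu]_(x in A) f x.
Proof.
move=> hf f0; rewrite (_ : \int[mu]_(x in A) f x = \int[mu]_(x in A) `|f x|).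
  exact: Rintegral_ge0.
apply: int_eq_ae; [exact: intg_meas| |].
  by apply: measurableT_comp => //; exact: intg_meas.
by apply: filterS f0 => x h Ax; rewrite ger0_norm// h.
Qed.

Lemma int_le_ae f g : intg A f -> intg A g ->
  {ae mu, forall x, A x -> f x <= g x} ->
  \int[mu]_(x in A) f x <= \int[mu]_(x in A) g x.
Proof.
move=> hf hg fg; rewrite -subr_ge0 -intB//; apply: int_ge0_ae; first exact: intgB.
by apply: filterS fg => x h Ax; rewrite subr_ge0 h.
Qed.

Lemma int_norm_le f g : intg A f -> intg A g ->
  {ae mu, forall x, A x -> `|f x| <= g x} ->
  `|\int[mu]_(x in A) f x| <= \int[mu]_(x in A) g x.
Proof.
move=> hf hg fg; rewrite ler_norml -intN//; apply/andP; split.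
  apply: int_le_ae => //; first exact: intgN.
  by apply: filterS fg => x /[apply]; rewrite ler_norml => /andP[].
apply: int_le_ae => //.
by apply: filterS fg => x /[apply]; rewrite ler_norml => /andP[].
Qed.

(** Membership in L^2(A). Measurability of f is a separate conjunct because that of f^2 does not
    imply it. *)
Definition sqi f := measurable_fun A f /\ intg A (fun x => f x ^+ 2).

Lemma sqi_mul f g : sqi f -> sqi g -> intg A (fun x => f x * g x).
Proof.
move=> [mf hf] [mg hg].
apply: (intg_le_ae (g := fun x => f x ^+ 2 + g x ^+ 2)).
- exact: measurable_funM.
- apply: aeW => x _; rewrite [leRHS]ger0_norm ?addr_ge0 ?sqr_ge0//.
  rewrite ler_norml.
  have := sqr_ge0 (f x + g x); have := sqr_ge0 (f x - g x).
  have := sqr_ge0 (f x); have := sqr_ge0 (g x).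
  by move=> h1 h2 h3 h4; apply/andP; split; nra.
- exact: intgD.
Qed.

Lemma sqiD f g : sqi f -> sqi g -> sqi (fun x => f x + g x).
Proof.
move=> hf hg; have hfg := sqi_mul hf hg; case: hf => mf hf; case: hg => mg hg.
split; first exact: measurable_funD.
apply: (intg_eq_ae (g := fun x => f x ^+ 2 + g x ^+ 2 + 2 * (f x * g x))).
- by apply: measurable_funX; exact: measurable_funD.
- by apply: aeW => x _; ring.
- by apply: intgD; [exact: intgD | exact: intgZ].
Qed.

Lemma sqi_bdd m f (C : R) : measurable_fun A m ->
  {ae mu, forall x, A x -> `|m x| <= C} -> sqi f -> sqi (fun x => m x * f x).
Proof.
move=> mm mC [mf hf]; split; first exact: measurable_funM.
apply: (intg_le_ae (g := fun x => C ^+ 2 * f x ^+ 2)).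
- by apply: measurable_funX; exact: measurable_funM.
- apply: filterS mC => x h Ax; rewrite exprMn !normrM; apply: ler_wpM2r => //.
  by apply: ler_pM => //; rewrite (le_trans (h Ax))// ler_norm.
- exact: intgZ.
Qed.

Lemma sqiZ c f : sqi f -> sqi (fun x => c * f x).
Proof.
by move=> hf; apply: (@sqi_bdd (fun=> c) f `|c|) => //; exact: aeW.
Qed.

Lemma sqiN f : sqi f -> sqi (fun x => - f x).
Proof.
move=> hf; have := sqiZ (-1) hf.
by congr sqi; apply/funext => x; rewrite mulN1r.
Qed.

Lemma sqiB f g : sqi f -> sqi g -> sqi (fun x => f x - g x).
Proof. by move=> hf hg; apply: sqiD => //; exact: sqiN. Qed.

Lemma sqi0 : sqi (fun=> 0).
Proof.
split => //; apply: (intg_eq_ae (g := fun=> 0)) => //.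
  by apply: aeW => x _; rewrite expr0n.
exact: integrable0.
Qed.

Definition ip f g := \int[mu]_(x in A) (f x * g x).

Lemma ipC f g : ip f g = ip g f.
Proof. by apply: eq_Rintegral => x _; rewrite mulrC. Qed.

Lemma ipDl f g h : sqi f -> sqi g -> sqi h ->
  ip (fun x => f x + g x) h = ip f h + ip g h.
Proof.
move=> sf sg sh; rewrite /ip -intD; [|exact: sqi_mul..].
by apply: eq_Rintegral => x _; rewrite mulrDl.
Qed.

Lemma ipZl c f h : sqi f -> sqi h -> ip (fun x => c * f x) h = c * ip f h.
Proof.
move=> sf sh; rewrite /ip -intZ; last exact: sqi_mul.
by apply: eq_Rintegral => x _; rewrite mulrA.
Qed.

Lemma ipBl f g h : sqi f -> sqi g -> sqi h ->
  ip (fun x => f x - g x) h = ip f h - ip g h.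
Proof.
move=> sf sg sh; rewrite /ip -intB; [|exact: sqi_mul..].
by apply: eq_Rintegral => x _; rewrite mulrBl.
Qed.

Lemma ipDr f g h : sqi f -> sqi g -> sqi h ->
  ip h (fun x => f x + g x) = ip h f + ip h g.
Proof. by move=> *; rewrite ipC ipDl// ipC (ipC g). Qed.

Lemma ipBr f g h : sqi f -> sqi g -> sqi h ->
  ip h (fun x => f x - g x) = ip h f - ip h g.
Proof. by move=> *; rewrite ipC ipBl// ipC (ipC g). Qed.

Lemma ipZr c f h : sqi f -> sqi h -> ip h (fun x => c * f x) = c * ip h f.
Proof. by move=> *; rewrite ipC ipZl// ipC. Qed.

Lemma ip_ge0 f : 0 <= ip f f.
Proof. by apply: Rintegral_ge0 => x _; rewrite -expr2 sqr_ge0. Qed.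

Definition nrm f := Num.sqrt (ip f f).

Lemma nrm_ge0 f : 0 <= nrm f. Proof. exact: sqrtr_ge0. Qed.

Lemma nrm2 f : nrm f ^+ 2 = ip f f.
Proof. by rewrite sqr_sqrtr// ip_ge0. Qed.

Lemma cauchy_schwarz f g : sqi f -> sqi g -> `|ip f g| <= nrm f * nrm g.
Proof.
move=> sf sg.
have key (s t : R) : 0 <= s ^+ 2 * ip f f + 2 * (s * t) * ip f g + t ^+ 2 * ip g g.
  have := ip_ge0 (fun x => s * f x + t * g x).
  have ss := sqiZ s sf; have st := sqiZ t sg.
  rewrite ipDl ?ipDr ?ipZl ?ipZr//; do ?[exact: sqiD]; try (by []).
  by rewrite [ip g f]ipC => h; apply: le_trans h _; rewrite le_eqVlt; apply/orP; left; apply/eqP; ring.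
have h : ip f g ^+ 2 <= ip f f * ip g g.
  have gg := ip_ge0 g; have ff := ip_ge0 f.
  have [g0|g0] := eqVneq (ip g g) 0.
    have [f0|f0] := eqVneq (ip f g) 0; first by rewrite f0 expr0n mulr_ge0.
    (* The form is affine in t when [ip g g] vanishes, and this t gives it the value -1. *)
    have := key 1 (- (ip f f + 1) / (2 * ip f g)).
    rewrite g0 mulr0 addr0 expr1n !mul1r.
    have -> : 2 * (- (ip f f + 1) / (2 * ip f g)) * ip f g = - (ip f f + 1).
      by field.
    lra.
  (* At this point the form equals [ip g g] times the quantity to be shown nonnegative. *)
  have := key (ip g g) (- ip f g).
  have gp : 0 < ip g g by rewrite lt_def g0.
  have -> : ip g g ^+ 2 * ip f f + 2 * (ip g g * - ip f g) * ip f g + (- ip f g) ^+ 2 * ip g g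
     = ip g g * (ip f f * ip g g - ip f g ^+ 2) by ring.
  by rewrite pmulr_rge0// subr_ge0.
rewrite -(@ler_pXn2r _ 2)// ?nnegrE ?mulr_ge0 ?nrm_ge0//.
by rewrite exprMn !nrm2 real_normK ?num_real.
Qed.

Lemma nrmD f g : sqi f -> sqi g -> nrm (fun x => f x + g x) <= nrm f + nrm g.
Proof.
move=> sf sg; rewrite -(@ler_pXn2r _ 2)// ?nnegrE ?addr_ge0 ?nrm_ge0//.
rewrite sqrrD !nrm2 ipDl ?ipDr//; try exact: sqiD.
have := cauchy_schwarz sf sg; have := ler_norm (ip f g).
rewrite [ip g f]ipC mulr2n; lra.
Qed.

Lemma nrmZ c f : sqi f -> nrm (fun x => c * f x) = `|c| * nrm f.
Proof.
move=> sf; have sc := sqiZ c sf.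
by rewrite /nrm ipZl// ipZr// mulrA -expr2 sqrtrM ?sqr_ge0// sqrtr_sqr.
Qed.

Lemma nrm_eq_ae f g : measurable_fun A f -> measurable_fun A g ->
  {ae mu, forall x, A x -> f x = g x} -> nrm f = nrm g.
Proof.
move=> mf mg fg; rewrite /nrm; congr Num.sqrt; apply: int_eq_ae.
- exact: measurable_funM.
- exact: measurable_funM.
- by apply: filterS fg => x h Ax; rewrite h.
Qed.

Lemma nrm_bdd m f (C : R) : measurable_fun A m -> 0 <= C ->
  {ae mu, forall x, A x -> `|m x| <= C} -> sqi f ->
  nrm (fun x => m x * f x) <= C * nrm f.
Proof.
move=> mm C0 mC sf; have sm := sqi_bdd mm mC sf.
rewrite -(@ler_pXn2r _ 2)// ?nnegrE ?mulr_ge0 ?nrm_ge0//.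
rewrite exprMn !nrm2 -intZ; last exact: sqi_mul.
apply: int_le_ae; [exact: sqi_mul | by apply: intgZ; exact: sqi_mul |].
apply: filterS mC => x h Ax.
rewrite -!expr2 exprMn; apply: ler_wpM2r; first exact: sqr_ge0.
by rewrite -[m x ^+ 2]real_normK ?num_real// lerXn2r ?nnegrE// h.
Qed.

End integrals.

(** * Absolutely continuous functions *)

Section primitive.
Variable R : realType.
Local Notation mu := (@lebesgue_measure R).
Local Notation oo a b := (`]a, b[%classic : set (measurableTypeR R)).
Implicit Types (f g k : R -> R) (a b c x y : R).

Lemma intg_sub (A B : set (measurableTypeR R)) f : measurable A -> measurable B ->
  B `<=` A -> intg A f -> intg B f.
Proof. move=> mA mB BA; exact: integrableS. Qed.

(** Endpoints are null sets. This is the bridge between the open interval of [int0L] and the closed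
    intervals of the fundamental theorem of calculus. *)
Lemma intg_cc a b f : intg (oo a b) f -> intg (`[a, b]%classic : set (measurableTypeR R)) f.
Proof.
move=> hf; have mf := intg_meas hf.
have mf2 : measurable_fun (`[a, b]%classic : set (measurableTypeR R)) f.
  exact: (@measurable_fun_itv_cc _ a b false true f mf).
apply/integrableP; split; first exact/measurable_EFinP.
rewrite -integral_itv_obnd_cbnd; last first.
  apply: measurableT_comp => //; apply/measurable_EFinP.
  apply: measurable_funS mf2 => //; exact: subset_itv_oc_cc.
rewrite -integral_itv_bndo_bndc; last first.
  by apply: measurableT_comp => //; apply/measurable_EFinP.
by case/integrableP : hf.
Qed.

Lemma int_cc a b f : intg (oo a b) f ->
  \int[mu]_(t in `[a, b]) f t = \int[mu]_(t in `]a, b[) f t.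
Proof.
move=> hf; have hc := intg_cc hf.
rewrite -Rintegral_itv_obnd_cbnd; last first.
  by apply: intg_sub hc => //; exact: subset_itv_oc_cc.
by rewrite -Rintegral_itv_bndo_bndc.
Qed.

Lemma intg_oo a b f : intg (`[a, b]%classic : set (measurableTypeR R)) f -> intg (oo a b) f.
Proof. by apply: intg_sub => //; exact: subset_itv_oo_cc. Qed.

Lemma intg_oo_sub a b c d f : a <= c -> d <= b -> intg (oo a b) f -> intg (oo c d) f.
Proof.
move=> ac db; apply: intg_sub => //; apply: subset_itv; by rewrite bnd_simp.
Qed.

Lemma chasles a b c f : a <= c -> c <= b -> intg (oo a b) f ->
  \int[mu]_(t in `]a, b[) f t = \int[mu]_(t in `]a, c[) f t + \int[mu]_(t in `]c, b[) f t.
Proof.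
move=> ac cb hf.
have h1 : intg (oo a c) f by apply: intg_oo_sub hf.
rewrite -(int_cc h1) -[\int[mu]_(t in `[a, c]) f t]Rintegral_itv_obnd_cbnd; last first.
  by apply: (intg_sub _ _ _ (intg_cc h1)) => //; exact: subset_itv_oc_cc.
have [cb'|bc] := ltP c b; last first.
  have -> : c = b by apply/le_anti/andP.
  rewrite set_itvoo0 Rintegral_set0 addr0 -Rintegral_itv_bndo_bndc//.
have <- := @Rintegral_itvB _ f (BRight a) (BLeft b) c hf ac cb'.
by rewrite addrC subrK.
Qed.

Lemma int_bound a b f (C : R) : a <= b -> measurable_fun (oo a b) f ->
  {ae mu, forall x, (oo a b) x -> `|f x| <= C} ->
  intg (oo a b) f /\ `|\int[mu]_(t in `]a, b[) f t| <= C * (b - a).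
Proof.
move=> ab mf hC.
have hc : intg (oo a b) (fun=> C).
  apply: intg_oo; apply: continuous_compact_integrable; first exact: segment_compact.
  by move=> x; exact: cvg_cst.
have hf : intg (oo a b) f.
  apply: (@intg_le_ae _ _ _ _ (fun=> C)) => //.
  by apply: aeS hC => x h Ax; apply: le_trans (h Ax) _; exact: ler_norm.
split => //; apply: (le_trans (int_norm_le _ hf hc hC)) => //.
have e : mu (oo a b) = (b - a)%:E.
  rewrite lebesgue_measure_itv /= lte_fin; case: ltP => // ba.
  by have -> : b = a; [apply/le_anti/andP | rewrite subrr].
have <- : fine (mu (oo a b)) = b - a by rewrite e.
by rewrite (Rintegral_cst mu (measurable_itv _)); exact: lexx.
Qed.

(** The interval is empty for x <= 0, where the value is therefore 0; the primitive is thus a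
    function on the whole line. *)
Definition Pint g x := \int[mu]_(t in `]0, x[) g t.

Lemma Pint0 g : Pint g 0 = 0.
Proof. by rewrite /Pint set_itvoo0 Rintegral_set0. Qed.

Lemma Pint_cont L g : 0 <= L -> intg (oo 0 L) g ->
  {within `[0, L], continuous (Pint g)}.
Proof.
move=> L0 hg.
have := parameterized_integral_continuous L0 (intg_cc hg).
apply: subspace_eq_continuous => x; rewrite inE/= in_itv/= => /andP[x0 xL].
change (parameterized_integral mu 0 x g = Pint g x).
by rewrite /parameterized_integral int_cc//; apply: intg_oo_sub hg.
Qed.

Lemma Pint_meas L g : 0 <= L -> intg (oo 0 L) g -> measurable_fun (oo 0 L) (Pint g).
Proof.
move=> L0 hg; apply: (@measurable_funS _ _ _ _ `[0, L]%classic).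
- exact: measurable_itv.
- exact: subset_itv_oo_cc.
- by apply: subspace_continuous_measurable_fun; [exact: measurable_itv|exact: Pint_cont].
Qed.

Lemma Pint_bound L g x : intg (oo 0 L) g -> x <= L ->
  `|Pint g x| <= \int[mu]_(t in `]0, L[) `|g t|.
Proof.
move=> hg xL.
have hn : intg (oo 0 L) (fun t => `|g t|) by exact: integrable_norm.
have [x0|x0] := leP 0 x; last first.
  rewrite /Pint set_itv_ge; last by rewrite bnd_simp -leNgt ltW.
  by rewrite Rintegral_set0 normr0; exact: Rintegral_ge0.
have hx : intg (oo 0 x) g by apply: intg_oo_sub hg.
have hnx : intg (oo 0 x) (fun t => `|g t|) by apply: intg_oo_sub hn.
apply: (le_trans (int_norm_le _ hx hnx _)) => //; first exact: aeW.
rewrite (chasles x0 xL hn) lerDl; exact: Rintegral_ge0.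
Qed.

(** Integrand of a double integral over the triangle below the diagonal, extended by zero to the
    plane; its inner integrals in the two orders produce the primitives of k and of g. *)
Definition tri L g k (z : measurableTypeR R * measurableTypeR R) : R :=
  if z.2 < z.1 then (g \_ (oo 0 L)) z.1 * (k \_ (oo 0 L)) z.2 else 0.

Lemma intg_ext L g : intg (oo 0 L) g -> intg setT (g \_ (oo 0 L)).
Proof.
move=> hg; have := (@integrable_mkcond _ _ _ mu (oo 0 L) (EFin \o g) (measurable_itv _)).1 hg.
by rewrite restrict_EFin.
Qed.

Lemma EFin_int (A : set (measurableTypeR R)) f : measurable A -> intg A f ->
  (\int[mu]_(x in A) (f x)%:E)%E = (\int[mu]_(x in A) f x)%:E.
Proof. by move=> mA hf; rewrite /Rintegral fineK//; exact: integrable_fin_num hf. Qed.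

Lemma tri_inner1 L g k x : intg (oo 0 L) g -> intg (oo 0 L) k ->
  (\int[mu]_y (tri L g k (x, y))%:E)%E = (((fun s => g s * Pint k s) \_ (oo 0 L)) x)%:E.
Proof.
move=> hg hk; rewrite patchE; case: ifPn => xD; last first.
  rewrite integral0_eq// => y _; rewrite /tri /= !patchE (negbTE xD).
  by case: ifPn => // _; rewrite mul0r.
move: (xD); rewrite inE /= in_itv /= => /andP[x0 xL].
have hkx : intg (oo 0 x) k by apply: intg_oo_sub hk => //; exact: ltW.
rewrite (_ : (fun y => _) = (fun y => (g x * (k \_ (oo 0 x)) y)%:E)); last first.
  apply/funext => y; congr EFin; rewrite /tri /= [in LHS]patchE xD.
  rewrite !patchE !mem_setE !in_itv/=.
  case: ltP => yx /=; last by rewrite andbF mulr0.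
  by rewrite (lt_trans yx xL).
have hkx' := intg_ext hkx.
rewrite EFin_int//; last exact: intgZ.
by rewrite intZ// /Pint [in RHS]Rintegral_mkcond.
Qed.

Lemma tri_inner2 L g k y : intg (oo 0 L) g -> intg (oo 0 L) k ->
  (\int[mu]_x (tri L g k (x, y))%:E)%E =
  (((fun s => k s * (Pint g L - Pint g s)) \_ (oo 0 L)) y)%:E.
Proof.
move=> hg hk; rewrite patchE; case: ifPn => yD; last first.
  rewrite integral0_eq// => x _; rewrite /tri /= !patchE (negbTE yD).
  by case: ifPn => // _; rewrite mulr0.
move: (yD); rewrite inE /= in_itv /= => /andP[y0 yL].
have hgy : intg (oo y L) g by apply: intg_oo_sub hg => //; exact: ltW.
rewrite (_ : (fun x => _) = (fun x => (k y * (g \_ (oo y L)) x)%:E)); last first.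
  apply/funext => x; congr EFin; rewrite /tri /= [X in _ * X]patchE yD.
  rewrite !patchE !mem_setE !in_itv/= [RHS]mulrC.
  case: ltP => yx /=; last by rewrite mul0r.
  by rewrite (lt_trans y0 yx).
have hgy' : intg setT (g \_ (oo y L)).
  have := (@integrable_mkcond _ _ _ mu (oo y L) (EFin \o g) (measurable_itv _)).1 hgy.
  by rewrite restrict_EFin.
rewrite EFin_int//; last exact: intgZ.
rewrite intZ// -Rintegral_mkcond.
by rewrite /Pint (chasles (ltW y0) (ltW yL) hg) addrC addKr.
Qed.

Lemma intg_Pint L g k : 0 <= L -> intg (oo 0 L) g -> intg (oo 0 L) k ->
  intg (oo 0 L) (fun t => g t * Pint k t).
Proof.
move=> L0 hg hk.
apply: (@intg_eq_ae _ _ _ _ (fun t => Pint k t * g t)) => //.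
- by apply: measurable_funM; [exact: intg_meas hg | exact: Pint_meas].
- by apply: aeW => x _; rewrite mulrC.
apply: (@intgM_bdd _ _ _ _ _ (\int[mu]_(t in `]0, L[) `|k t|)) => //; first exact: Pint_meas.
by apply: aeW => x /=; rewrite in_itv/= => /andP[_ /ltW]; exact: Pint_bound.
Qed.

(* Fubini on the triangle 0 < t < s < L. *)
Lemma Pint_fubini L g k : 0 <= L -> intg (oo 0 L) g -> intg (oo 0 L) k ->
  \int[mu]_(t in `]0, L[) (g t * Pint k t) =
  Pint g L * Pint k L - \int[mu]_(t in `]0, L[) (k t * Pint g t).
Proof.
move=> L0 hg hk.
have mh : measurable_fun setT (tri L g k).
  apply: measurable_fun_ifT => //.
    by apply: measurable_fun_ltr.
  apply: measurable_funM.
    by apply: (measurableT_comp (f := g \_ (oo 0 L))) => //; exact: intg_meas (intg_ext hg).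
  by apply: (measurableT_comp (f := k \_ (oo 0 L))) => //; exact: intg_meas (intg_ext hk).
have hg' : intg (oo 0 L) (fun t => `|g t|) by exact: integrable_norm.
have hk' : intg (oo 0 L) (fun t => `|k t|) by exact: integrable_norm.
(* The absolute value of [tri L g k] is [tri] of |g| and |k|, so the iterated integral in Tonelli's
   criterion is given by the same inner integral. *)
have ih : (mu \x mu)%E.-integrable setT (EFin \o tri L g k).
  apply/integrable12ltyP; first exact/measurable_EFinP.
  under eq_integral => x _.
    rewrite (_ : (fun y => _) = fun y => (tri L (fun t => `|g t|) (fun t => `|k t|) (x, y))%:E); last first.
      apply/funext => y; rewrite /= /tri /=; congr EFin; case: ifPn => _; last by rewrite normr0.
      by rewrite normrM !patchE; case: ifPn => _; case: ifPn => _; rewrite ?normr0.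
    rewrite tri_inner1//.
  over.
  have := intg_ext (intg_Pint L0 hg' hk').
  by move=> /integrable_lty; exact.
have := Fubini ih.
under eq_integral => x _ do rewrite /= tri_inner1//.
under [in X in _ = X -> _]eq_integral => x _ do rewrite /= tri_inner2//.
move=> /(congr1 fine).
rewrite -/(Rintegral mu setT _) -[X in _ = X -> _]/(Rintegral mu setT _) -!Rintegral_mkcond => ->.
rewrite -intZ// -intB//.
- by apply: eq_Rintegral => t _; ring.
- exact: intgZ.
- exact: intg_Pint.
Qed.

End primitive.

(** * Product rule, test functions and the fundamental lemma of the calculus of variations *)

Section prim.
Variable R : realType.
Local Notation mu := (@lebesgue_measure R).
Local Notation oo a b := (`]a, b[%classic : set (measurableTypeR R)).
Implicit Types (f g k phi : R -> R) (a b c x y : R).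

Lemma dct (A : set (measurableTypeR R)) (u : nat -> R -> R) (v g : R -> R) : measurable A ->
  (forall n, measurable_fun A (u n)) -> measurable_fun A v -> intg A g ->
  (forall n x, A x -> `|u n x| <= g x) ->
  (forall x, A x -> u n x @[n --> \oo] --> v x) ->
  \int[mu]_(x in A) u n x @[n --> \oo] --> \int[mu]_(x in A) v x.
Proof.
move=> mA mu_ mv hg hb hc.
have hce x : A x -> (u n x)%:E @[n --> \oo] --> (v x)%:E.
  by move=> Ax; apply: cvg_EFin; [exact: nearW | exact: hc].
have [| | | | |iv _ hcv] := @dominated_convergence _ _ _ mu A mA
    (fun n x => (u n x)%:E) (fun x => (v x)%:E) (EFin \o g).
- by move=> n; apply/measurable_EFinP.
- exact/measurable_EFinP.
- exact: aeW.
- exact: hg.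
- by apply: aeW => x n Ax; rewrite lee_fin; exact: hb.
move: hcv; rewrite EFin_int// => hcv.
exact: (fine_cvg hcv).
Qed.

Lemma intg_eq (A : set (measurableTypeR R)) f g : measurable A ->
  (forall x, A x -> f x = g x) -> intg A f -> intg A g.
Proof.
move=> mA fg; apply: eq_integrable => // x; rewrite inE => Ax /=.
by rewrite fg.
Qed.

Lemma int_eq (A : set (measurableTypeR R)) f g :
  (forall x, A x -> f x = g x) -> \int[mu]_(x in A) f x = \int[mu]_(x in A) g x.
Proof. by move=> fg; apply: eq_Rintegral => x; rewrite inE => Ax; rewrite fg. Qed.

Lemma meas_eq (A : set (measurableTypeR R)) f g :
  (forall x, A x -> f x = g x) -> measurable_fun A f -> measurable_fun A g.
Proof.
by move=> fg; apply: eq_measurable_fun => x; rewrite inE => Ax; rewrite fg.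
Qed.

(* f is absolutely continuous on [0, L], and g is its derivative. *)
Definition prim (L : R) f g :=
  intg (oo 0 L) g /\ forall x, 0 <= x <= L -> f x = f 0 + Pint g x.

Lemma prim_meas L f g : 0 <= L -> prim L f g -> measurable_fun (oo 0 L) f.
Proof.
move=> L0 [hg hf]; apply: (@meas_eq _ (fun x => f 0 + Pint g x)).
  by move=> x /=; rewrite in_itv/= => /andP[x0 xL]; rewrite -hf// !ltW.
by apply: measurable_funD => //; exact: Pint_meas.
Qed.

Lemma prim_bound L f g : 0 <= L -> prim L f g ->
  exists2 C, 0 <= C & forall x, 0 <= x <= L -> `|f x| <= C.
Proof.
move=> L0 [hg hf]; exists (`|f 0| + \int[mu]_(t in `]0, L[) `|g t|).
  by apply: addr_ge0 => //; exact: Rintegral_ge0.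
move=> x xL; rewrite hf//; apply: (le_trans (ler_normD _ _)).
by rewrite lerD2l; apply: Pint_bound => //; case/andP: xL.
Qed.

Lemma prim_total L f g : 0 <= L -> prim L f g -> \int[mu]_(x in `]0, L[) g x = f L - f 0.
Proof.
by move=> L0 [hg hf]; rewrite [f L]hf ?lexx ?L0// addrC addKr.
Qed.

(** After splitting off the values at 0, the only term that is not linear is the product of two
    primitives, and this is Fubini on the triangle over ]0, x[. *)
Lemma primM L f g f2 g2 : 0 <= L -> prim L f g -> prim L f2 g2 ->
  prim L (fun x => f x * f2 x) (fun x => g x * f2 x + f x * g2 x).
Proof.
move=> L0 pf pf2; have [hg hf] := pf; have [hg2 hf2] := pf2.
have i1 : intg (oo 0 L) (fun x => f2 0 * g x + g x * Pint g2 x).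
  by apply: intgD => //; [exact: intgZ | exact: intg_Pint].
have i2 : intg (oo 0 L) (fun x => f 0 * g2 x + g2 x * Pint g x).
  by apply: intgD => //; [exact: intgZ | exact: intg_Pint].
have e x : 0 <= x <= L -> (f2 0 * g x + g x * Pint g2 x) + (f 0 * g2 x + g2 x * Pint g x)
   = g x * f2 x + f x * g2 x.
  by move=> xL; rewrite [f x]hf// [f2 x]hf2//; ring.
have ooW x y : (oo 0 y) x -> y <= L -> 0 <= x <= L.
  by rewrite /= in_itv/= => /andP[x0 xy] yL; rewrite (ltW x0)/= (le_trans (ltW xy)).
split.
  apply: (@intg_eq _ _ _ _ _ (intgD _ i1 i2)) => // x h; exact/e/(ooW _ _ h).
move=> x /andP[x0 xL].
have -> : Pint (fun x0 => g x0 * f2 x0 + f x0 * g2 x0) x =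
    \int[mu]_(t in `]0, x[) ((f2 0 * g t + g t * Pint g2 t) + (f 0 * g2 t + g2 t * Pint g t)).
  by apply: int_eq => t h; rewrite e//; exact: ooW h _.
have [hgx hg2x] : intg (oo 0 x) g /\ intg (oo 0 x) g2.
  by split; [apply: intg_oo_sub hg|apply: intg_oo_sub hg2].
rewrite intD//; [|by apply: intg_oo_sub i1|by apply: intg_oo_sub i2].
rewrite intD//; [|exact: intgZ|exact: intg_Pint].
rewrite intD//; [|exact: intgZ|exact: intg_Pint].
rewrite !intZ// (Pint_fubini x0 hgx hg2x) -/(Pint g x) -/(Pint g2 x).
rewrite [f x]hf ?x0// [f2 x]hf2 ?x0//; ring.
Qed.

Lemma prim_C1 L f f' : 0 <= L -> {within `[0, L], continuous f} ->
  {within `[0, L], continuous f'} ->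
  (forall x, x \in `]0, L[ -> is_derive x (1 : R) f (f' x)) -> prim L f f'.
Proof.
move=> L0 cf cf' df.
have i0 : intg (`[0, L]%classic : set (measurableTypeR R)) f'.
  by apply: continuous_compact_integrable => //; exact: segment_compact.
have hi := intg_oo i0.
split => // x /andP[x0 xL].
have [x0'|x0'] := ltP 0 x; last first.
  by have -> : x = 0; [apply/le_anti/andP | rewrite Pint0 addr0].
have sub : `[0, x] `<=` `[0, L].
  by move=> y /=; rewrite !in_itv/= => /andP[-> yx]; rewrite (le_trans yx).
have cfx := continuous_subspaceW sub cf.
have hix : intg (oo 0 x) f' by apply: intg_oo_sub hi.
have D : derivable_oo_LRcontinuous f 0 x.
  have [h1 h2 h3] := (continuous_within_itvP _ x0').1 cfx.
  split => // y; rewrite in_itv/= => /andP[y0 yx].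
  by have [] := df y; rewrite ?in_itv/= ?y0 ?(lt_le_trans yx).
have := continuous_FTC2 x0' (continuous_subspaceW sub cf') D.
have h : {in `]0, x[, derive1 f =1 f'}.
  move=> y; rewrite in_itv/= => /andP[y0 yx].
  have hy : y \in `]0, L[ by rewrite in_itv/= y0 (lt_le_trans yx).
  by rewrite derive1E; have := df _ hy => hd; rewrite derive_val.
move=> /(_ h); rewrite EFin_int//; last exact: intg_cc.
rewrite int_cc// -EFinB => -[e]; rewrite /Pint e; ring.
Qed.

Lemma cont_bound L f : 0 <= L -> {within `[0, L], continuous f} ->
  measurable_fun (oo 0 L) f /\ exists2 C, 0 <= C & forall x, 0 <= x <= L -> `|f x| <= C.
Proof.
move=> L0 cf; split.
  apply: (@measurable_funS _ _ _ _ `[0, L]%classic).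
  - exact: measurable_itv.
  - exact: subset_itv_oo_cc.
  - by apply: subspace_continuous_measurable_fun => //; exact: measurable_itv.
have cn : {within `[0, L], continuous (fun x => `|f x|)}.
  by move=> x; apply: cvg_norm; exact: cf.
have [c cI hc] := EVT_max L0 cn.
by exists `|f c| => // x xL; apply: hc; rewrite in_itv.
Qed.

Lemma sqi_bounded L f C : 0 <= L -> measurable_fun (oo 0 L) f ->
  (forall x, 0 <= x <= L -> `|f x| <= C) -> sqi (oo 0 L) f.
Proof.
move=> L0 mf hC; split => //.
apply: (@int_bound _ 0 L _ (C ^+ 2) L0 _ _).1; first exact: measurable_funX.
apply: aeA => x; rewrite /= in_itv/= => /andP[x0 xL].
have h : `|f x| <= C by apply: hC; rewrite !ltW.
by rewrite normrX; apply: lerXn2r; rewrite ?nnegrE//; exact: le_trans h.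
Qed.

Lemma cont_sqi L f : 0 <= L -> {within `[0, L], continuous f} -> sqi (oo 0 L) f.
Proof. by move=> L0 /(cont_bound L0) [mf [C C0 hC]]; exact: sqi_bounded hC. Qed.

Lemma sqi_intg L f : 0 <= L -> sqi (oo 0 L) f -> intg (oo 0 L) f.
Proof.
move=> L0 sf; have s1 : sqi (oo 0 L) (fun=> 1).
  by apply: (@sqi_bounded _ _ 1) => // x _; rewrite normr1.
by apply: (@intg_eq _ _ _ _ _ (sqi_mul _ sf s1)) => // x _; rewrite mulr1.
Qed.

Lemma test_supp L phi : 0 < L -> test_function `]0, L[ phi ->
  exists a b, [/\ 0 < a, a <= b, b < L & forall x, ~~ (a <= x <= b) -> phi x = 0].
Proof.
move=> L0 [_ [K [cK KL Kphi]]].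
have [K0|/set0P [z Kz]] := eqVneq K set0.
  exists (L / 2), (L / 2); split; [lra|lra|lra|] => x _; apply: Kphi.
  by rewrite K0.
have cid : {within K, continuous (id : R -> R)}.
  by apply: continuous_subspaceT => x; exact: cvg_id.
have [b bK hb] := compact_EVT_max (ex_intro _ z Kz) cK cid.
have [a aK ha] := compact_EVT_min (ex_intro _ z Kz) cK cid.
move: bK aK; rewrite !inE => bK aK.
have := KL _ bK; have := KL _ aK; rewrite /= !in_itv/= => /andP[a0 aL] /andP[b0 bL].
exists a, b; split => //; first by apply: ha; rewrite inE.
move=> x h; apply: Kphi => Kx; move/negP: h; apply.
by rewrite ha ?inE// hb ?inE.
Qed.

Lemma test_intro L phi a b : 0 < a -> b < L -> (forall n, Dn n phi) ->
  (forall x, ~~ (a <= x <= b) -> phi x = 0) -> test_function `]0, L[ phi.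
Proof.
move=> a0 bL hD h; split; first exact/DnP.
exists `[a, b]%classic; split; first exact: segment_compact.
  by move=> x /=; rewrite !in_itv/= => /andP[ax xb]; rewrite (lt_le_trans a0) ?(le_lt_trans xb).
by move=> x /= /negP; rewrite in_itv/=; exact: h.
Qed.

Lemma test_Dn (A : set R) phi : test_function A phi -> forall n, Dn n phi.
Proof. by case=> /DnP. Qed.

Lemma Dn_continuous n phi : Dn n phi -> continuous phi.
Proof.
move=> h x; have [hd _] : (forall x : R, derivable phi x 1) /\ True by case: n h => [|n] [].
exact/differentiable_continuous/derivable1_diffP.
Qed.

Lemma Dn_derive n phi : Dn n.+1 phi -> Dn n (derive1 phi).
Proof. by case. Qed.

Lemma Dn_is_derive n phi x : Dn n phi -> is_derive x (1 : R) phi (derive1 phi x).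
Proof.
move=> h; have [hd _] : (forall x : R, derivable phi x 1) /\ True by case: n h => [|n] [].
by rewrite derive1E; exact: derivableP.
Qed.

Lemma prim_Dn L phi : 0 <= L -> Dn 1 phi -> prim L phi (derive1 phi).
Proof.
move=> L0 h; apply: prim_C1 => //.
- by apply: continuous_subspaceT; exact: Dn_continuous h.
- by apply: continuous_subspaceT; exact: Dn_continuous (Dn_derive h).
- by move=> x _; exact: Dn_is_derive h.
Qed.

Lemma test_prim L phi : 0 < L -> test_function `]0, L[ phi ->
  [/\ prim L phi (derive1 phi), phi 0 = 0 & phi L = 0].
Proof.
move=> L0 ht; have [a [b [a0 ab bL h]]] := test_supp L0 ht.
split; first by apply: prim_Dn (test_Dn ht _); exact: ltW.
  by apply: h; rewrite negb_and -!ltNge a0.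
by apply: h; rewrite negb_and -!ltNge bL orbT.
Qed.

Lemma test_sqi L (A : set R) phi : 0 < L -> test_function A phi ->
  sqi (oo 0 L) phi /\ sqi (oo 0 L) (derive1 phi).
Proof.
move=> L0 ht; have h := test_Dn ht 1; split; apply: cont_sqi; rewrite ?(ltW L0)//.
- by apply: continuous_subspaceT; exact: Dn_continuous h.
- by apply: continuous_subspaceT; exact: Dn_continuous (Dn_derive h).
Qed.

Lemma test_bound L (A : set R) phi : 0 < L -> test_function A phi ->
  measurable_fun (oo 0 L) phi /\ exists2 C, 0 <= C & forall x, 0 <= x <= L -> `|phi x| <= C.
Proof.
move=> L0 ht; have h := test_Dn ht 1; apply: cont_bound; first exact: ltW.
by apply: continuous_subspaceT; exact: Dn_continuous h.
Qed.

Lemma test_mul_intg L (A : set R) r phi : 0 < L -> test_function A phi -> intg (oo 0 L) r ->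
  intg (oo 0 L) (fun x => r x * phi x).
Proof.
move=> L0 ht hr; have [mphi [C C0 hC]] := test_bound L0 ht.
apply: (@intg_eq _ (fun x => phi x * r x)) => //; first by move=> x _; rewrite mulrC.
apply: (@intgM_bdd _ _ _ _ _ C) => //.
by apply: aeA => x /=; rewrite in_itv/= => /andP[x0 xL]; apply: hC; rewrite !ltW.
Qed.

(* The test functions plateau b c n converge boundedly to the indicator of ]b, c[. *)
Lemma fundamental_lemma L r : 0 < L -> intg (oo 0 L) r ->
  (forall phi, test_function `]0, L[ phi -> \int[mu]_(x in `]0, L[) (r x * phi x) = 0) ->
  {ae mu, forall x, (oo 0 L) x -> r x = 0}.
Proof.
move=> L0 hr h0.
have hI b c : 0 < b -> b <= c -> c < L -> \int[mu]_(x in `]b, c[) r x = 0.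
  move=> b0 bc cL.
  have bcL : `[b, c] `<=` `]0, L[.
    by move=> x /=; rewrite !in_itv/= => /andP[ax xb]; rewrite (lt_le_trans b0) ?(le_lt_trans xb).
  have mr := intg_meas hr.
  have mpl n : measurable_fun (oo 0 L) (plateau b c n).
    by have [] := test_bound L0 (plateau_test n bcL).
  have m1 : measurable_fun (oo 0 L) (\1_(oo b c) : R -> R).
    by apply: measurable_indic; exact: measurable_itv.
  have h1 := @dct _ (fun n x => r x * plateau b c n x) (fun x => r x * \1_(oo b c) x) (fun x => `|r x|)
    (measurable_itv _) (fun n => measurable_funM mr (mpl n))
    (measurable_funM mr m1) (integrable_norm hr).
  have h2 : \int[mu]_(x in oo 0 L) (r x * \1_(oo b c) x) = 0.
    have e0 : (fun n => \int[mu]_(x in `]0, L[) (r x * plateau b c n x)) = (fun=> 0).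
      by apply/funext => n; apply: h0; exact: plateau_test.
    rewrite e0 in h1; apply/esym.
    apply: (@cvg_unique _ (@Rhausdorff R) ((fun=> 0 : R) @ \oo)); [exact: cvg_cst|apply: h1].
    - move=> n x _; rewrite normrM ler_piMr//.
      by have /andP[p0 p1] := plateau_bound b c n x; rewrite ger0_norm.
    - by move=> x _; apply: cvgM; [exact: cvg_cst | exact: plateau_cvg].
  rewrite -h2 Rintegral_mkcond [RHS]Rintegral_mkcond; congr Rintegral.
  apply/funext => x; rewrite !patchE indicE.
  have [xbc|] := boolP (x \in oo b c); last by rewrite mulr0; case: ifP.
  rewrite mulr1 ifT//; apply/mem_set/bcL; move: xbc; rewrite inE /= !in_itv/=.
  by move=> /andP[/ltW -> /ltW ->].
pose r' := r \_ (oo 0 L).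
have ir' : intg setT r' by exact: intg_ext.
have hli : locally_integrable setT r' by apply: open_integrable_locally => //; exact: openT.
have iy (y : R) : mu.-integrable [set` Interval -oo%O (BRight y)] (EFin \o r').
  by apply: integrableS ir'.
(* By Lebesgue differentiation the primitive of r' has derivative r' x at almost every x; by [hI]
   this primitive is constant on ]0, L[, so the derivative is 0. *)
have := FTC1Ny iy hli.
apply: aeS => x hx /=; rewrite in_itv/= => /andP[x0 xL].
have rE : r' x = r x by rewrite /r' patchE mem_set//= in_itv/= x0.
have [_] := hx.
rewrite -rE => <-; rewrite derive1E.
rewrite -[RHS](@derive_cst R R R (\int[mu]_(t in [set` Interval -oo%O (BRight x)]) r' t) x 1).
apply: near_eq_derive; near=> y.
have y0 : 0 < y by near: y; exact: lt_nbhsr.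
have yL : y < L by near: y; exact: lt_nbhsl.
have key s t : 0 < s -> s <= t -> t < L ->
   \int[mu]_(t in [set` Interval -oo%O (BRight t)]) r' t = \int[mu]_(t in [set` Interval -oo%O (BRight s)]) r' t.
  move=> s0 st tL; apply/eqP; rewrite -subr_eq0 Rintegral_itvB//.
  rewrite -(hI s t)//.
  have hst : intg (oo s t) r by apply: intg_oo_sub hr; apply: ltW.
  have hst' : intg (oo s t) r' by apply: integrableS ir'.
  rewrite -[in X in _ == X](int_cc hst).
  have hcc : intg (`[s, t]%classic : set (measurableTypeR R)) r' by exact: intg_cc.
  rewrite Rintegral_itv_obnd_cbnd; last by apply: (intg_sub _ _ _ hcc) => //; exact: subset_itv_oc_cc.
  apply/eqP/int_eq => u; rewrite /= in_itv/= => /andP[su ut].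
  by rewrite /r' patchE mem_set//= in_itv/= (lt_le_trans s0)//= (le_lt_trans ut).
by rewrite /cst; have [xy|/ltW yx] := leP x y; [rewrite (key x y)|rewrite -(key y x)].
Unshelve. all: by end_near. Qed.

End prim.

(** * The lemma of du Bois-Reymond *)

Section weak.
Variable R : realType.
Local Notation mu := (@lebesgue_measure R).
Local Notation oo a b := (`]a, b[%classic : set (measurableTypeR R)).
Implicit Types (f g k r phi : R -> R) (a b c x y : R).
Variable L : R.
Hypothesis L0 : 0 < L.
Let L0' : 0 <= L. Proof. exact: ltW. Qed.
Local Notation D := (oo 0 L).

Lemma testB phi psi (c : R) : test_function `]0, L[ phi -> test_function `]0, L[ psi ->
  test_function `]0, L[ (fun x => phi x - c * psi x).
Proof.
move=> h1 h2; have [a1 [b1 [a10 ab1 bL1 k1]]] := test_supp L0 h1.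
have [a2 [b2 [a20 ab2 bL2 k2]]] := test_supp L0 h2.
apply: (@test_intro _ L _ (Num.min a1 a2) (Num.max b1 b2)).
- by rewrite lt_min a10.
- by rewrite gt_max bL1.
- move=> n; apply: DnD; first exact: test_Dn h1 n.
  apply: (@Dn_ext _ _ (fun x => (- c) * psi x)); first by move=> x; rewrite mulNr.
  by apply: DnM; [exact: Dn_cst | exact: test_Dn h2 n].
- move=> x; rewrite negb_and -!ltNge lt_min gt_max => hx.
  rewrite k1 ?k2 ?mulr0 ?subrr//; rewrite negb_and -!ltNge.
    by case/orP: hx => /andP[h h']; rewrite ?h ?h' ?orbT.
  by case/orP: hx => /andP[h h']; rewrite ?h ?h' ?orbT.
Qed.

Lemma int_out a b f : 0 < a -> a <= b -> b < L ->
  (forall x, ~~ (a <= x <= b) -> f x = 0) -> intg D f ->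
  forall x, b <= x -> x <= L -> Pint f x = Pint f L.
Proof.
move=> a0 ab bL h hf x bx xL.
have x0 : 0 <= x by rewrite (le_trans (ltW a0))// (le_trans ab).
rewrite /Pint (chasles x0 xL hf) (_ : \int[mu]_(t in `]x, L[) f t = 0) ?addr0//.
rewrite (int_eq (g := fun=> 0)); last first.
  move=> t /=; rewrite in_itv/= => /andP[xt tL]; apply: h.
  by rewrite negb_and -!ltNge (le_lt_trans bx xt) orbT.
by rewrite /Rintegral integral0.
Qed.

(** The zero mean makes the primitive vanish again to the right of the support of psi, which is what
    keeps its support compact in ]0, L[. *)
Lemma test_primitive psi : test_function `]0, L[ psi -> Pint psi L = 0 ->
  exists2 phi, test_function `]0, L[ phi & forall x, derive1 phi x = psi x.
Proof.
move=> ht hI; have [a [b [a0 ab bL k]]] := test_supp L0 ht.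
have ipsi M : intg (oo 0 M) psi.
  have [M0|M0] := ltP 0 M; last first.
    by rewrite set_itv_ge -?leNgt ?bnd_simp//; exact: integrable_set0.
  by apply: sqi_intg; [exact: ltW | have [] := test_sqi M0 ht].
have z0 x : x <= a -> Pint psi x = 0.
  move=> xa; rewrite /Pint (int_eq (g := fun=> 0)); first by rewrite /Rintegral integral0.
  move=> t /=; rewrite in_itv/= => /andP[t0 tx]; apply: k.
  by rewrite negb_and -!ltNge (lt_le_trans tx xa).
have z1 x : b <= x -> Pint psi x = 0.
  move=> bx; have [xL|xL] := leP x L.
    by rewrite (int_out a0 ab bL k (ipsi L) bx xL).
  rewrite /Pint (chasles L0' (ltW xL) (ipsi x)) -/(Pint psi L) hI add0r.
  rewrite (int_eq (g := fun=> 0)); first by rewrite /Rintegral integral0.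
  move=> t /=; rewrite in_itv/= => /andP[t0 tx]; apply: k.
  by rewrite negb_and -!ltNge (lt_trans bL t0) orbT.
have hd (x : R) : is_derive x (1 : R) (Pint psi) (psi x).
  have [xa|xa] := ltP x a.
    rewrite k; last by rewrite negb_and -!ltNge xa.
    have hn : \near x, cst (0 : R) x = Pint psi x.
      by near=> y; rewrite z0//; apply: ltW; near: y; exact: lt_nbhsl.
    exact: (near_eq_is_derive hn (is_derive_cst (0 : R) x (1 : R))).
  have x0 : 0 < x by exact: lt_le_trans xa.
  have x1 : x < x + 1 by rewrite ltrDl.
  have cp : {for x, continuous psi} by exact: (Dn_continuous (test_Dn ht 0)).
  have [h1 h2] := continuous_FTC1_closed x1 (intg_cc (ipsi (x + 1))) x0 cp.
  have hh : is_derive x (1 : R) (fun x => \int[mu]_(t in [set` `[0, x]]) psi t) (psi x).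
    by apply: DeriveDef; [exact: h1|rewrite -derive1E].
  apply: near_eq_is_derive hh; near=> y.
  by rewrite int_cc.
exists (Pint psi); last by move=> x; rewrite derive1E; have h := hd x; rewrite derive_val.
apply: (test_intro a0 bL).
  by move=> n; apply: DnW; apply: DnS hd _; exact: test_Dn ht n.
move=> x; rewrite negb_and -!ltNge => /orP[|] h; [apply: z0|apply: z1]; exact: ltW.
Unshelve. all: by end_near. Qed.

(** If every test function had integral zero, the fundamental lemma with r = 1 would give 1 = 0
    almost everywhere on ]0, L[. *)
Lemma test_nonzero : exists2 phi, test_function `]0, L[ phi & Pint phi L = 1.
Proof.
have [phi [tphi nphi]] : exists phi, test_function `]0, L[ phi /\ Pint phi L != 0.
  apply: contrapT => hn.
  have i1 : intg D (fun=> 1).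
    by apply: (@int_bound _ 0 L _ 1 L0' _ _).1 => //; apply: aeA => x _; rewrite normr1.
  have h1 : {ae mu, forall x, D x -> (1 : R) = 0}.
    apply: (fundamental_lemma L0 i1) => phi tphi.
    rewrite (int_eq (g := phi)); last by move=> x _; rewrite mul1r.
    by apply/eqP/negPn/negP => nphi; apply: hn; exists phi.
  have : \int[mu]_(x in D) (1 : R) = \int[mu]_(x in D) (0 : R).
    by apply: int_eq_ae => //; exact: measurable_itv.
  move=> e0; have e : mu D = L%:E by rewrite lebesgue_measure_itv /= lte_fin L0 /= oppr0 adde0.
  have e1 : fine (mu D) = L by rewrite e.
  have e2 : 1 * fine (mu D) = 0 * fine (mu D).
    exact: (etrans (etrans (esym (Rintegral_cst mu (measurable_itv _) 1)) e0)
      (Rintegral_cst mu (measurable_itv _) 0)).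
  by move: L0; rewrite -e1 -[fine _]mul1r e2 mul0r ltxx.
(* This is phi divided by its integral, written in the shape covered by [testB]. *)
exists (fun x => phi x - (1 - (Pint phi L)^-1) * phi x); first exact: testB.
have i1 := sqi_intg L0' (test_sqi L0 tphi).1.
rewrite /Pint intB//; last exact: intgZ.
rewrite intZ// -/(Pint phi L) mulrBl mulVf//; ring.
Qed.

(** Subtracting from a test function th its mean times the normalised [th0] leaves the derivative of
    a test function. Hence r integrates against th as the constant c, the integral of r [th0], does,
    and the fundamental lemma applies to r - c. *)
Lemma du_bois_reymond r : intg D r ->
  (forall phi, test_function `]0, L[ phi -> \int[mu]_(x in `]0, L[) (r x * derive1 phi x) = 0) ->
  exists c, {ae mu, forall x, D x -> r x = c}.
Proof.
move=> hr h; have [th0 t0 I0] := test_nonzero.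
pose c := \int[mu]_(x in `]0, L[) (r x * th0 x); exists c.
have cc : intg D (fun=> c).
  by apply: (@int_bound _ 0 L _ `|c| L0' _ _).1 => //; exact: aeA.
have : {ae mu, forall x, D x -> r x - c = 0}.
  apply: (fundamental_lemma L0); first exact: intgB.
  move=> th ht.
  have [|phi tphi dphi] := test_primitive (testB (Pint th L) ht t0).
    have i1 := sqi_intg L0' (test_sqi L0 ht).1.
    have i2 := sqi_intg L0' (test_sqi L0 t0).1.
    rewrite /Pint intB//; last exact: intgZ.
    by rewrite intZ// -!/(Pint _ L) I0; ring.
  have := h _ tphi.
  have i1 := test_mul_intg L0 ht hr.
  have i2 := test_mul_intg L0 t0 hr.
  have i3 := sqi_intg L0' (test_sqi L0 ht).1.
  rewrite (int_eq (g := fun x => r x * th x - Pint th L * (r x * th0 x))); last first.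
    by move=> x _; rewrite dphi; ring.
  rewrite intB//; last exact: intgZ.
  rewrite intZ// -/c => /eqP; rewrite subr_eq0 => /eqP e.
  rewrite (int_eq (g := fun x => r x * th x - c * th x)); last by move=> x _; ring.
  rewrite intB//; last exact: intgZ.
  by rewrite intZ// e -/(Pint th L); ring.
by apply: aeS => x /[apply] /eqP; rewrite subr_eq0 => /eqP.
Qed.

End weak.

(** * Weak derivatives *)

Section sobolev.
Variable R : realType.
Local Notation mu := (@lebesgue_measure R).
Local Notation oo a b := (`]a, b[%classic : set (measurableTypeR R)).
Implicit Types (f g k r phi : R -> R) (a b c x y : R).
Variable L : R.
Hypothesis L0 : 0 < L.
Let L0' : 0 <= L. Proof. exact: ltW. Qed.
Local Notation D := (oo 0 L).
Let mD : measurable D. Proof. exact: measurable_itv. Qed.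

Lemma L2P f : L2 L f <-> sqi D f.
Proof.
have e : (f \_ D) = (fun x => f x * \1_D x).
  by apply/funext => x; rewrite patchE indicE; case: ifPn; rewrite ?mulr1 ?mulr0.
have e2 : (fun x => ((f \_ D) x) ^+ 2) = (fun x => f x ^+ 2) \_ D.
  by apply/funext => x; rewrite !patchE; case: ifPn => // _; rewrite expr0n.
split=> [h|[mf hf]].
- have := Lfun2_integrable_sqr h; move: h; rewrite /L2 inE => /andP[+ _].
  rewrite inE => /= mf.
  rewrite e2 -restrict_EFin => /(integrable_mkcond _ mD) hi.
  by split => //; apply/(measurable_restrictT _ mD).
- have m : measurable_fun setT (f \_ D) by apply/(measurable_restrictT _ mD).
  rewrite /L2 inE; apply/andP; split; first by rewrite inE.
  rewrite inE /= /finite_norm unlock poweR_lty//.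
  have := (@integrable_mkcond _ _ _ mu D (EFin \o (fun x => f x ^+ 2)) mD).1 hf.
  rewrite restrict_EFin => /(integrable_lty measurableT); apply: le_lt_trans.
  rewrite le_eqVlt; apply/orP; left; apply/eqP; apply: eq_integral => x _ /=.
  by rewrite -e2 powR_mulrn// real_normK ?num_real.
Qed.

Lemma L2normE f : L2norm L f = nrm D f.
Proof. by rewrite /L2norm /nrm /ip /int0L; congr Num.sqrt; apply: int_eq => x _; rewrite expr2. Qed.

Definition weak := is_weak_derivative L.

Lemma weak_sqi f g : weak f g -> sqi D g.
Proof. by case=> /L2P. Qed.

Lemma test_sq phi : test_function `]0, L[ phi -> sqi D phi /\ sqi D (derive1 phi).
Proof. exact: test_sqi. Qed.

Lemma prim_sqi F g : prim L F g -> sqi D F.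
Proof.
move=> pF; have [C C0 hC] := prim_bound L0' pF.
exact: sqi_bounded (prim_meas L0' pF) hC.
Qed.

Lemma prim_weak F g : sqi D g -> prim L F g -> weak F g.
Proof.
move=> sg pF; split; first exact/L2P.
move=> phi tp; have [pp p0 pL] := test_prim L0 tp.
have := prim_total L0' (primM L0' pF pp).
rewrite pL p0 !mulr0 subr0 intD//.
- by move=> /eqP; rewrite addrC addr_eq0 => /eqP.
- exact: sqi_mul sg (test_sq tp).1.
- exact: sqi_mul (prim_sqi pF) (test_sq tp).2.
Qed.

Lemma Pint_prim g : intg D g -> prim L (Pint g) g.
Proof. by move=> hg; split => // x _; rewrite Pint0 add0r. Qed.

Lemma prim_addc F g c : prim L F g -> prim L (fun x => c + F x) g.
Proof. by case=> hg hF; split => // x xL; rewrite hF// addrA. Qed.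

(** The difference between f and the primitive of g has weak derivative zero, hence is a constant by
    [du_bois_reymond]. *)
Lemma weak_prim f g : sqi D f -> weak f g ->
  exists2 F, prim L F g & {ae mu, forall x, D x -> f x = F x}.
Proof.
move=> sf wg; have sg := weak_sqi wg; have hg := sqi_intg L0' sg.
have pG := Pint_prim hg; have sG := prim_sqi pG.
have [|phi tp|c hc] := @du_bois_reymond _ _ L0 (fun x => f x - Pint g x).
- by apply: sqi_intg => //; exact: sqiB.
- have [_ /(_ phi tp)] := wg; have [_ /(_ phi tp)] := prim_weak sg pG.
  rewrite /int0L => e1 e2.
  rewrite (int_eq (g := fun x => f x * derive1 phi x - Pint g x * derive1 phi x)); last first.
    by move=> x _; rewrite mulrBl.
  rewrite intB//; [|exact: sqi_mul sf (test_sq tp).2|exact: sqi_mul sG (test_sq tp).2].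
  by rewrite e1 e2 subrr.
- exists (fun x => c + Pint g x); first exact: prim_addc.
  by apply: aeS hc => x /[apply] <-; rewrite subrK.
Qed.

Lemma weak_unique f g1 g2 : sqi D f -> weak f g1 -> weak f g2 ->
  {ae mu, forall x, D x -> g1 x = g2 x}.
Proof.
move=> sf w1 w2; have [s1 s2] := (weak_sqi w1, weak_sqi w2).
have : {ae mu, forall x, D x -> g1 x - g2 x = 0}.
  apply: (fundamental_lemma L0); first by apply: sqi_intg => //; exact: sqiB.
  move=> phi tp; rewrite (int_eq (g := fun x => g1 x * phi x - g2 x * phi x)); last first.
    by move=> x _; rewrite mulrBl.
  rewrite intB//; [|exact: sqi_mul s1 (test_sq tp).1|exact: sqi_mul s2 (test_sq tp).1].
  have [_ /(_ phi tp)] := w1; have [_ /(_ phi tp)] := w2; rewrite /int0L => -> /oppr_inj ->.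
  by rewrite subrr.
by apply: aeS => x /[apply] /eqP; rewrite subr_eq0 => /eqP.
Qed.

Lemma weak_eq_ae f f' g : sqi D f -> sqi D f' -> {ae mu, forall x, D x -> f' x = f x} ->
  weak f g -> weak f' g.
Proof.
move=> sf sf' ff [sg h]; split => // phi tp; rewrite -h//; apply: int_eq_ae => //.
- by apply: measurable_funM; [case: sf'|case: (test_sq tp).2].
- by apply: measurable_funM; [case: sf|case: (test_sq tp).2].
- by apply: aeS ff => x /[apply] ->.
Qed.

Lemma weak_lin (c1 c2 : R) f1 g1 f2 g2 : sqi D f1 -> sqi D f2 -> weak f1 g1 -> weak f2 g2 ->
  weak (fun x => c1 * f1 x + c2 * f2 x) (fun x => c1 * g1 x + c2 * g2 x).
Proof.
move=> sf1 sf2 w1 w2; have [s1 s2] := (weak_sqi w1, weak_sqi w2).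
split; first by apply/L2P; apply: sqiD => //; exact: sqiZ.
move=> phi tp; have [tp1 tp2] := test_sq tp.
have [_ /(_ phi tp)] := w1; have [_ /(_ phi tp)] := w2; rewrite /int0L => e2 e1.
rewrite (int_eq (g := fun x => c1 * (f1 x * derive1 phi x) + c2 * (f2 x * derive1 phi x))); last first.
  by move=> x _; ring.
rewrite intD//; [|by apply: intgZ => //; exact: sqi_mul..].
rewrite !intZ//; [|exact: sqi_mul..].
rewrite e1 e2.
rewrite [in RHS](int_eq (g := fun x => c1 * (g1 x * phi x) + c2 * (g2 x * phi x))); last first.
  by move=> x _; ring.
rewrite intD//; [|by apply: intgZ => //; exact: sqi_mul..].
rewrite !intZ//; [|exact: sqi_mul..].
ring.
Qed.

Lemma H1_sqi f : H1 L f -> sqi D f.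
Proof. by case=> /L2P. Qed.

Lemma H1_Dx f : H1 L f -> weak f (Dx L f).
Proof. by case=> _ [g hg]; rewrite /Dx; apply: (xgetPex (fun=> 0)); exists g. Qed.

Lemma H1_Dx_sqi f : H1 L f -> sqi D (Dx L f).
Proof. by move/H1_Dx/weak_sqi. Qed.

Lemma weak_H1 f g : sqi D f -> weak f g -> H1 L f.
Proof. by move=> /L2P sf wg; split => //; exists g. Qed.

Lemma Dx_ae f g : sqi D f -> weak f g -> {ae mu, forall x, D x -> Dx L f x = g x}.
Proof. move=> sf wg; exact: weak_unique sf (H1_Dx (weak_H1 sf wg)) wg. Qed.

Lemma Dx_nrm f g : sqi D f -> weak f g -> nrm D (Dx L f) = nrm D g.
Proof.
move=> sf wg; have h := Dx_ae sf wg; have [m1 _] := H1_Dx_sqi (weak_H1 sf wg).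
by have [m2 _] := weak_sqi wg; exact: nrm_eq_ae.
Qed.

Lemma test_weak phi : test_function `]0, L[ phi -> weak phi (derive1 phi).
Proof.
move=> tp; have [pp _ _] := test_prim L0 tp.
exact: prim_weak (test_sq tp).2 pp.
Qed.

Lemma H1norm_sqE f : H1norm L f ^+ 2 = nrm D f ^+ 2 + nrm D (Dx L f) ^+ 2.
Proof. by rewrite /H1norm sqr_sqrtr !L2normE// addr_ge0// sqr_ge0. Qed.

Lemma H1norm_ge0 f : 0 <= H1norm L f. Proof. exact: sqrtr_ge0. Qed.

Lemma nrm_le_H1norm f : nrm D f <= H1norm L f.
Proof.
rewrite -(@ler_pXn2r _ 2)// ?nnegrE ?nrm_ge0 ?H1norm_ge0// H1norm_sqE.
by rewrite lerDl sqr_ge0.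
Qed.

Lemma nrm_Dx_le_H1norm f : nrm D (Dx L f) <= H1norm L f.
Proof.
rewrite -(@ler_pXn2r _ 2)// ?nnegrE ?nrm_ge0 ?H1norm_ge0// H1norm_sqE.
by rewrite lerDr sqr_ge0.
Qed.

Lemma weakB f1 g1 f2 g2 : sqi D f1 -> sqi D f2 -> weak f1 g1 -> weak f2 g2 ->
  weak (fun x => f1 x - f2 x) (fun x => g1 x - g2 x).
Proof.
move=> s1 s2 w1 w2; have := @weak_lin 1 (-1) _ _ _ _ s1 s2 w1 w2.
by congr weak; apply/funext => x; rewrite mul1r mulN1r.
Qed.

Lemma weakZ c f g : sqi D f -> weak f g -> weak (fun x => c * f x) (fun x => c * g x).
Proof.
move=> s1 w1; have := @weak_lin c 0 _ _ _ _ s1 s1 w1 w1.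
by congr weak; apply/funext => x; rewrite mul0r addr0.
Qed.

Lemma test_H10 phi : test_function `]0, L[ phi -> H10 L phi.
Proof.
move=> tp; have [sp sp'] := test_sq tp; split; first exact: weak_H1 sp (test_weak tp).
move=> e e0; exists phi => //.
suff -> : H1norm L (phi - phi) = 0 by [].
have w0 : weak (phi - phi) (fun=> 0).
  have := weakB sp sp (test_weak tp) (test_weak tp).
  by congr weak; apply/funext => x; rewrite ?subrr.
have s0 : sqi D (phi - phi).
  have := sqiB mD sp sp; by congr sqi.
apply/eqP; rewrite -sqrf_eq0 H1norm_sqE (Dx_nrm s0 w0).
have z : nrm D (fun=> 0 : R) = 0.
  rewrite /nrm /ip (int_eq (g := fun=> 0)) ?/Rintegral ?integral0 ?sqrtr0//.
  by move=> x _; rewrite mulr0.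
have -> : phi - phi = (fun=> 0) by rewrite subrr.
by rewrite z expr0n addr0.
Qed.

(* By averaging F x = F y + int_y^x g over y. *)
Lemma prim_sup F g x : sqi D g -> prim L F g -> 0 <= x <= L ->
  L * `|F x| <= Num.sqrt L * nrm D F + L * (Num.sqrt L * nrm D g).
Proof.
move=> sg pF xL; have sF := prim_sqi pF; have [hg hF] := pF.
have s1 : sqi D (fun=> 1).
  by apply: (@sqi_bounded _ _ _ 1) => // y _; rewrite normr1.
have c1 c : \int[mu]_(y in D) c = L * c.
  have e : mu D = L%:E by rewrite lebesgue_measure_itv /= lte_fin L0 /= oppr0 adde0.
  have e1 : fine (mu D) = L by rewrite e.
  by rewrite -[in RHS]e1 mulrC; exact: Rintegral_cst.
have n1 : nrm D (fun=> 1 : R) = Num.sqrt L.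
  by rewrite /nrm /ip (int_eq (g := fun=> 1)) ?c1 ?mulr1// => y _; rewrite mulr1.
have sabs f : sqi D f -> sqi D (fun x => `|f x|).
  case=> mf hf; split; first exact: measurableT_comp.
  by apply: intg_eq hf => // y _; rewrite real_normK ?num_real.
have nabs f : nrm D (fun x => `|f x|) = nrm D f.
  by rewrite /nrm /ip; congr Num.sqrt; apply: int_eq => y _; rewrite -!expr2 real_normK ?num_real.
have I f : sqi D f -> \int[mu]_(y in D) `|f y| <= Num.sqrt L * nrm D f.
  move=> sf; rewrite mulrC -n1 -nabs.
  apply: le_trans (cauchy_schwarz mD (sabs _ sf) s1); apply: le_trans (ler_norm _).
  by rewrite /ip le_eqVlt; apply/orP; left; apply/eqP; apply: int_eq => y _; rewrite mulr1.
have hgn : intg D (fun t => `|g t|) by exact: integrable_norm.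
have hFn : intg D (fun t => `|F t|) by apply: sqi_intg => //; exact: sabs.
have B y : 0 <= y <= L -> `|F x| <= `|F y| + \int[mu]_(t in D) `|g t|.
  move=> yL; have -> : F x = F y + (Pint g x - Pint g y) by rewrite [F x]hF// [F y]hF//; ring.
  apply: (le_trans (ler_normD _ _)); rewrite lerD2l.
  have key s t : 0 <= s -> s <= t -> t <= L -> `|Pint g t - Pint g s| <= \int[mu]_(t in D) `|g t|.
    move=> s0 st tL; have t0 := le_trans s0 st.
    have h1 : intg (oo 0 t) g by apply: intg_oo_sub hg.
    have h2 : intg (oo s t) g by apply: intg_oo_sub hg.
    have h3 : intg (oo s t) (fun t => `|g t|) by exact: integrable_norm.
    have h4 : intg (oo s L) (fun t => `|g t|) by apply: intg_oo_sub hgn.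
    rewrite /Pint (chasles s0 st h1) addrC addKr.
    apply: (le_trans (int_norm_le _ h2 h3 _)) => //; first exact: aeA.
    rewrite (chasles s0 (le_trans st tL) hgn) (chasles st tL h4).
    have i1 : 0 <= \int[mu]_(t in `]0, s[) `|g t| by exact: Rintegral_ge0.
    have i2 : 0 <= \int[mu]_(t0 in `]t, L[) `|g t0| by exact: Rintegral_ge0.
    by rewrite addrCA lerDl addr_ge0.
  case/andP: xL => x0 xL; case/andP: yL => y0 yL.
  have [xy|/ltW yx] := leP x y; [rewrite distrC|]; exact: key.
have : \int[mu]_(y in D) `|F x| <= \int[mu]_(y in D) (`|F y| + \int[mu]_(t in D) `|g t|).
  apply: int_le_ae => //.
  - by apply: (@int_bound _ 0 L _ `|F x| L0' _ _).1 => //; apply: aeA => y _; rewrite normr_id.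
  - apply: intgD => //.
    by apply: (@int_bound _ 0 L _ `|\int[mu]_(t in D) `|g t| | L0' _ _).1 => //; exact: aeA.
  - by apply: aeA => y /=; rewrite in_itv/= => /andP[y0 yL]; apply: B; rewrite !ltW.
rewrite c1 intD//; last first.
  by apply: (@int_bound _ 0 L _ `|\int[mu]_(t in D) `|g t| | L0' _ _).1 => //; exact: aeA.
rewrite c1 => h; apply: le_trans h _; apply: lerD; first exact: I.
by apply: ler_wpM2l => //; exact: I.
Qed.

(** At an endpoint a test function phi close to f vanishes, so [prim_sup] applied to F - phi bounds
    |F x| there by a multiple of the H^1 distance, which is arbitrarily small. *)
Lemma H10_prim f : H10 L f -> exists F, [/\ prim L F (Dx L f),
  {ae mu, forall x, D x -> f x = F x}, F 0 = 0 & F L = 0].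
Proof.
move=> [h1 hd]; have sf := H1_sqi h1; have wf := H1_Dx h1.
have [F pF fF] := weak_prim sf wf; exists F.
have sg := weak_sqi wf; have sF := prim_sqi pF.
suff key x : x = 0 \/ x = L -> F x = 0.
  by split => //; apply: key; [left|right].
move=> hx; have xL : 0 <= x <= L by case: hx => ->; rewrite lexx ?L0' ?andbT.
apply/normr0_eq0/le_anti; rewrite normr_ge0 andbT.
(* The factor in [prim_sup] once both norms have a common bound; e / (C + 1) then yields an error at
   most e. *)
set C := (Num.sqrt L + L * Num.sqrt L).
have C0 : 0 <= C by rewrite addr_ge0// ?mulr_ge0// sqrtr_ge0.
rewrite -(pmulr_rle0 _ L0); apply/ler_addgt0Pl => e e0; rewrite addr0.
have e1 : 0 < e / (C + 1) by rewrite divr_gt0// ltr_wpDl.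
have [phi tp hphi] := hd _ e1.
have [pp p0 pL] := test_prim L0 tp; have [sp sp'] := test_sq tp.
have px : phi x = 0 by case: hx => ->.
have pd : prim L (fun y => F y - phi y) (fun y => Dx L f y - derive1 phi y).
  have [hg hF] := pF; have [hp hpp] := pp; split; first exact: intgB.
  move=> y yL; rewrite [F y]hF// [phi y]hpp// /Pint intB//; first ring.
    by apply: intg_oo_sub hg => //; case/andP: yL.
  by apply: intg_oo_sub hp => //; case/andP: yL.
have sd := sqiB mD sg sp'.
have := prim_sup sd pd xL; rewrite px subr0 => h.
have wd : weak (f - phi) (fun y => Dx L f y - derive1 phi y) by exact: weakB wf (test_weak tp).
have sfd : sqi D (f - phi) by exact: sqiB.
have n1 : nrm D (fun y => F y - phi y) <= e / (C + 1).
  apply: le_trans (ltW hphi); apply: le_trans (nrm_le_H1norm _).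
  suff -> : nrm D (fun y => F y - phi y) = nrm D (f - phi) by [].
  apply: nrm_eq_ae => //.
  - by case: (prim_sqi pd).
  - by case: sfd.
  - by apply: aeS fF => y /[apply] fy; rewrite -fy.
have n2 : nrm D (fun y => Dx L f y - derive1 phi y) <= e / (C + 1).
  apply: le_trans (ltW hphi); apply: le_trans (nrm_Dx_le_H1norm _).
  by rewrite (Dx_nrm sfd wd).
apply: le_trans h _.
have : C * (e / (C + 1)) <= e.
  rewrite mulrCA ler_piMr// ?(ltW e0)// ler_pdivrMr ?mul1r ?lerDl// ltr_wpDl//.
apply: le_trans; rewrite /C [leRHS]mulrDl; apply: lerD.
  by apply: ler_wpM2l => //; exact: sqrtr_ge0.
by rewrite -mulrA; apply: ler_wpM2l => //; apply: ler_wpM2l => //; exact: sqrtr_ge0.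
Qed.

End sobolev.

(** * The Poincare inequality *)

Section poincare.
Variable R : realType.
Local Notation mu := (@lebesgue_measure R).
Local Notation oo a b := (`]a, b[%classic : set (measurableTypeR R)).
Implicit Types (f g k r phi : R -> R) (a b c x y : R).
Variable L : R.
Hypothesis L0 : 0 < L.
Let L0' : 0 <= L. Proof. exact: ltW. Qed.
Local Notation D := (oo 0 L).
Let mD : measurable D. Proof. exact: measurable_itv. Qed.

(** [Linfty_norm] is the real part of an extended real and would be 0 if the latter were infinite;
    an essential bound C makes it finite, and then it dominates |f| almost everywhere. *)
Lemma Linfty_norm_ae f : (exists2 C, 0 <= C & {ae mu, forall x, D x -> `|f x| <= C}) ->
  0 <= Linfty_norm L f /\ {ae mu, forall x, D x -> `|f x| <= Linfty_norm L f}.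
Proof.
move=> [C C0 hC]; rewrite /Linfty_norm.
set N := ('N[mu]_+oo[_])%E.
have muT : (0 < mu setT)%E.
  by rewrite (_ : mu setT = +oo%E) ?ltry// -set_itvNyy lebesgue_measure_itv.
have NE : N = ess_sup mu (abse \o (EFin \o (f \_ D)))%E.
  by rewrite /N unlock /Lnorm muT.
have N0 : (0 <= N)%E by exact: Lnorm_ge0.
have NC : (N <= C%:E)%E.
  rewrite NE; apply/ess_supP; apply: aeS hC => x h /=.
  rewrite lee_fin patchE; case: ifPn => [|_]; last by rewrite normr0.
  by rewrite inE; exact: h.
have Nf : N \is a fin_num by rewrite ge0_fin_numE// (le_lt_trans NC) ?ltry.
split; first exact: fine_ge0.
have := ess_sup_ge mu (abse \o (EFin \o (f \_ D)))%E; rewrite -NE.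
apply: aeS => x /= h Dx; move: h; rewrite patchE mem_set// -[X in (_ <= X)%E](fineK Nf).
by rewrite lee_fin.
Qed.

Lemma Linfty_ae f : Linfty L f ->
  [/\ measurable_fun D f, 0 <= Linfty_norm L f &
      {ae mu, forall x, D x -> `|f x| <= Linfty_norm L f}].
Proof.
rewrite /Linfty inE => /andP[]; rewrite inE /= => mf; rewrite inE /= /finite_norm => hf.
have m : measurable_fun D f by apply/(measurable_restrictT _ mD).
have [] := @Linfty_norm_ae f.
  exists (Linfty_norm L f); first by apply: fine_ge0; exact: Lnorm_ge0.
  have muT : (0 < mu setT)%E.
    by rewrite (_ : mu setT = +oo%E) ?ltry// -set_itvNyy lebesgue_measure_itv.
  have Nf : ('N[mu]_+oo[EFin \o (f \_ (`]0, L[ : set R))%R] \is a fin_num)%E.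
    by rewrite ge0_fin_numE//; exact: Lnorm_ge0.
  rewrite /Linfty_norm.
  have := ess_sup_ge mu (abse \o (EFin \o (f \_ D)))%E.
  apply: aeS => x /= h Dx; move: h; rewrite patchE mem_set// => h.
  rewrite -lee_fin fineK//; apply: le_trans h _.
  by rewrite unlock /Lnorm muT.
by move=> h1 h2; split.
Qed.

Lemma cont_Linfty f : {within `[0, L], continuous f} ->
  [/\ measurable_fun D f, 0 <= Linfty_norm L f &
      {ae mu, forall x, D x -> `|f x| <= Linfty_norm L f}].
Proof.
move=> cf; have [mf [C C0 hC]] := cont_bound L0' cf.
have [] := @Linfty_norm_ae f; last by [].
exists C => //; apply: aeA => x /=; rewrite in_itv/= => /andP[x0 xL].
by apply: hC; rewrite !ltW.
Qed.

(* phi' ^ 2 - c ^ 2 phi ^ 2 = (phi' - c cot (c x) phi) ^ 2 + (c cot (c x) phi ^ 2)', for c = pi / L. *)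
Lemma poincare_test phi : test_function `]0, L[ phi ->
  nrm D phi <= L / pi * nrm D (derive1 phi).
Proof.
move=> tp; have [a [b [a0 ab bL k]]] := test_supp L0 tp.
have [sp sp'] := test_sq L0 tp.
have dk x : x < a \/ b < x -> derive1 phi x = 0.
  move=> h; rewrite derive1E -[RHS](@derive_cst R R R 0 x 1); apply: near_eq_derive.
  by case: h => h; near=> y; apply: k; rewrite negb_and -!ltNge; apply/orP;
    [left|right]; near: y; [exact: lt_nbhsl|exact: lt_nbhsr].
set c := pi / L.
have pi0 := pi_gt0 R.
have c0 : 0 < c by rewrite divr_gt0.
(* A closed interval inside ]0, L[, where sin (c x) does not vanish, but strictly larger than the
   support, so that the boundary terms are zero. *)
pose a' := a / 2; pose b' := (b + L) / 2.
have a'0 : 0 < a' by rewrite divr_gt0.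
have a'a : a' < a by rewrite /a'; lra.
have bb' : b < b' by rewrite /b'; lra.
have b'L : b' < L by rewrite /b'; lra.
have ab' : a' < b' by rewrite (lt_trans a'a)// (le_lt_trans ab).
pose s x := sin (c * x); pose co x := cos (c * x).
have s0 x : 0 < x -> x < L -> s x != 0.
  move=> x0 xL; rewrite gt_eqF// sin_gt0_pi// mulr_gt0//=.
  by rewrite /c mulrAC ltr_pdivrMr// ltr_pM2l.
have ds x : is_derive x (1 : R) s (co x * c).
  apply: (@is_derive_comp _ sin (fun y => c * y) x _ _ (is_derive_sin _)).
  by have := is_derive_affine c 0 x; congr is_derive; apply/funext => y; rewrite addr0.
have dco x : is_derive x (1 : R) co (- s x * c).
  apply: (@is_derive_comp _ cos (fun y => c * y) x _ _ (is_derive_cos _)).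
  by have := is_derive_affine c 0 x; congr is_derive; apply/funext => y; rewrite addr0.
have cdiff f (x df : R) : is_derive x (1 : R) f df -> {for x, continuous f}.
  by move=> [h _]; apply/differentiable_continuous/derivable1_diffP.
have dp x : is_derive x (1 : R) phi (derive1 phi x) by exact: Dn_is_derive (test_Dn tp 0).
have dp2 x : is_derive x (1 : R) (derive1 phi) (derive1 (derive1 phi) x).
  by exact: Dn_is_derive (Dn_derive (test_Dn tp 1)).
pose w x := c * (co x * (s x)^-1 * (phi x * phi x)).
pose w' x := c * (- c * (s x)^-1 * (s x)^-1 * (phi x * phi x) +
                  2 * (co x * (s x)^-1) * (phi x * derive1 phi x)).
have dw x : 0 < x -> x < L -> is_derive x (1 : R) w (w' x).
  move=> x0 xL; have sx := s0 _ x0 xL.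
  have dV := is_deriveV sx (ds x).
  have dW : is_derive x (1 : R) w _ := is_deriveZ c (is_deriveM (is_deriveM (dco x) dV) (is_deriveM (dp x) (dp x))).
  refine (is_derive_eq dW _); rewrite /w' /GRing.scale /=.
  have := cos2Dsin2 (c * x); rewrite -/(co x) -/(s x) => e.
  have -> : c * ((co x * (s x)^-1) * (phi x * derive1 phi x + phi x * derive1 phi x) +
      phi x * phi x * (co x * (- s x ^- 2 * (co x * c)) + (s x)^-1 * (- s x * c))) =
      c * (- c * (s x)^-1 * (s x)^-1 * (phi x * phi x) * (co x ^+ 2 + s x ^+ 2) +
                  2 * (co x * (s x)^-1) * (phi x * derive1 phi x)) by field.
  by rewrite e mulr1.
have cw' x : 0 < x -> x < L -> {for x, continuous w'}.
  move=> x0 xL; have sx := s0 _ x0 xL.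
  have hs := cdiff _ _ _ (ds x); have hco := cdiff _ _ _ (dco x).
  have hp := cdiff _ _ _ (dp x); have hp2 := cdiff _ _ _ (dp2 x).
  have hV : {for x, continuous (fun x => (s x)^-1)} by apply: cvgV.
  rewrite /w'; apply: cvgM; first exact: cvg_cst.
  apply: cvgD.
    apply: cvgM; last exact: cvgM.
    apply: cvgM => //; apply: cvgM => //; exact: cvg_cst.
  apply: cvgM; last exact: cvgM.
  apply: cvgM; first exact: cvg_cst.
  exact: cvgM.
have Iw : intg (oo a' b') w' /\ \int[mu]_(x in oo a' b') w' x = 0.
  have cw : {within `[a', b'], continuous w'}.
    apply: continuous_in_subspaceT => x; rewrite inE /= in_itv/= => /andP[h1 h2].
    by apply: cw'; [exact: lt_le_trans h1|exact: le_lt_trans h2 _].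
  have ic : intg (`[a', b']%classic : set (measurableTypeR R)) w'.
    by apply: continuous_compact_integrable => //; exact: segment_compact.
  have i0 := intg_oo ic; split => //.
  have cww x : 0 < x -> x < L -> {for x, continuous w} by move=> x0 xL; exact: cdiff (dw _ x0 xL).
  have Dw : derivable_oo_LRcontinuous w a' b'.
    split.
    - move=> x; rewrite in_itv/= => /andP[h1 h2].
      by have [] := dw x (lt_trans a'0 h1) (lt_trans h2 b'L).
    - by apply: cvg_at_right_filter; apply: cww => //; exact: lt_trans b'L.
    - by apply: cvg_at_left_filter; apply: cww => //; exact: lt_trans ab'.
  have := continuous_FTC2 ab' cw Dw.
  have h : {in `]a', b'[, derive1 w =1 w'}.
    move=> x; rewrite in_itv/= => /andP[h1 h2].
    by rewrite derive1E; have hd := dw x (lt_trans a'0 h1) (lt_trans h2 b'L); rewrite derive_val.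
  move=> /(_ h); rewrite EFin_int// int_cc// -EFinB => -[->].
  have z x : x < a \/ b < x -> w x = 0.
    by move=> hx; rewrite /w k ?mulr0// negb_and -!ltNge; apply/orP.
  by rewrite z ?z ?subrr//; [left|right].
case: Iw => iw Iw.
pose F x := derive1 phi x * derive1 phi x - c ^+ 2 * (phi x * phi x).
have iF : intg D F by apply: intgB => //; [exact: sqi_mul|apply: intgZ => //; exact: sqi_mul].
have F0 : 0 <= \int[mu]_(x in D) F x.
  have zF x : x < a \/ b < x -> F x = 0.
    by move=> hx; rewrite /F dk// k ?mulr0 ?subrr// negb_and -!ltNge; apply/orP.
  have b'0 : 0 < b' by exact: lt_trans ab'.
  have iF1 : intg (oo 0 b') F by apply: intg_oo_sub iF => //; exact: ltW.
  rewrite (chasles (ltW b'0) (ltW b'L) iF) (chasles (ltW a'0) (ltW ab') iF1).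
  have -> : \int[mu]_(t in `]0, a'[) F t = 0.
    rewrite (int_eq (g := fun=> 0)); first by rewrite /Rintegral integral0.
    by move=> t /=; rewrite in_itv/= => /andP[_ h]; apply: zF; left; exact: lt_trans h a'a.
  have -> : \int[mu]_(t in `]b', L[) F t = 0.
    rewrite (int_eq (g := fun=> 0)); first by rewrite /Rintegral integral0.
    by move=> t /=; rewrite in_itv/= => /andP[h _]; apply: zF; right; exact: lt_trans bb' h.
  rewrite add0r addr0 -Iw; apply: int_le_ae => //.
    by apply: intg_oo_sub iF1 => //; exact: ltW.
  apply: aeA => x /=; rewrite in_itv/= => /andP[h1 h2].
  have sx := s0 x (lt_trans a'0 h1) (lt_trans h2 b'L).
  have e := cos2Dsin2 (c * x); rewrite -/(co x) -/(s x) in e.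
  have -> : F x = (derive1 phi x - c * (co x * (s x)^-1) * phi x) ^+ 2 +
     c * (- c * (s x)^-1 * (s x)^-1 * (phi x * phi x) * (co x ^+ 2 + s x ^+ 2) + 2 * (co x * (s x)^-1) * (phi x * derive1 phi x)).
    by rewrite /F; field.
  by rewrite e mulr1 -/(w' x) lerDr sqr_ge0.
have h : c ^+ 2 * nrm D phi ^+ 2 <= nrm D (derive1 phi) ^+ 2.
  rewrite !nrm2 -subr_ge0 /ip -intZ//; last exact: sqi_mul.
  rewrite -intB//; first exact: sqi_mul.
  by apply: intgZ => //; exact: sqi_mul.
have cn0 : 0 <= c * nrm D phi := mulr_ge0 (ltW c0) (nrm_ge0 _ _).
rewrite -exprMn ler_pXn2r ?nnegrE ?nrm_ge0// in h.
have -> : L / pi = c^-1 by rewrite invf_div.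
by rewrite ler_pdivlMl.
Unshelve. all: by end_near. Qed.

Lemma poincare f : H10 L f -> nrm D f <= L / pi * nrm D (Dx L f).
Proof.
move=> [h1 hd]; have sf := H1_sqi h1; have wf := H1_Dx h1; have sg := weak_sqi wf.
have C0 : 0 < L / pi by rewrite divr_gt0// pi_gt0.
apply/ler_addgt0Pr => e e0.
(* Chosen so that the error in f plus L / pi times the error in its derivative is e. *)
have e1 : 0 < e / (1 + L / pi) by rewrite divr_gt0// ltr_pwDl// ltW.
have [phi tp hphi] := hd _ e1.
have [sp sp'] := test_sq L0 tp.
have wd : weak L (f - phi) (fun y => Dx L f y - derive1 phi y) by exact: weakB wf (test_weak L0 tp).
have sfd : sqi D (f - phi) by exact: sqiB.
have sgd : sqi D (fun y => Dx L f y - derive1 phi y) by exact: weak_sqi wd.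
have n1 : nrm D (f - phi) <= e / (1 + L / pi).
  by apply: le_trans (ltW hphi); exact: nrm_le_H1norm.
have n2 : nrm D (fun y => Dx L f y - derive1 phi y) <= e / (1 + L / pi).
  by apply: le_trans (ltW hphi); rewrite -(Dx_nrm L0 sfd wd); exact: nrm_Dx_le_H1norm.
have t1 : nrm D f <= nrm D (f - phi) + nrm D phi.
  have := nrmD mD sfd sp; apply: le_trans.
  rewrite le_eqVlt; apply/orP; left; apply/eqP; congr nrm; apply/funext => x.
  by rewrite /= subrK.
have t2 : nrm D (derive1 phi) <= nrm D (Dx L f) + nrm D (fun y => Dx L f y - derive1 phi y).
  have := nrmD mD sg (sqiN mD sgd).
  have -> : (fun x => Dx L f x + - (Dx L f x - derive1 phi x)) = derive1 phi.
    by apply/funext => x; ring.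
  suff -> : nrm D (fun x => - (Dx L f x - derive1 phi x)) = nrm D (fun y => Dx L f y - derive1 phi y) by [].
  have := nrmZ mD (-1) sgd; rewrite normrN1 mul1r => <-.
  by congr nrm; apply/funext => x; rewrite mulN1r.
have t3 := poincare_test tp.
have t4 := ler_wpM2l (ltW C0) t2; have t5 := ler_wpM2l (ltW C0) n2.
have e2 : e = e / (1 + L / pi) + L / pi * (e / (1 + L / pi)).
  have d0 : 1 + L / pi != 0 by rewrite gt_eqF// addr_gt0.
  by rewrite -[X in X + _]mul1r -mulrDl mulrC divfK.
rewrite e2; apply: (le_trans t1); rewrite [leRHS]addrCA; apply: lerD => //.
apply: (le_trans t3); apply: (le_trans t4); rewrite mulrDr; exact: lerD.
Qed.

End poincare.

(** * The dissipation inequality *)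

Section pointwise.
Variable R : realType.

Lemma young (s t e : R) : 0 < e -> - (s * t) <= e * t ^+ 2 + s ^+ 2 / (4 * e).
Proof.
move=> e0; rewrite -subr_ge0.
have -> : e * t ^+ 2 + s ^+ 2 / (4 * e) - - (s * t) = (2 * e * t + s) ^+ 2 / (4 * e).
  by field; rewrite gt_eqF.
by rewrite divr_ge0 ?sqr_ge0// mulr_ge0// ltW.
Qed.

Variables (a A q Q Z W1 eta : R).
Hypotheses (a0 : 0 <= a) (aA : a <= A) (hq : `|q| <= Q) (eta0 : 0 < eta).

(** Only one of the two factors a in the square is bounded by A; keeping the other lets the cross
    terms be absorbed by the damping a Z^2. *)
Lemma sqr_damping (s S : R) : `|s| <= S -> (s * a * Z) ^+ 2 <= A * S ^+ 2 * (a * Z ^+ 2).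
Proof.
move=> sS; have s2 : s ^+ 2 <= S ^+ 2.
  by rewrite -[s ^+ 2]real_normK ?num_real// lerXn2r// ?nnegrE// (le_trans _ sS).
have -> : (s * a * Z) ^+ 2 = (a * s ^+ 2) * (a * Z ^+ 2) by ring.
apply: ler_wpM2r; first by rewrite mulr_ge0// sqr_ge0.
by apply: ler_pM => //; exact: sqr_ge0.
Qed.

Lemma cross_q : - (q * a * Z * W1) <= eta * W1 ^+ 2 + A * (Q ^+ 2 / (4 * eta)) * (a * Z ^+ 2).
Proof.
apply: (le_trans (young (q * a * Z) W1 eta0)); rewrite lerD2l.
have -> : A * (Q ^+ 2 / (4 * eta)) * (a * Z ^+ 2) = A * Q ^+ 2 * (a * Z ^+ 2) / (4 * eta).
  by field; rewrite gt_eqF.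
by rewrite ler_pM2r ?invr_gt0 ?mulr_gt0//; exact: sqr_damping.
Qed.

Lemma cross_p (p P W : R) : `|p| <= P ->
  - (p * a * Z * W) <= W ^+ 2 / 2 + A * (P ^+ 2 / 2) * (a * Z ^+ 2).
Proof.
(* With Young weight 1/2 the price is W^2 / 2, which is the 1 in the numerator of [cstC1]. *)
move=> hp; have h : (0 : R) < 1 / 2 by lra.
apply: (le_trans (young (p * a * Z) W h)).
have := sqr_damping hp; set X := (p * a * Z) ^+ 2; set Y := A * P ^+ 2 * _ => XY.
have -> : A * (P ^+ 2 / 2) * (a * Z ^+ 2) = Y / 2 by rewrite /Y; field.
have -> : X / (4 * (1 / 2)) = X / 2 by field.
lra.
Qed.

(** Where a >= amin, the positive part of the Z^2 coefficient is at most K <= K a / amin, so it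
    joins the cross terms in C_3 a Z^2; as eps C_3 <= 1/2, half of the damping survives, at least
    amin Z^2 / 2. The W1^2 coefficient is at most - dp, half of which pays for the cross term in
    q. *)
Lemma pointwise_damped (amin p P p2 P2 q' K dp eps W : R) : 0 < amin -> amin <= a -> `|p| <= P ->
  `|p2| <= P2 -> p - q' / 2 <= K -> 0 <= K -> dp <= p + q' / 2 -> 0 < dp -> eta = dp / 2 -> 0 < eps ->
  eps * (K / amin + A * (Q ^+ 2 / (4 * eta) + P ^+ 2 / 2)) <= 1 / 2 ->
  - (a * Z ^+ 2) + eps * (p * Z ^+ 2 - p * a * Z * W - q * a * Z * W1 - p * W1 ^+ 2
     + p2 * W ^+ 2 / 2 - q' * W1 ^+ 2 / 2 - q' * Z ^+ 2 / 2) <=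
  - (eps * dp / 2) * W1 ^+ 2 - (amin / 2) * Z ^+ 2 + eps * ((1 + P2) / 2) * W ^+ 2.
Proof.
move=> am0 ama hp hp2 hK K0 hdp dp0 eE eps0 hC.
have Z2 := sqr_ge0 Z; have W2 := sqr_ge0 W; have W12 := sqr_ge0 W1.
have aZ : 0 <= a * Z ^+ 2 by exact: mulr_ge0.
have h1 : (p - q' / 2) * Z ^+ 2 <= K / amin * (a * Z ^+ 2).
  apply: (@le_trans _ _ (K * Z ^+ 2)); first exact: ler_wpM2r.
  have -> : K / amin * (a * Z ^+ 2) = K * (a * Z ^+ 2 / amin) by field; rewrite gt_eqF.
  by apply: ler_wpM2l => //; rewrite ler_pdivlMr// mulrC; exact: ler_wpM2r.
have h2 := cross_p W hp.
have h3 := cross_q.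
have h4 : dp * W1 ^+ 2 <= (p + q' / 2) * W1 ^+ 2 by exact: ler_wpM2r.
have h5 : p2 * W ^+ 2 <= P2 * W ^+ 2.
  by apply: ler_wpM2r => //; apply: le_trans hp2; exact: ler_norm.
have h6 : amin * Z ^+ 2 <= a * Z ^+ 2 by exact: ler_wpM2r.
have h7 := ler_wpM2r aZ hC.
have h8 : p * Z ^+ 2 - p * a * Z * W - q * a * Z * W1 - p * W1 ^+ 2
     + p2 * W ^+ 2 / 2 - q' * W1 ^+ 2 / 2 - q' * Z ^+ 2 / 2 <=
   (K / amin + A * (Q ^+ 2 / (4 * eta) + P ^+ 2 / 2)) * (a * Z ^+ 2) +
    (1 + P2) / 2 * W ^+ 2 - dp / 2 * W1 ^+ 2.
  rewrite eE in h3 *.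
  have -> : (K / amin + A * (Q ^+ 2 / (4 * (dp / 2)) + P ^+ 2 / 2)) * (a * Z ^+ 2) =
     K / amin * (a * Z ^+ 2) + A * (Q ^+ 2 / (4 * (dp / 2))) * (a * Z ^+ 2) +
     A * (P ^+ 2 / 2) * (a * Z ^+ 2) by ring.
  move: h1 h2 h3 h4 h5; set X1 := K / amin * _; set X2 := _ * (Q ^+ 2 / _) * _; set X3 := A * (P ^+ 2 / 2) * _.
  clear; move=> *; lra.
have h9 := ler_wpM2l (ltW eps0) h8.
apply: (le_trans (lerD (lexx _) h9)); rewrite -mulrA in h7.
move: h7 h6; set X := (K / amin + _) * _; clear; move=> *; lra.
Qed.

(** Where p = 0, the decay comes from q' alone. The condition dp < dq / 2 makes the W1^2 coefficient
    at most - dp, as on the damped interval, and the Z^2 coefficient - dq / 2 explains the second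
    entry of [cst_delta2]. *)
Lemma pointwise_undamped (q' C dp dq eps : R) :
  dq <= q' -> 0 < dp < dq / 2 -> eta = dp / 2 -> 0 < eps -> A * (Q ^+ 2 / (4 * eta)) <= C ->
  eps * C <= 1 / 2 ->
  - (a * Z ^+ 2) + eps * (- q * a * Z * W1 - q' * W1 ^+ 2 / 2 - q' * Z ^+ 2 / 2) <=
  - (eps * dp / 2) * W1 ^+ 2 - (eps * dq / 2) * Z ^+ 2.
Proof.
move=> hq' /andP[dp0 dpq] eE eps0 hC hC2.
have Z2 := sqr_ge0 Z; have W12 := sqr_ge0 W1.
have aZ : 0 <= a * Z ^+ 2 by exact: mulr_ge0.
have h3 := cross_q.
have h1 := ler_wpM2r W12 hq'.
have h2 := ler_wpM2r Z2 hq'.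
have h4 := ler_wpM2r aZ hC.
have h5 := ler_wpM2r W12 (ltW dpq).
have h8 : - q * a * Z * W1 - q' * W1 ^+ 2 / 2 - q' * Z ^+ 2 / 2 <=
  C * (a * Z ^+ 2) - dp / 2 * W1 ^+ 2 - dq / 2 * Z ^+ 2.
  rewrite eE in h3 h4; move: h1 h2 h3 h4 h5; set X := _ * (Q ^+ 2 / _) * _; set Y := C * _.
  clear; move=> *; lra.
have h9 := ler_wpM2l (ltW eps0) h8.
have h7 := ler_wpM2r aZ hC2; rewrite -mulrA in h7.
apply: (le_trans (lerD (lexx _) h9)).
move: h7 aZ; set X := C * _; clear; move=> *; lra.
Qed.

End pointwise.

(** * Pairs of a function and its space derivative; integration by parts *)

Section pairs.
Variable R : realType.
Local Notation mu := (@lebesgue_measure R).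
Local Notation oo a b := (`]a, b[%classic : set (measurableTypeR R)).
Implicit Types (f g k r phi : R -> R).
Variable L : R.
Hypothesis L0 : 0 < L.
Let L0' : 0 <= L. Proof. exact: ltW. Qed.
Local Notation D := (oo 0 L).

(** The derivative is an explicit argument instead of [Dx L f]: a difference quotient in time of
    [Dx L (y t)] is only almost everywhere equal to [Dx] of the difference quotient, whereas pairs
    are stable under linear combinations as they stand. *)
Definition H1pair f g := [/\ sqi D f, sqi D g &
  exists2 F, prim L F g & {ae mu, forall x, D x -> f x = F x}].

(** The boundary values are those of the absolutely continuous representative F, since those of f
    carry no information. *)
Definition H10pair f g := [/\ sqi D f, sqi D g &
  exists F, [/\ prim L F g, {ae mu, forall x, D x -> f x = F x}, F 0 = 0 & F L = 0]].

Lemma prim_lin (c1 c2 : R) f1 g1 f2 g2 : prim L f1 g1 -> prim L f2 g2 ->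
  prim L (fun x => c1 * f1 x + c2 * f2 x) (fun x => c1 * g1 x + c2 * g2 x).
Proof.
move=> [h1 k1] [h2 k2]; split; first by apply: intgD => //; exact: intgZ.
move=> x xL; rewrite k1// k2// /Pint.
have [i1 i2] : intg (oo 0 x) g1 /\ intg (oo 0 x) g2.
  by case/andP: xL => _ xL; split; [apply: intg_oo_sub h1|apply: intg_oo_sub h2].
rewrite intD//; [|exact: intgZ|exact: intgZ].
rewrite !intZ//; ring.
Qed.

Lemma H1pair_lin (c1 c2 : R) f1 g1 f2 g2 : H1pair f1 g1 -> H1pair f2 g2 ->
  H1pair (fun x => c1 * f1 x + c2 * f2 x) (fun x => c1 * g1 x + c2 * g2 x).
Proof.
move=> [s1 t1 [F1 p1 e1]] [s2 t2 [F2 p2 e2]]; split.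
- by apply: sqiD => //; exact: sqiZ.
- by apply: sqiD => //; exact: sqiZ.
- exists (fun x => c1 * F1 x + c2 * F2 x); first exact: prim_lin.
  by apply: aeS2 e1 e2 => x h1 h2 Dx; rewrite h1// h2.
Qed.

Lemma H10pair_lin (c1 c2 : R) f1 g1 f2 g2 : H10pair f1 g1 -> H10pair f2 g2 ->
  H10pair (fun x => c1 * f1 x + c2 * f2 x) (fun x => c1 * g1 x + c2 * g2 x).
Proof.
move=> [s1 t1 [F1 [p1 e1 z1 y1]]] [s2 t2 [F2 [p2 e2 z2 y2]]]; split.
- by apply: sqiD => //; exact: sqiZ.
- by apply: sqiD => //; exact: sqiZ.
- exists (fun x => c1 * F1 x + c2 * F2 x); split.
  + exact: prim_lin.
  + by apply: aeS2 e1 e2 => x h1 h2 Dx; rewrite h1// h2.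
  + by rewrite z1 z2 !mulr0 addr0.
  + by rewrite y1 y2 !mulr0 addr0.
Qed.

Lemma H1_pair f : H1 L f -> H1pair f (Dx L f).
Proof.
move=> h; have s := H1_sqi h; have w := H1_Dx h.
by split => //; [exact: weak_sqi w|exact: (weak_prim L0 s w)].
Qed.

Lemma H10_pair f : H10 L f -> H10pair f (Dx L f).
Proof.
move=> h; have h1 : H1 L f by case: h.
split; [exact: H1_sqi|exact: weak_sqi (H1_Dx h1)|exact: H10_prim].
Qed.

Lemma ip_eq_ae f f' g g' : measurable_fun D f -> measurable_fun D f' ->
  measurable_fun D g -> measurable_fun D g' ->
  {ae mu, forall x, D x -> f x = f' x} -> {ae mu, forall x, D x -> g x = g' x} ->
  ip D f g = ip D f' g'.
Proof.
move=> mf mf' mg mg' ef eg; apply: int_eq_ae => //.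
- exact: measurable_funM.
- exact: measurable_funM.
- by apply: aeS2 ef eg => x h1 h2 Dx; rewrite h1// h2.
Qed.

Lemma prim_ae F g g' : sqi D g -> sqi D g' -> {ae mu, forall x, D x -> g x = g' x} ->
  prim L F g -> prim L F g'.
Proof.
move=> sg sg' e [hg hF]; split; first exact: sqi_intg.
move=> x xL; rewrite hF//; congr (_ + _); case/andP: xL => x0 xL.
have sub : oo 0 x `<=` D by move=> y /=; rewrite !in_itv/= => /andP[-> yx]; exact: lt_le_trans xL.
apply: int_eq_ae => //.
- by apply: measurable_funS sub _ => //; case: sg.
- by apply: measurable_funS sub _ => //; case: sg'.
- by apply: aeS e => y h /sub.
Qed.

(* The boundary terms vanish because u does. *)
Lemma H10pair_ip u u' v v' : H10pair u u' -> H1pair v v' -> ip D u v' = - ip D u' v.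
Proof.
move=> [su su' [U [pU eU U0 UL]]] [sv sv' [V pV eV]].
have [sU sV] := (prim_sqi L0 pU, prim_sqi L0 pV).
have := prim_total L0' (primM L0' pU pV).
rewrite U0 UL !mul0r subrr intD//; [|exact: sqi_mul..].
have -> : ip D u v' = ip D U v' by apply: ip_eq_ae => //; [case: su|case: sU|case: sv'|case: sv'|exact: aeA].
have -> : ip D u' v = ip D u' V by apply: ip_eq_ae => //; [case: su'|case: su'|case: sv|case: sV|exact: aeA].
by rewrite /ip addrC => /eqP; rewrite addr_eq0 => /eqP.
Qed.

End pairs.

(** * Vanishing of p'' off the damping interval *)

Section coefficients.
Variable R : realType.
Local Notation mu := (@lebesgue_measure R).
Implicit Types (f g k r phi : R -> R).

Lemma ae_neq (c : R) : {ae mu, forall x : R, x != c}.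
Proof.
exists [set c]; split; first exact: measurable_set1.
  exact: lebesgue_measure_set1.
by move=> x /= /negP; rewrite negbK => /eqP.
Qed.

Lemma is_derive_near0 f (x d : R) : is_derive x (1 : R) f d -> (\near x, f x = 0) -> d = 0.
Proof.
move=> [_ <-] h; rewrite -[RHS](@derive_cst R R R 0 x 1).
exact: near_eq_derive.
Qed.

(** Near such a point p vanishes identically, hence so do p' and then p''. Thus the W^2 term of the
    dissipation is confined to ]x0, x1[, the only place where the damping of the energy can
    compensate it. *)
Lemma C2_p''0 (L x0 x1 : R) p p' p'' : C2 L p p' p'' ->
  0 <= x0 -> x1 <= L ->
  (forall x, x \in `[0, x0] \/ x \in `[x1, L] -> p x = 0) ->
  forall x, 0 < x < L -> x < x0 \/ x1 < x -> p'' x = 0.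
Proof.
move=> [_ _ _ hd] x00 x1L hp x /andP[x_gt0 xL].
have p0 y : 0 < y -> y < L -> y < x0 \/ x1 < y -> p y = 0.
  by move=> y0 yL [h|h]; apply: hp; [left|right]; rewrite in_itv/= ?(ltW y0) ?(ltW h) ?(ltW yL).
have nr y : 0 < y -> y < L -> y < x0 \/ x1 < y ->
   \near y, [/\ 0 < y, y < L & y < x0 \/ x1 < y].
  by move=> y0 yL [h|h]; near=> z; split;
    [near: z; exact: lt_nbhsr|near: z; exact: lt_nbhsl|left; near: z; exact: lt_nbhsl
    |near: z; exact: lt_nbhsr|near: z; exact: lt_nbhsl|right; near: z; exact: lt_nbhsr].
have p'0 y : 0 < y -> y < L -> y < x0 \/ x1 < y -> p' y = 0.
  move=> y0 yL h; have [|hy _] := hd y; first by rewrite in_itv/= y0.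
  apply: (is_derive_near0 hy); apply: filterS (nr y y0 yL h) => z [? ? ?]; exact: p0.
move=> h; have [|_ hx] := hd x; first by rewrite in_itv/= x_gt0.
apply: (is_derive_near0 hx); apply: filterS (nr x x_gt0 xL h) => z [? ? ?]; exact: p'0.
Unshelve. all: by end_near. Qed.

End coefficients.

(** * The dissipation inequality at a fixed time *)

Section static.
Variable R : realType.
Local Notation mu := (@lebesgue_measure R).
Local Notation oo a b := (`]a, b[%classic : set (measurableTypeR R)).
Implicit Types (f g k r phi : R -> R).
Variables (L : R) (a : R -> R) (x0 x1 amin : R)
    (q q' q'' p p' p'' : R -> R) (deltaq deltap eps1 : R).
Hypotheses (L_gt0 : 0 < L)
    (a_bounded : Linfty L a)
    (a_ge0 : ae0L L (fun x => 0 <= a x))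
    (x0_ge0 : 0 <= x0) (x1_le_L : x1 <= L)
    (amin_gt0 : 0 < amin)
    (a_damping : {ae lebesgue_measure, forall x : R,
                    x \in `]x0, x1[ -> amin <= a x})
    (q_C2 : C2 L q q' q'') (p_C2 : C2 L p p' p'')
    (hQ : condQ L x0 x1 q q' deltaq)
    (hP : condP L x0 x1 q' p deltaq deltap)
    (eps1_gt0 : 0 < eps1)
    (eps1_lt : eps1 < Num.min (1 / (2 * cstC3 L a p q q' amin deltap))
                              (Linfty_norm L q + L / pi * Linfty_norm L p)^-1).
Let L0' : 0 <= L. Proof. exact: ltW. Qed.
Local Notation D := (oo 0 L).
Let mD : measurable D. Proof. exact: measurable_itv. Qed.
Local Notation A := (Linfty_norm L a).
Local Notation Q := (Linfty_norm L q).
Local Notation P := (Linfty_norm L p).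
Local Notation P2 := (Linfty_norm L p'').
Local Notation K := (cstK L p q').

(** Continuity of p and q' on [0, L] bounds the set under [sup], without which the supremum would
    not be an upper bound. *)
Lemma cstK_ge x : 0 <= x <= L -> 0 <= K /\ p x - q' x / 2 <= K.
Proof.
move=> xL; have [cp _ _ _] := p_C2; have [_ cq' _ _] := q_C2.
have [_ [Cp _ hp]] := cont_bound L0' cp; have [_ [Cq _ hq]] := cont_bound L0' cq'.
have hs : has_ubound [set Num.max (p x - q' x / 2) 0 | x in `[0, L]].
  exists (Cp + Cq) => z [y]; rewrite /= in_itv/= => yL <-.
  have := hp _ yL; have := hq _ yL; rewrite !ler_norml => /andP[h1 h2] /andP[h3 h4].
  by rewrite ge_max; apply/andP; split; lra.
have := ub_le_sup hs (ex_intro2 _ _ x _ erefl); rewrite -/(cstK L p q').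
rewrite /= in_itv/= xL => /(_ isT); rewrite ge_max => /andP[h1 h2].
by split.
Qed.

(** A positive eps1 below 1 / (2 C_3) forces C_3 > 0, inverses of nonpositive numbers being
    nonpositive (and that of 0 being 0); then one clears the denominator. *)
Lemma eps_C3 : eps1 * cstC3 L a p q q' amin deltap <= 1 / 2.
Proof.
move: eps1_lt; rewrite lt_min => /andP[h _].
have h0 := lt_trans eps1_gt0 h; move: h0 h; set C := cstC3 _ _ _ _ _ _ _ => h0 h.
have C0 : 0 < C.
  move: h0; rewrite div1r invr_gt0; lra.
rewrite ltr_pdivlMr ?mulr_gt0// in h; move: h; clear -C0; move=> h.
suff : eps1 * C < 1 / 2 by apply: ltW.
by rewrite ltr_pdivlMr// mulrAC -mulrA.
Qed.

Lemma eps_QP : 0 <= eps1 * (Q + L / pi * P) < 1.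
Proof.
move: eps1_lt; rewrite lt_min => /andP[_ h].
have h0 := lt_trans eps1_gt0 h; move: h0; rewrite invr_gt0 => h0.
by rewrite mulr_ge0 ?ltW//= -ltr_pdivlMr// div1r.
Qed.

(** The points x0 and x1 are discarded: a is bounded below on the open interval only, and the
    vanishing of p'' is obtained from a neighbourhood. *)
Lemma coef_ae : {ae mu, forall x, D x ->
  [/\ 0 <= a x, a x <= A, `|q x| <= Q & `|p x| <= P] /\
  [/\ `|p'' x| <= P2, x0 < x < x1 -> amin <= a x &
      (x0 < x < x1) || (x < x0) || (x1 < x)]}.
Proof.
have [cp cp' cp'' _] := p_C2; have [cq _ _ _] := q_C2.
have [ma A0 hA] := Linfty_ae a_bounded.
have [_ _ hq] := cont_Linfty L_gt0 cq; have [_ _ hp] := cont_Linfty L_gt0 cp.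
have [_ _ hp2] := cont_Linfty L_gt0 cp''.
apply: aeS2 (aeS3 (T := fun x => D x -> [/\ 0 <= a x, a x <= A, `|q x| <= Q & `|p x| <= P]) _
    (aeS2 (S := fun x => D x -> 0 <= a x /\ a x <= A) _ a_ge0 hA) hq hp)
  (aeS3 (T := fun x => D x -> [/\ `|p'' x| <= P2, x0 < x < x1 -> amin <= a x &
      (x0 < x < x1) || (x < x0) || (x1 < x)]) _ hp2 a_damping
      (aeS2 (S := fun x => x != x0 /\ x != x1) _ (ae_neq x0) (ae_neq x1))).
- by move=> x h1 h2 Dx; split; [exact: h1|exact: h2].
- by move=> x h1 h2 h3 Dx; have [? ?] := h1 Dx; split => //; [exact: h2|exact: h3].
- move=> x h1 h2 Dx; split; first exact: h1.
  by apply: le_trans (h2 Dx); exact: ler_norm.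
- move=> x h1 h2 [n0 n1] Dx; split; [exact: h1|by move=> h; apply: h2; rewrite in_itv|].
  have [l0|] := boolP (x < x0); first by rewrite orbT.
  rewrite -leNgt le_eqVlt eq_sym (negbTE n0) /= => ->.
  by have /orP[->|->] := lt_total n1; rewrite ?orbT.
- by move=> x h1 h2; split.
Qed.

Local Notation m2 := (cst_delta2 amin eps1 deltaq).
Local Notation chi := (\1_(oo x0 x1) : R -> R).
Local Notation C1 := (cstC1 L p'').

(* The last group of terms on the right-hand side is the derivative of
   W1 Z + eps1 (p W W1 - p' W ^ 2 / 2 + q W1 ^ 2 / 2 + q Z ^ 2 / 2), of which only the boundary
   values of q W1 ^ 2 survive; their sign is given by q L <= 0 <= q 0. *)
Lemma static_pointwise : {ae mu, forall x, D x -> forall W W1 w2 Z z1,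
  W1 * z1 + Z * (w2 - a x * Z) + eps1 * (p x * Z * Z + (p x * W * (w2 - a x * Z) +
     (q x * (w2 - a x * Z) * W1 + q x * Z * z1))) <=
  (- (eps1 * deltap / 2) * (W1 * W1) + (- m2) * (Z * Z) + eps1 * C1 * (chi x * W * W)) +
  ((w2 * Z + W1 * z1) + eps1 * ((p' x * (W * W1) + p x * (W1 * W1 + W * w2)) -
     (p'' x * (W * W) + p' x * (W1 * W + W * W1)) / 2 +
     (q' x * (W1 * W1) + q x * (w2 * W1 + W1 * w2)) / 2 +
     (q' x * (Z * Z) + q x * (z1 * Z + Z * z1)) / 2))}.
Proof.
have dp0 : 0 < deltap by case: hP => _ /andP[].
have P20 : 0 <= P2 by case: p_C2 => _ _ c _; have [] := cont_Linfty L_gt0 c.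
have P0 : 0 <= P by case: p_C2 => c _ _ _; have [] := cont_Linfty L_gt0 c.
have A0 : 0 <= A by have [] := Linfty_ae a_bounded.
have eta0 : 0 < deltap / 2 by lra.
apply: aeS coef_ae => x h Dx W W1 w2 Z z1.
have [[ha0 haA hq hp] [hp2 ham hx]] := h Dx.
move: (Dx); rewrite /= in_itv/= => /andP[x_gt0 xL].
have xL' : 0 <= x <= L by rewrite !ltW.
have [K0 hK] := cstK_ge xL'.
have hC := eps_C3.
rewrite -subr_ge0.
(* What is left of the left-hand side once the exact derivative is removed: all terms in [z1], [w2]
   and p' cancel, leaving a quadratic form in W, W1, Z. *)
set J := - (a x * Z ^+ 2) + eps1 * (p x * Z ^+ 2 - p x * a x * Z * W - q x * a x * Z * W1 - p x * W1 ^+ 2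
     + p'' x * W ^+ 2 / 2 - q' x * W1 ^+ 2 / 2 - q' x * Z ^+ 2 / 2).
set B := - (eps1 * deltap / 2) * (W1 * W1) + (- m2) * (Z * Z) + eps1 * C1 * (chi x * W * W).
have -> : forall X Y, B + X - Y = B - (Y - X) by move=> X Y; ring.
rewrite subr_ge0.
have -> : forall T : R, T = J -> (T <= B) = (J <= B) by move=> T ->.
  2: by rewrite /J; field.
have m2in : m2 * Z ^+ 2 <= amin / 2 * Z ^+ 2.
  by apply: ler_wpM2r; rewrite ?sqr_ge0// /cst_delta2 ge_min lexx.
have m2out : m2 * Z ^+ 2 <= eps1 * deltaq / 2 * Z ^+ 2.
  by apply: ler_wpM2r; rewrite ?sqr_ge0// /cst_delta2 ge_min lexx orbT.
have [xin|xout] := boolP (x0 < x < x1).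
  have ch : chi x = 1 by rewrite indicE mem_set//= in_itv.
  have hdp : deltap <= p x + q' x / 2.
    by case: hP => _ _; apply; rewrite in_itv/=; case/andP: xin => /ltW -> /ltW ->.
  have := @pointwise_damped _ (a x) A (q x) Q Z W1 (deltap / 2) ha0 haA hq eta0 amin (p x) P (p'' x) P2 (q' x) K deltap eps1 W
    amin_gt0 (ham xin) hp hp2 hK K0 hdp dp0 erefl eps1_gt0 hC.
  rewrite -/J => hJ; apply: (le_trans hJ); rewrite /B ch /cstC1.
  have -> : eps1 * ((1 + P2) / 2) * (1 * W * W) = eps1 * ((1 + P2) / 2) * W ^+ 2 by ring.
  by rewrite lerD2r -!expr2 [(- m2) * _]mulNr lerD2l lerN2.
have hx' : x < x0 \/ x1 < x by move: hx; rewrite (negbTE xout) /= => /orP.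
have xI : x \in `[0, x0] \/ x \in `[x1, L].
  by case: hx' => hx'; [left|right]; rewrite in_itv/= ?(ltW x_gt0) ?(ltW hx') ?(ltW xL).
have px : p x = 0 by case: hP => h0 _ _; exact: h0.
have p2x : p'' x = 0.
  apply: (C2_p''0 p_C2 x0_ge0 x1_le_L _ _ hx'); last by rewrite x_gt0.
  by case: hP.
have dq : deltaq <= q' x by case: hQ => _ _ _; apply.
have ch : chi x = 0.
  by rewrite indicE memNset//= in_itv/=; exact/negP.
have dpq : 0 < deltap < deltaq / 2 by case: hP.
have hCC : A * (Q ^+ 2 / (4 * (deltap / 2))) <= cstC3 L a p q q' amin deltap.
  rewrite /cstC3 /cstC2 -[leLHS]add0r; apply: lerD; first by rewrite divr_ge0// ltW.
  by apply: ler_wpM2l => //; rewrite lerDl divr_ge0// sqr_ge0.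
have := @pointwise_undamped _ (a x) A (q x) Q Z W1 (deltap / 2) ha0 haA hq eta0 (q' x) _ deltap deltaq eps1
   dq dpq erefl eps1_gt0 hCC hC.
rewrite /J /B px p2x ch => hJ; apply: le_trans (le_trans hJ _).
  by rewrite le_eqVlt; apply/orP; left; apply/eqP; ring.
by rewrite mul0r mul0r mulr0 addr0 -!expr2 [(- m2) * _]mulNr lerD2l lerN2.
Qed.

Lemma chi_bound x : `|chi x| <= 1.
Proof. by rewrite indicE; case: (_ \in _); rewrite ?normr1 ?normr0. Qed.

Lemma sqi_p f : sqi D f -> sqi D (fun x => p x * f x).
Proof. by move=> sf; have [c _ _ _] := p_C2; have [m _ h] := cont_Linfty L_gt0 c; exact: sqi_bdd h sf. Qed.

Lemma sqi_q f : sqi D f -> sqi D (fun x => q x * f x).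
Proof. by move=> sf; have [c _ _ _] := q_C2; have [m _ h] := cont_Linfty L_gt0 c; exact: sqi_bdd h sf. Qed.

Lemma sqi_a f : sqi D f -> sqi D (fun x => a x * f x).
Proof. by move=> sf; have [m _ h] := Linfty_ae a_bounded; exact: sqi_bdd h sf. Qed.

Lemma sqi_chi f : sqi D f -> sqi D (fun x => chi x * f x).
Proof. by move=> sf; apply: (@sqi_bdd _ _ mD _ _ 1) => //; apply: aeA => x _; exact: chi_bound. Qed.

(* The time derivative of V_1 along w' = z, w1' = z1, z' = zt, where w1 and z1 are the x-derivatives
   of w and z. *)
Definition dissipation w w1 z z1 zt := ip D w1 z1 + ip D z zt +
  eps1 * (ip D (fun x => p x * z x) z + (ip D (fun x => p x * w x) zt +
    (ip D (fun x => q x * zt x) w1 + ip D (fun x => q x * z x) z1))).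

Lemma static_prim W w2 W1 Z z1 : prim L W W1 -> prim L W1 w2 -> prim L Z z1 ->
  W 0 = 0 -> W L = 0 -> Z 0 = 0 -> Z L = 0 -> sqi D w2 -> sqi D z1 ->
  dissipation W W1 Z z1 (fun x => w2 x - a x * Z x) <=
  - (eps1 * deltap / 2) * ip D W1 W1 + (- m2) * ip D Z Z + eps1 * C1 * ip D (fun x => chi x * W x) W.
Proof.
move=> pW pW1 pZ W0 WL Z0 ZL sw2 sz1.
have [sW [sW1 sZ]] := (prim_sqi L_gt0 pW, (prim_sqi L_gt0 pW1, prim_sqi L_gt0 pZ)).
have szt : sqi D (fun x => w2 x - a x * Z x) by apply: sqiB => //; exact: sqi_a.
have [cp cp' cp'' dp] := p_C2; have [cq cq' _ dq] := q_C2.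
have pp : prim L p p' by apply: prim_C1 => // x h; have [] := dp x h.
have pp' : prim L p' p'' by apply: prim_C1 => // x h; have [] := dp x h.
have pq : prim L q q' by apply: prim_C1 => // x h; have [] := dq x h.
(* The five products whose combination [T6] has the exact derivative of [static_pointwise] as its
   derivative. *)
have T1 := primM L0' pW1 pZ.
have T2 := primM L0' pp (primM L0' pW pW1).
have T3 := primM L0' pp' (primM L0' pW pW).
have T4 := primM L0' pq (primM L0' pW1 pW1).
have T5 := primM L0' pq (primM L0' pZ pZ).
have T6 := prim_lin 1 eps1 T1 (prim_lin 1 1 (prim_lin 1 (- 2^-1) T2 T3) (prim_lin 2^-1 2^-1 T4 T5)).
have hT := prim_total L0' T6; have [iT _] := T6.
move: hT iT; set T := (fun x => _ * (w2 x * Z x + _) + _) => hT iT.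
have T0 : \int[mu]_(x in D) T x <= 0.
  rewrite hT W0 WL Z0 ZL; case: hQ => q0 qL _ _.
  have h1 : 0 <= q 0 * (W1 0 * W1 0) by rewrite mulr_ge0// -expr2 sqr_ge0.
  have h2 : q L * (W1 L * W1 L) <= 0 by rewrite mulr_le0_ge0// -expr2 sqr_ge0.
  apply: (@le_trans _ _ (eps1 / 2 * (q L * (W1 L * W1 L) - q 0 * (W1 0 * W1 0)))).
    by rewrite le_eqVlt; apply/orP; left; apply/eqP; field.
  by rewrite pmulr_rle0 ?divr_gt0// subr_le0 (le_trans h2).
have i1 := sqi_mul mD sW1 sz1. have i2 := sqi_mul mD sZ szt.
have i3 := sqi_mul mD (sqi_p sZ) sZ. have i4 := sqi_mul mD (sqi_p sW) szt.
have i5 := sqi_mul mD (sqi_q szt) sW1. have i6 := sqi_mul mD (sqi_q sZ) sz1.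
have j1 := sqi_mul mD sW1 sW1. have j2 := sqi_mul mD sZ sZ.
have j3 := sqi_mul mD (sqi_chi sW) sW.
rewrite /dissipation /ip.
rewrite -(intD mD i5 i6) -(intD mD i4 (intgD mD i5 i6)) -(intD mD i3 (intgD mD i4 (intgD mD i5 i6))).
have i7 := intgD mD i3 (intgD mD i4 (intgD mD i5 i6)).
rewrite -(intZ mD eps1 i7) -(intD mD i1 i2) -(intD mD (intgD mD i1 i2) (intgZ mD eps1 i7)).
rewrite -(intZ mD _ j1) -(intZ mD _ j2) -(intZ mD _ j3).
have k1 := intgZ mD (- (eps1 * deltap / 2)) j1. have k2 := intgZ mD (- m2) j2.
have k3 := intgZ mD (eps1 * C1) j3.
rewrite -(intD mD k1 k2) -(intD mD (intgD mD k1 k2) k3).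
have k4 := intgD mD (intgD mD k1 k2) k3.
apply: (@le_trans _ _ (\int[mu]_(x in D) ((- (eps1 * deltap / 2) * (W1 x * W1 x) + - m2 * (Z x * Z x) +
     eps1 * C1 * (chi x * W x * W x)) + T x))); last first.
  by rewrite (intD mD k4 iT) gerDl.
apply: int_le_ae => //.
- exact: (intgD mD (intgD mD i1 i2) (intgZ mD eps1 i7)).
- exact: intgD.
apply: aeS static_pointwise => x h Dx; apply: le_trans (h Dx (W x) (W1 x) (w2 x) (Z x) (z1 x)) _.
rewrite lerD2l le_eqVlt; apply/orP; left; apply/eqP; rewrite /T; by field.
Qed.

(** Transfer of [static_prim] from absolutely continuous representatives to arbitrary ones: every
    inner product involved is insensitive to null sets. *)
Lemma static_ineq w w1 w2 z z1 zt : H10pair L w w1 -> H1pair L w1 w2 -> H10pair L z z1 ->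
  sqi D zt -> {ae mu, forall x, D x -> zt x = w2 x - a x * z x} ->
  dissipation w w1 z z1 zt <=
  - (eps1 * deltap / 2) * ip D w1 w1 + (- m2) * ip D z z + eps1 * C1 * ip D (fun x => chi x * w x) w.
Proof.
move=> [sw sw1 [W [pW eW W0 WL]]] [_ sw2 [W1 pW1 eW1]] [sz sz1 [Z [pZ eZ Z0 ZL]]] szt ezt.
have [sW [sW1 sZ]] := (prim_sqi L_gt0 pW, (prim_sqi L_gt0 pW1, prim_sqi L_gt0 pZ)).
(* Replacing the derivative w1 of W by its own continuous representative gives W1 point values at 0
   and L. *)
have pWW1 := prim_ae L_gt0 sw1 sW1 eW1 pW.
have := static_prim pWW1 pW1 pZ W0 WL Z0 ZL sw2 sz1.
set zt' := (fun x => w2 x - a x * Z x).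
have szt' : sqi D zt' by apply: sqiB => //; exact: sqi_a.
have ezt' : {ae mu, forall x, D x -> zt x = zt' x}.
  by apply: aeS2 ezt eZ => x h1 h2 Dx; rewrite h1// h2.
have eM m f g : {ae mu, forall x, D x -> f x = g x} -> {ae mu, forall x, D x -> m x * f x = m x * g x}.
  by apply: aeS => x h Dx; rewrite h.
have M f : sqi D f -> measurable_fun D f by case.
have E f f' g g' : sqi D f -> sqi D f' -> sqi D g -> sqi D g' ->
  {ae mu, forall x, D x -> f x = f' x} -> {ae mu, forall x, D x -> g x = g' x} ->
  ip D f g = ip D f' g'.
  by move=> *; apply: ip_eq_ae => //; exact: M.
rewrite /dissipation.
rewrite (E w1 W1 z1 z1)//; last exact: aeA.
rewrite (E z Z zt zt')//.
rewrite (E _ (fun x => p x * Z x) z Z)//; [|exact: sqi_p|exact: sqi_p|exact: eM].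
rewrite (E _ (fun x => p x * W x) zt zt')//; [|exact: sqi_p|exact: sqi_p|exact: eM].
rewrite (E _ (fun x => q x * zt' x) w1 W1)//; [|exact: sqi_q|exact: sqi_q|exact: eM].
rewrite (E (fun x => q x * z x) (fun x => q x * Z x) z1 z1)//; [|exact: sqi_q|exact: sqi_q|exact: eM|exact: aeA].
rewrite (E w1 W1 w1 W1)// (E z Z z Z)//.
by rewrite (E _ (fun x => chi x * W x) w W)//; [exact: sqi_chi|exact: sqi_chi|exact: eM].
Qed.

End static.

(** * Equivalence with the Sobolev norms *)

Section equivalence.
Variable R : realType.
Local Notation oo a b := (`]a, b[%classic : set (measurableTypeR R)).
Implicit Types (f g k r phi : R -> R).
Variables (L : R) (a q q' q'' p p' p'' : R -> R) (eps1 : R).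
Hypotheses (L_gt0 : 0 < L) (a_bounded : Linfty L a) (q_C2 : C2 L q q' q'') (p_C2 : C2 L p p' p'').
Local Notation D := (oo 0 L).
Let mD : measurable D. Proof. exact: measurable_itv. Qed.
Local Notation A := (Linfty_norm L a).
Local Notation Q := (Linfty_norm L q).
Local Notation P := (Linfty_norm L p).

Lemma energyE f g : sqi D (Dx L f) -> sqi D g ->
  energy L f g = (ip D (Dx L f) (Dx L f) + ip D g g) / 2.
Proof.
move=> s1 s2; rewrite /energy /ip -intD//; exact: sqi_mul.
Qed.

Lemma MfunE f g : Mfun L p q f g = ip D (fun x => p x * f x) g + ip D (fun x => q x * g x) (Dx L f).
Proof. by []. Qed.

Lemma H1_sqis f : H1 L f -> sqi D f /\ sqi D (Dx L f).
Proof. by move=> h; split; [exact: H1_sqi|exact: weak_sqi (H1_Dx h)]. Qed.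

(** Cauchy-Schwarz on both terms, Poincare with its constant L / pi on g, and 2 s t <= s^2 + t^2.
    The factor is the inverse of the second bound imposed on eps1. *)
Lemma Mfun_bound g k : H10 L g -> sqi D k ->
  `|Mfun L p q g k| <= (Q + L / pi * P) * energy L g k.
Proof.
move=> hg sk; have [sg sg1] : sqi D g /\ sqi D (Dx L g) by apply: H1_sqis; case: hg.
have [cp _ _ _] := p_C2; have [cq _ _ _] := q_C2.
have [mp P0 hp] := cont_Linfty L_gt0 cp; have [mq Q0 hq] := cont_Linfty L_gt0 cq.
have sp := sqi_bdd mD mp hp sg; have sq := sqi_bdd mD mq hq sk.
rewrite MfunE (energyE sg1 sk) -!nrm2.
have pi0 : 0 < L / pi by rewrite divr_gt0// pi_gt0.
have h1 := cauchy_schwarz mD sp sk; have h2 := cauchy_schwarz mD sq sg1.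
have h3 := nrm_bdd mD mp P0 hp sg; have h4 := nrm_bdd mD mq Q0 hq sk.
have h5 := poincare L_gt0 hg.
move: h1 h2 h3 h4 h5 (nrm_ge0 D k) (nrm_ge0 D (Dx L g)).
set n1 := nrm D (Dx L g); set nk := nrm D k; set ng := nrm D g.
set npg := nrm D _; set nqk := nrm D _ => h1 h2 h3 h4 h5 k0 n0.
apply: (le_trans (ler_normD _ _)); apply: (le_trans (lerD h1 h2)).
have e1 : npg * nk <= P * (L / pi * n1) * nk.
  by apply: ler_wpM2r => //; apply: (le_trans h3); exact: ler_wpM2l.
have e2 : nqk * n1 <= Q * nk * n1 by exact: ler_wpM2r.
apply: (le_trans (lerD e1 e2)).
have -> : P * (L / pi * n1) * nk + Q * nk * n1 = (Q + L / pi * P) * (n1 * nk) by ring.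
apply: ler_wpM2l; first by rewrite addr_ge0// mulr_ge0// ltW.
have := sqr_ge0 (n1 - nk); rewrite -subr_ge0.
have -> : (n1 ^+ 2 + nk ^+ 2) / 2 - n1 * nk = (n1 - nk) ^+ 2 / 2 by field.
by move=> h; rewrite divr_ge0.
Qed.

Lemma H2norm_sqE f : H2norm L f ^+ 2 =
  nrm D f ^+ 2 + nrm D (Dx L f) ^+ 2 + nrm D (Dx L (Dx L f)) ^+ 2.
Proof. by rewrite /H2norm sqr_sqrtr !L2normE// !addr_ge0// sqr_ge0. Qed.

Lemma nrm_sqD f g : sqi D f -> sqi D g ->
  nrm D (fun x => f x + g x) ^+ 2 <= 2 * nrm D f ^+ 2 + 2 * nrm D g ^+ 2.
Proof.
move=> sf sg; have h := nrmD mD sf sg.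
have h2 : nrm D (fun x => f x + g x) ^+ 2 <= (nrm D f + nrm D g) ^+ 2.
  by rewrite lerXn2r// ?nnegrE ?addr_ge0 ?nrm_ge0.
apply: (le_trans h2); rewrite -subr_ge0.
have -> : 2 * nrm D f ^+ 2 + 2 * nrm D g ^+ 2 - (nrm D f + nrm D g) ^+ 2 = (nrm D f - nrm D g) ^+ 2 by ring.
exact: sqr_ge0.
Qed.

Lemma Vs_equiv C0 : 0 < C0 -> 0 < eps1 -> 0 <= eps1 * (Q + L / pi * P) < 1 ->
  exists2 C6 : R, 0 < C6 &
     forall f g : R -> R, H2 L f -> H10 L f -> H10 L g ->
       C6^-1 * (H2norm L f ^+ 2 + H1norm L g ^+ 2) <= Vs L a p q eps1 C0 f g
         <= C6 * (H2norm L f ^+ 2 + H1norm L g ^+ 2).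
Proof.
move=> C0_gt0 eps0 /andP[e0 e1].
have [ma A0 hA] := Linfty_ae a_bounded.
(* The fraction of E that survives in V_1 after M has been estimated by [Mfun_bound]. *)
set th := 1 - eps1 * (Q + L / pi * P).
have th0 : 0 < th by rewrite subr_gt0.
pose m := Num.min (th / 2) (C0 / 2).
have m0 : 0 < m by rewrite lt_min !divr_gt0.
(* Bounds the Sobolev norms by the squares of f_x, g, g_x and k: the term (L / pi)^2 serves f by
   Poincare, and f_xx = k + a g costs 2 k^2 + 2 A^2 g^2. *)
pose B := (L / pi) ^+ 2 + 4 + 2 * A ^+ 2.
have B4 : 4 <= B.
  by rewrite /B addrAC lerDr addr_ge0 ?sqr_ge0// mulr_ge0// sqr_ge0.
have B0 : 0 < B by apply: lt_le_trans B4.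
(* For the upper bound: V_1 <= 2 E, where k = f_xx - a g contributes 2 + 2 A^2, and C0 comes from
   the energy of (f, g). *)
pose C' := 2 + 2 * A ^+ 2 + C0.
have A20 : 0 <= A ^+ 2 by exact: sqr_ge0.
have C'0 : 0 < C' by rewrite /C' addr_gt0// ltr_pwDl// mulr_ge0.
exists (B / m + C'); first by rewrite addr_gt0// divr_gt0.
move=> f g [hf1 hf2] hf hg.
have [sf sf1] := H1_sqis hf1; have [_ sf2] := H1_sqis hf2.
have [sg sg1] : sqi D g /\ sqi D (Dx L g) by apply: H1_sqis; case: hg.
have sag := sqi_bdd mD ma hA sg.
set k := (fun x => Dx L (Dx L f) x - a x * g x).
have sk : sqi D k by exact: sqiB.
have hM := Mfun_bound hg sk.
have Ek : energy L g k = (nrm D (Dx L g) ^+ 2 + nrm D k ^+ 2) / 2 by rewrite (energyE sg1 sk) !nrm2.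
have Ef : energy L f g = (nrm D (Dx L f) ^+ 2 + nrm D g ^+ 2) / 2 by rewrite (energyE sf1 sg) !nrm2.
have h1 : nrm D k ^+ 2 <= 2 * nrm D (Dx L (Dx L f)) ^+ 2 + 2 * (A ^+ 2 * nrm D g ^+ 2).
  have sN := sqiN mD sag.
  have := nrm_sqD sf2 sN; have -> : nrm D (fun x => - (a x * g x)) = nrm D (fun x => a x * g x).
    have := nrmZ mD (-1) sag; rewrite normrN1 mul1r => <-.
    by congr nrm; apply/funext => x; rewrite mulN1r.
  move=> h; apply: le_trans h _; rewrite lerD2l; apply: ler_wpM2l => //.
  rewrite -exprMn lerXn2r// ?nnegrE ?mulr_ge0 ?nrm_ge0//; exact: nrm_bdd.
have h2 : nrm D (Dx L (Dx L f)) ^+ 2 <= 2 * nrm D k ^+ 2 + 2 * (A ^+ 2 * nrm D g ^+ 2).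
  have -> : Dx L (Dx L f) = (fun x => k x + a x * g x) by apply/funext => x; rewrite /k subrK.
  apply: (le_trans (nrm_sqD sk sag)); rewrite lerD2l; apply: ler_wpM2l => //.
  rewrite -exprMn lerXn2r// ?nnegrE ?mulr_ge0 ?nrm_ge0//; exact: nrm_bdd.
have h3 : nrm D f ^+ 2 <= (L / pi) ^+ 2 * nrm D (Dx L f) ^+ 2.
  have pi0 : 0 < L / pi by rewrite divr_gt0// pi_gt0.
  have := poincare L_gt0 hf => h.
  rewrite -exprMn lerXn2r// ?nnegrE ?nrm_ge0//.
  by apply: mulr_ge0; [exact: ltW|exact: nrm_ge0].
have := H1norm_sqE L g; have := H2norm_sqE f.
generalize (H2norm L f ^+ 2) (H1norm L g ^+ 2) => N2 N1 -> ->.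
rewrite /Vs /V1 -/k.
move: hM Ek Ef h1 h2 h3.
have K0 : 0 <= nrm D k ^+ 2 by exact: sqr_ge0.
have F10 : 0 <= nrm D (Dx L f) ^+ 2 by exact: sqr_ge0.
have G0 : 0 <= nrm D g ^+ 2 by exact: sqr_ge0.
have G10 : 0 <= nrm D (Dx L g) ^+ 2 by exact: sqr_ge0.
have F00 : 0 <= nrm D f ^+ 2 by exact: sqr_ge0.
have F20 : 0 <= nrm D (Dx L (Dx L f)) ^+ 2 by exact: sqr_ge0.
move: K0 F10 G0 G10 F00 F20.
(* From here on the claim is an inequality between nonnegative real numbers. *)
generalize (nrm D k ^+ 2) (nrm D (Dx L f) ^+ 2) (nrm D g ^+ 2) (nrm D (Dx L g) ^+ 2)
  (nrm D f ^+ 2) (nrm D (Dx L (Dx L f)) ^+ 2) (Mfun L p q g k) (energy L g k) (energy L f g)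
  => K F1 G G1 F0 F2 M E1 E2 K0 F10 G0 G10 F00 F20 hM Ek Ef h1 h2 h3.
clear f g hf1 hf2 hf hg sf sf1 sf2 sg sg1 sag k sk.
have E10 : 0 <= E1 by rewrite Ek divr_ge0// addr_ge0.
have E20 : 0 <= E2 by rewrite Ef divr_ge0// addr_ge0.
have hM1 : - ((1 - th) * E1) <= eps1 * M /\ eps1 * M <= (1 - th) * E1.
  have -> : (1 - th) * E1 = eps1 * ((Q + L / pi * P) * E1) by rewrite /th; ring.
  rewrite -mulrN !ler_pM2l//; apply/andP; by rewrite -ler_norml.
case: hM1 => hM1 hM2.
have S0 : 0 <= F0 + F1 + F2 + (G + G1) by rewrite !addr_ge0.
have BM : 0 < B / m by rewrite divr_gt0.
have lo : F0 + F1 + F2 + (G + G1) <= B / m * (E1 + eps1 * M + C0 * E2).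
  have l1 : F0 + F1 + F2 + (G + G1) <= B * (F1 + K + G + G1).
    have b1 : ((L / pi) ^+ 2 + 1) * F1 <= B * F1.
      by apply: ler_wpM2r => //; rewrite /B -addrA lerD2l; lra.
    have b2 : 2 * K <= B * K by apply: ler_wpM2r => //; lra.
    have b3 : (1 + 2 * A ^+ 2) * G <= B * G.
      by apply: ler_wpM2r => //; rewrite /B lerD2r; have := sqr_ge0 (L / pi); lra.
    have b4 : 1 * G1 <= B * G1 by apply: ler_wpM2r => //; lra.
    have -> : B * (F1 + K + G + G1) = B * F1 + B * K + B * G + B * G1 by ring.
    move: b1 b2 b3 b4 h2 h3; rewrite !mulrDl !mul1r -!mulrA; clear; move=> *; lra.
  have l2 : m * (F1 + K + G + G1) <= E1 + eps1 * M + C0 * E2.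
    have c1 : m * (G1 + K) <= th / 2 * (G1 + K).
      by apply: ler_wpM2r; [rewrite addr_ge0|rewrite ge_min lexx].
    have c2 : m * (F1 + G) <= C0 / 2 * (F1 + G).
      by apply: ler_wpM2r; [rewrite addr_ge0|rewrite ge_min lexx orbT].
    have -> : m * (F1 + K + G + G1) = m * (G1 + K) + m * (F1 + G) by ring.
    apply: (le_trans (lerD c1 c2)); apply: lerD.
      have -> : th / 2 * (G1 + K) = E1 - (1 - th) * E1 by rewrite Ek; field.
      by rewrite lerD2l.
    by rewrite Ef le_eqVlt; apply/orP; left; apply/eqP; field.
  apply: (le_trans l1); rewrite -mulrA; apply: ler_wpM2l; first exact: ltW.
  by rewrite mulrC ler_pdivlMr// mulrC.
have V0 : 0 <= E1 + eps1 * M + C0 * E2.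
  by have := le_trans S0 lo; rewrite pmulr_rge0.
apply/andP; split.
  have BC : 0 < B / m + C' by exact: addr_gt0.
  rewrite ler_pdivrMl//; apply: (le_trans lo).
  by apply: ler_wpM2r => //; rewrite lerDl ltW.
apply: (@le_trans _ _ (C' * (F0 + F1 + F2 + (G + G1)))); last first.
  by apply: ler_wpM2r => //; rewrite lerDr ltW.
have u1 : E1 + eps1 * M <= 2 * E1.
  have : (1 - th) * E1 <= 1 * E1 by apply: ler_wpM2r => //; rewrite /th; lra.
  rewrite mul1r => h; apply: (le_trans (lerD (lexx _) (le_trans hM2 h))).
  by rewrite mulr_natl mulr2n.
apply: (le_trans (lerD u1 (lexx _))).
rewrite Ek Ef /C'.
have -> : 2 * ((G1 + K) / 2) = G1 + K by field.
set S := F0 + F1 + F2 + (G + G1).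
have -> : (2 + 2 * A ^+ 2 + C0) * S = 2 * S + 2 * (A ^+ 2 * S) + C0 * S by ring.
apply: lerD; last by apply: ler_wpM2l; [exact: ltW|rewrite /S; lra].
apply: (le_trans (lerD (lexx _) h1)); rewrite addrA; apply: lerD; first by rewrite /S; lra.
by apply: ler_wpM2l => //; apply: ler_wpM2l => //; rewrite /S; lra.
Qed.

End equivalence.

(** * Curves in L^2 *)

Section curves.
Variable R : realType.
Local Notation mu := (@lebesgue_measure R).
Local Notation oo a b := (`]a, b[%classic : set (measurableTypeR R)).
Implicit Types (f g k r phi : R -> R) (t s h : R) (u v : R -> R -> R).
Variable L : R.
Hypothesis L0 : 0 < L.
Local Notation D := (oo 0 L).
Let mD : measurable D. Proof. exact: measurable_itv. Qed.

Lemma ip_cvg (T : Type) (F : set_system T) (FF : Filter F) (u v : T -> R -> R) (u0 v0 : R -> R) :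
  (\forall s \near F, sqi D (u s)) -> (\forall s \near F, sqi D (v s)) -> sqi D u0 -> sqi D v0 ->
  nrm D (fun x => u s x - u0 x) @[s --> F] --> (0 : R) ->
  nrm D (fun x => v s x - v0 x) @[s --> F] --> (0 : R) ->
  ip D (u s) (v s) @[s --> F] --> ip D u0 v0.
Proof.
move=> su sv su0 sv0 cu cv.
have c0 : nrm D (fun x => u s x - u0 x) * nrm D v0 + nrm D u0 * nrm D (fun x => v s x - v0 x) +
    nrm D (fun x => u s x - u0 x) * nrm D (fun x => v s x - v0 x) @[s --> F] --> (0 : R).
  rewrite -[X in _ --> X](_ : 0 * nrm D v0 + nrm D u0 * 0 + 0 * 0 = 0); last by ring.
  apply: cvgD; last exact: cvgM.
  by apply: cvgD; apply: cvgM => //; exact: cvg_cst.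
apply/cvgrPdist_le => e e0.
move/cvgrPdist_le : c0 => /(_ e e0) c0.
near=> s.
have h1 : sqi D (u s) by near: s.
have h2 : sqi D (v s) by near: s.
have h3 : `|0 - (nrm D (fun x => u s x - u0 x) * nrm D v0 + nrm D u0 * nrm D (fun x => v s x - v0 x) +
    nrm D (fun x => u s x - u0 x) * nrm D (fun x => v s x - v0 x))| <= e by near: s.
apply: le_trans h3; rewrite sub0r normrN; apply: le_trans (ler_norm _).
have d1 := sqiB mD h1 su0; have d2 := sqiB mD h2 sv0.
have -> : ip D u0 v0 - ip D (u s) (v s) =
  - (ip D (fun x => u s x - u0 x) v0 + ip D u0 (fun x => v s x - v0 x) +
     ip D (fun x => u s x - u0 x) (fun x => v s x - v0 x)).
  by rewrite !ipBl// !ipBr//; ring.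
rewrite normrN; apply: (le_trans (ler_normD _ _)); apply: lerD.
  apply: (le_trans (ler_normD _ _)); apply: lerD; exact: cauchy_schwarz.
exact: cauchy_schwarz.
Unshelve. all: by end_near. Qed.

(** Continuity reaches t = 0, from the right, whereas [curve_der] asks for a two-sided derivative at
    t > 0: the differential inequality lives on the open half-line, the functional on the closed
    one. *)
Definition curve_cont u := (forall s, 0 <= s -> sqi D (u s)) /\
  forall t, 0 <= t ->
    nrm D (fun x => u s x - u t x) @[s --> within `[0, +oo[ (nbhs t)] --> (0 : R).

Definition curve_der u u' := forall t, 0 < t ->
  nrm D (fun x => (s - t)^-1 * (u s x - u t x) - u' t x) @[s --> t^'] --> (0 : R).

Lemma near_ge0 t : 0 <= t -> \forall s \near within `[0, +oo[ (nbhs t), 0 <= s.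
Proof. by move=> _; rewrite near_withinE; apply: nearW => s; rewrite /= in_itv/= andbT. Qed.

Lemma ip_cont u v : curve_cont u -> curve_cont v ->
  {within `[0, +oo[, continuous (fun s => ip D (u s) (v s))}.
Proof.
move=> [su cu] [sv cv]; apply/subspace_continuousP => t; rewrite /= in_itv/= andbT => t0.
apply: ip_cvg; [| |exact: su|exact: sv|exact: cu|exact: cv].
  by apply: filterS (near_ge0 t0) => s; exact: su.
by apply: filterS (near_ge0 t0) => s; exact: sv.
Qed.

Lemma quot_is_derive f t d : (s - t)^-1 * (f s - f t) @[s --> t^'] --> d ->
  is_derive t (1 : R) f d.
Proof.
move=> h.
have cv : h^-1 *: (f (h *: (1 : R) + t) - f t) @[h --> (0:R)^'] --> d.
  apply/cvgrPdist_lt => e e0.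
  move/cvgrPdist_lt : h => /(_ e e0).
  rewrite !near_withinE => /nbhs_ballP[r /= r0 hr].
  apply/nbhs_ballP; exists r => //= k; rewrite /ball/= sub0r normrN => kr k0.
  have := hr (k + t); rewrite /ball/= opprD addrCA subrr addr0 normrN => /(_ kr).
  rewrite addrK /GRing.scale /= mulr1; apply.
  by apply: contra k0 => /eqP e1; apply/eqP; move: e1 => /(congr1 (fun z => z - t)); rewrite addrK subrr.
apply: DeriveDef; last exact/cvg_lim.
by apply/cvg_ex; exists d.
Qed.

Lemma near_gt0 t : 0 < t -> \forall s \near t^', 0 < s.
Proof. by move=> t0; apply: nbhs_dnbhs; exact: lt_nbhsr. Qed.

Lemma ip_der u v u' v' t : 0 < t -> (forall s, 0 <= s -> sqi D (u s)) -> (forall s, 0 <= s -> sqi D (v s)) ->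
  sqi D (u' t) -> sqi D (v' t) -> curve_der u u' -> curve_der v v' ->
  is_derive t (1 : R) (fun s => ip D (u s) (v s)) (ip D (u' t) (v t) + ip D (u t) (v' t)).
Proof.
move=> t0 su sv su' sv' du dv; apply: quot_is_derive.
have t0' := ltW t0.
have n1 : \forall s \near t^', sqi D (fun x => (s - t)^-1 * (u s x - u t x)).
  near=> s; apply: sqiZ => //; apply: sqiB => //; apply: su => //; apply: ltW; near: s; exact: near_gt0.
have n2 : \forall s \near t^', sqi D (fun x => (s - t)^-1 * (v s x - v t x)).
  near=> s; apply: sqiZ => //; apply: sqiB => //; apply: sv => //; apply: ltW; near: s; exact: near_gt0.
have z w : nrm D (fun x => w x - w x) = 0.
  rewrite /nrm /ip (int_eq (g := fun=> 0)) ?/Rintegral ?integral0 ?sqrtr0//.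
  by move=> x _; rewrite subrr mulr0.
have zc w : nrm D (fun x => w x - w x) @[s --> t^'] --> (0 : R) by rewrite z; exact: cvg_cst.
have FF : Filter t^' by typeclasses eauto.
have nu : \forall s \near t^', sqi D (u t) by apply: nearW => s; exact: su.
have nv : \forall s \near t^', sqi D (v t) by apply: nearW => s; exact: sv.
have c1 := ip_cvg FF n1 nv su' (sv _ t0') (du _ t0) (zc _).
have c2 := ip_cvg FF nu n2 (su _ t0') sv' (zc _) (dv _ t0).
have c3 := ip_cvg FF n1 n2 su' sv' (du _ t0) (dv _ t0).
have c4 : (s - t) @[s --> t^'] --> (0 : R).
  have c4' : (s - t) @[s --> t] --> t - t by apply: cvgB; [exact: cvg_id|exact: cvg_cst].
  by rewrite subrr in c4'; exact: cvg_within_filter c4'.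
(* The quotient of a bilinear form is exactly this sum; the third term carries a factor s - t and
   disappears in the limit. *)
have H : ip D (fun x => (s - t)^-1 * (u s x - u t x)) (v t) +
    ip D (u t) (fun x => (s - t)^-1 * (v s x - v t x)) +
    (s - t) * ip D (fun x => (s - t)^-1 * (u s x - u t x)) (fun x => (s - t)^-1 * (v s x - v t x))
    @[s --> t^'] --> ip D (u' t) (v t) + ip D (u t) (v' t) + 0 * ip D (u' t) (v' t).
  by apply: cvgD; [exact: cvgD|exact: cvgM].
move: H; rewrite mul0r addr0; apply: cvg_trans; apply: near_eq_cvg; near=> s.
have s0 : 0 <= s by apply: ltW; near: s; exact: near_gt0.
have st : s - t != 0 by rewrite subr_eq0; near: s; exact: nbhs_dnbhs_neq.
have [[s1 s2] [s3 s4]] := ((su s s0, su t t0'), (sv s s0, sv t t0')).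
have d1 := sqiB mD s1 s2; have d2 := sqiB mD s3 s4.
rewrite /= !ipZl// ?ipZr//; last exact: sqiZ.
rewrite !ipBl// !ipBr//; field.
Unshelve. all: by end_near. Qed.

Lemma cder_mul u u' (m : R -> R) (C : R) : measurable_fun D m -> 0 <= C ->
  {ae mu, forall x, D x -> `|m x| <= C} -> (forall s, 0 <= s -> sqi D (u s)) ->
  (forall s, 0 <= s -> sqi D (u' s)) ->
  curve_der u u' -> curve_der (fun s x => m x * u s x) (fun s x => m x * u' s x).
Proof.
move=> mm C0 hC su su' du t t0.
have c0 : C * nrm D (fun x => (s - t)^-1 * (u s x - u t x) - u' t x) @[s --> t^'] --> (0 : R).
  by rewrite -[X in _ --> X](mulr0 C); apply: cvgM; [exact: cvg_cst|exact: du].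
apply: (squeeze_cvgr _ (cvg_cst 0) c0); near=> s.
rewrite nrm_ge0 /=.
have s0 : 0 <= s by apply: ltW; near: s; exact: near_gt0.
have -> : (fun x => (s - t)^-1 * (m x * u s x - m x * u t x) - m x * u' t x) =
  (fun x => m x * ((s - t)^-1 * (u s x - u t x) - u' t x)).
  by apply/funext => x; ring.
apply: nrm_bdd => //; apply: sqiB => //; last by apply: su'; exact: ltW.
apply: sqiZ => //; apply: sqiB => //; apply: su => //; exact: ltW.
Unshelve. all: by end_near. Qed.

Lemma ccont_mul u (m : R -> R) (C : R) : measurable_fun D m -> 0 <= C ->
  {ae mu, forall x, D x -> `|m x| <= C} -> curve_cont u -> curve_cont (fun s x => m x * u s x).
Proof.
move=> mm C0 hC [su cu]; split; first by move=> s s0; apply: sqi_bdd hC _ => //; exact: su.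
move=> t t0.
have c0 : C * nrm D (fun x => u s x - u t x) @[s --> within `[0, +oo[ (nbhs t)] --> (0 : R).
  by rewrite -[X in _ --> X](mulr0 C); apply: cvgM; [exact: cvg_cst|exact: cu].
apply: (squeeze_cvgr _ (cvg_cst 0) c0); apply: filterS (near_ge0 t0) => s s0.
rewrite nrm_ge0 /=.
have -> : (fun x => m x * u s x - m x * u t x) = (fun x => m x * (u s x - u t x)).
  by apply/funext => x; ring.
by apply: nrm_bdd => //; apply: sqiB => //; exact: su.
Qed.

Lemma shift_within f (t h l : R) : 0 <= h -> f s @[s --> within `[0, +oo[ (nbhs (t + h))] --> l ->
  f (s + h) @[s --> within `[0, +oo[ (nbhs t)] --> l.
Proof.
move=> h0 hf; apply/cvgrPdist_lt => e e0.
move/cvgrPdist_lt : hf => /(_ e e0).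
rewrite !near_withinE => /nbhs_ballP[r /= r0 hr].
apply/nbhs_ballP; exists r => //= k kr; rewrite in_itv/= andbT => k0.
apply: hr; first by move: kr; rewrite /ball/= opprD addrACA subrr addr0.
by rewrite /= in_itv/= andbT addr_ge0.
Qed.

Lemma shift_dnbhs f (t h l : R) : f s @[s --> (t + h)^'] --> l -> f (s + h) @[s --> t^'] --> l.
Proof.
move=> hf; apply/cvgrPdist_lt => e e0.
move/cvgrPdist_lt : hf => /(_ e e0).
rewrite !near_withinE => /nbhs_ballP[r /= r0 hr].
apply/nbhs_ballP; exists r => //= k kr kt.
apply: hr; first by move: kr; rewrite /ball/= opprD addrACA subrr addr0.
by apply: contra kt => /eqP /addIr ->.
Qed.

(** Spelled as a linear combination so that [H1pair_lin] and [H10pair_lin] apply to it directly. *)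
Definition dq h u (s : R) : R -> R := fun x => h^-1 * u (s + h) x + (- h^-1) * u s x.

Lemma sqi_dq h u s : 0 <= h -> 0 <= s -> (forall s, 0 <= s -> sqi D (u s)) -> sqi D (dq h u s).
Proof.
move=> h0 s0 su; apply: sqiD => //; apply: sqiZ => //; apply: su => //; exact: addr_ge0.
Qed.

Lemma ccont_dq h u : 0 < h -> curve_cont u -> curve_cont (dq h u).
Proof.
move=> h0 [su cu]; have h0' := ltW h0; split; first by move=> s s0; exact: sqi_dq.
move=> t t0.
have th0 : 0 <= t + h by rewrite addr_ge0.
have c1 := shift_within h0' (cu _ th0).
have c0 : h^-1 * nrm D (fun x => u (s + h) x - u (t + h) x) + h^-1 * nrm D (fun x => u s x - u t x)
   @[s --> within `[0, +oo[ (nbhs t)] --> (0 : R).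
  rewrite -[X in _ --> X](_ : h^-1 * 0 + h^-1 * 0 = 0); last by ring.
  by apply: cvgD; apply: cvgM; [exact: cvg_cst|exact: c1|exact: cvg_cst|exact: cu].
apply: (squeeze_cvgr _ (cvg_cst 0) c0); apply: filterS (near_ge0 t0) => s s0.
rewrite nrm_ge0 /=.
have -> : (fun x => dq h u s x - dq h u t x) =
  (fun x => h^-1 * (u (s + h) x - u (t + h) x) + (- h^-1) * (u s x - u t x)).
  by apply/funext => x; rewrite /dq; ring.
have s1 : sqi D (fun x => u (s + h) x - u (t + h) x) by apply: sqiB => //; apply: su => //; rewrite addr_ge0.
have s2 : sqi D (fun x => u s x - u t x) by apply: sqiB => //; exact: su.
apply: (le_trans (nrmD mD (sqiZ mD _ s1) (sqiZ mD _ s2))).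
by rewrite !nrmZ// normrN !ger0_norm// invr_ge0.
Qed.

Lemma cder_dq h u u' : 0 < h -> (forall s, 0 <= s -> sqi D (u s)) -> (forall s, 0 <= s -> sqi D (u' s)) ->
  curve_der u u' -> curve_der (dq h u) (dq h u').
Proof.
move=> h0 su su' du t t0; have h0' := ltW h0; have t0' := ltW t0.
have th0 : 0 < t + h by rewrite addr_gt0.
have c1 := shift_dnbhs (du _ th0).
have c0 : h^-1 * nrm D (fun x => (s + h - (t + h))^-1 * (u (s + h) x - u (t + h) x) - u' (t + h) x) +
    h^-1 * nrm D (fun x => (s - t)^-1 * (u s x - u t x) - u' t x) @[s --> t^'] --> (0 : R).
  rewrite -[X in _ --> X](_ : h^-1 * 0 + h^-1 * 0 = 0); last by ring.
  by apply: cvgD; apply: cvgM; [exact: cvg_cst|exact: c1|exact: cvg_cst|exact: du].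
apply: (squeeze_cvgr _ (cvg_cst 0) c0); near=> s.
have s0 : 0 <= s by apply: ltW; near: s; exact: near_gt0.
rewrite nrm_ge0 /=.
have -> : s + h - (t + h) = s - t by ring.
have -> : (fun x => (s - t)^-1 * (dq h u s x - dq h u t x) - dq h u' t x) =
  (fun x => h^-1 * ((s - t)^-1 * (u (s + h) x - u (t + h) x) - u' (t + h) x) +
    (- h^-1) * ((s - t)^-1 * (u s x - u t x) - u' t x)).
  by apply/funext => x; rewrite /dq; ring.
have s1 : sqi D (fun x => (s - t)^-1 * (u (s + h) x - u (t + h) x) - u' (t + h) x).
  apply: sqiB => //; last by apply: su'; exact: ltW.
  by apply: sqiZ => //; apply: sqiB => //; apply: su => //; rewrite addr_ge0.
have s2 : sqi D (fun x => (s - t)^-1 * (u s x - u t x) - u' t x).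
  apply: sqiB => //; last by apply: su'; exact: ltW.
  by apply: sqiZ => //; apply: sqiB => //; exact: su.
apply: (le_trans (nrmD mD (sqiZ mD _ s1) (sqiZ mD _ s2))).
by rewrite !nrmZ// normrN !ger0_norm// invr_ge0.
Unshelve. all: by end_near. Qed.

Lemma dq_lim u u' t : 0 < t -> curve_der u u' ->
  nrm D (fun x => dq n.+1%:R^-1 u t x - u' t x) @[n --> \oo] --> (0 : R).
Proof.
move=> t0 du; have := du _ t0 => /cvgr_dnbhsP.
move=> /(_ (fun n => t + n.+1%:R^-1)) h.
have : (nrm D (fun x => (t + n.+1%:R^-1 - t)^-1 * (u (t + n.+1%:R^-1) x - u t x) - u' t x)) @[n --> \oo] --> (0 : R).
  apply: h; split.
    by move=> n; rewrite -subr_eq0 addrAC subrr add0r invr_eq0.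
  rewrite -[X in _ --> X]addr0; apply: cvgD; [exact: cvg_cst|exact: cvg_harmonic].
apply: cvg_trans; apply: near_eq_cvg; apply: nearW => n /=; congr nrm; apply/funext => x.
by rewrite /dq addrAC subrr add0r invrK; ring.
Qed.

End curves.

(** * Differential inequalities in time *)

Section time.
Variable R : realType.
Local Notation mu := (@lebesgue_measure R).
Local Notation oo a b := (`]a, b[%classic : set (measurableTypeR R)).
Implicit Types (f g u w phi : R -> R) (t s : R).

Lemma within_pos u t : {within `[0, +oo[, continuous u} -> 0 < t -> {for t, continuous u}.
Proof.
move=> /subspace_continuousP cu t0.
have := cu t; rewrite /= in_itv/= (ltW t0) => /(_ isT) h.
apply/cvgrPdist_lt => e e0; move/cvgrPdist_lt : h => /(_ e e0).
rewrite near_withinE => h; near=> s.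
have hs : s \in `[0, +oo[ -> `|u t - u s| < e by near: s.
apply: hs; rewrite in_itv/= andbT ltW//; near: s; exact: lt_nbhsr.
Unshelve. all: by end_near. Qed.

Lemma within_sub u (L : R) : {within `[0, +oo[, continuous u} -> {within `[0, L], continuous u}.
Proof. by apply: continuous_subspaceW => x /=; rewrite !in_itv/= andbT => /andP[]. Qed.

Lemma within_intg u (b c : R) : {within `[0, +oo[, continuous u} -> 0 <= b -> intg (oo b c) u.
Proof.
move=> cu b0; have [bc|cb] := leP b c; last first.
  by rewrite set_itv_ge ?bnd_simp -?leNgt ?ltW//; exact: integrable_set0.
have c0 := le_trans b0 bc.
apply: (@intg_oo_sub _ 0 c) => //; apply: intg_oo; apply: continuous_compact_integrable.
  exact: segment_compact.
exact: within_sub.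
Qed.

Lemma Pint_derive u t : {within `[0, +oo[, continuous u} -> 0 < t -> is_derive t (1 : R) (Pint u) (u t).
Proof.
move=> cu t0; have t1 : t < t + 1 by rewrite ltrDl.
have iu (c : R) : intg (oo 0 c) u by exact: within_intg.
have [h1 h2] := continuous_FTC1_closed t1 (intg_cc (iu (t + 1))) t0 (within_pos cu t0).
have hh : is_derive t (1 : R) (fun x => \int[mu]_(t in [set` `[0, x]]) u t) (u t).
  by apply: DeriveDef; [exact: h1|rewrite -derive1E].
have -> // : Pint u = (fun x => \int[mu]_(t in [set` `[0, x]]) u t).
by apply/funext => y; rewrite int_cc.
Qed.

Lemma Pint_diff u (b c : R) : {within `[0, +oo[, continuous u} -> 0 <= b -> b <= c ->
  Pint u c - Pint u b = \int[mu]_(t in `]b, c[) u t.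
Proof.
move=> cu b0 bc; have c0 := le_trans b0 bc.
by rewrite /Pint (chasles b0 bc (within_intg c cu (lexx 0))) addrC addKr.
Qed.

(** The mean of u over [t, t + 1 / (n + 1)], a window ahead of t so that it stays in the half-line
    where u is continuous. *)
Definition steklov (n : nat) u t := n.+1%:R * (Pint u (t + n.+1%:R^-1) - Pint u t).

Lemma steklov_cvg u t : {within `[0, +oo[, continuous u} -> 0 < t ->
  steklov n u t @[n --> \oo] --> u t.
Proof.
move=> cu t0; have [h1 h2] := Pint_derive cu t0.
have : h^-1 *: ((Pint u \o shift t) (h *: (1 : R)) - Pint u t) @[h --> (0 : R)^'] --> u t.
  by rewrite -h2; exact: h1.
move=> /cvgr_dnbhsP /(_ (fun n => n.+1%:R^-1)) h.
have : (n.+1%:R^-1)^-1 *: ((Pint u \o shift t) (n.+1%:R^-1 *: (1 : R)) - Pint u t) @[n --> \oo] --> u t.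
  apply: h; split; first by move=> n; rewrite invr_eq0.
  exact: cvg_harmonic.
apply: cvg_trans; apply: near_eq_cvg; apply: nearW => n.
by rewrite /= /steklov invrK /GRing.scale /= mulr1 [_ + t]addrC.
Qed.

Lemma steklov_bound u (L M : R) n t : {within `[0, +oo[, continuous u} ->
  (forall s, 0 <= s <= L + 1 -> `|u s| <= M) -> 0 <= t -> t <= L -> `|steklov n u t| <= M.
Proof.
move=> cu hM t0 tL.
have n0 : (0 : R) < n.+1%:R^-1 by rewrite invr_gt0.
have n1 : (n.+1%:R^-1 : R) <= 1 by rewrite invf_le1// ler1n.
have tt : t <= t + n.+1%:R^-1 by rewrite lerDl ltW.
rewrite /steklov Pint_diff//.
have mf := intg_meas (within_intg (t + n.+1%:R^-1) cu t0).
have [|_ h] := int_bound (C := M) tt mf.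
  apply: aeA => s; rewrite /= in_itv/= => /andP[ts st]; apply: hM.
  by rewrite (le_trans t0 (ltW ts))/= (le_trans (ltW st))// lerD.
rewrite normrM ger0_norm// -ler_pdivlMl//.
by apply: le_trans h _; rewrite addrAC subrr add0r mulrC.
Qed.

Lemma steklov_prim u (L : R) n : 0 <= L -> {within `[0, +oo[, continuous u} ->
  prim L (steklov n u) (fun t => n.+1%:R * (u (t + n.+1%:R^-1) - u t)).
Proof.
move=> L0 cu; set k : R := n.+1%:R^-1.
have k0 : 0 < k by rewrite invr_gt0.
have ck (f : R -> R) : (forall t, 0 < t -> {for t, continuous f}) ->
    {within `[0, L], continuous (fun t => f (t + k))}.
  move=> cf; apply: continuous_in_subspaceT => t; rewrite inE /= in_itv/= => /andP[t0 _].
  apply: (@continuous_comp _ _ _ (fun t => t + k) f).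
    by apply: cvgD; [exact: cvg_id|exact: cvg_cst].
  by apply: cf; rewrite ltr_wpDl.
have cP t : 0 < t -> {for t, continuous (Pint u)}.
  by move=> t0; have [h _] := Pint_derive cu t0; exact/differentiable_continuous/derivable1_diffP.
have cPL : {within `[0, L], continuous (Pint u)} by apply: Pint_cont => //; exact: within_intg.
have w1 := ck _ cP; have w2 := ck _ (fun t => within_pos cu (t := t)).
apply: prim_C1 => //.
- move=> t; apply: cvgM; first exact: cvg_cst.
  by apply: cvgB; [exact: w1|exact: cPL].
- move=> t; apply: cvgM; first exact: cvg_cst.
  by apply: cvgB; [exact: w2|exact: (within_sub cu)].
- move=> t; rewrite in_itv/= => /andP[t0 _].
  have tk : 0 < t + k by rewrite addr_gt0.
  have d1 : is_derive t (1 : R) (fun t => Pint u (t + k)) (u (t + k) * 1).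
    apply: (@is_derive_comp _ (Pint u) (fun t => t + k)); first exact: Pint_derive.
    by have := is_derive_affine 1 k t; congr is_derive; apply/funext => y; rewrite mul1r.
  have := is_deriveZ (n.+1%:R) (is_deriveB d1 (Pint_derive cu t0)).
  by rewrite mulr1.
Qed.

Lemma test_half_line phi : test_function `]0, +oo[ phi -> exists2 L, 0 < L & test_function `]0, L[ phi.
Proof.
move=> [hD [K [cK KL Kphi]]].
have [K0|/set0P [z Kz]] := eqVneq K set0.
  exists 1 => //; split => //; exists set0; split => //; first exact: compact0.
  by rewrite -K0.
have cid : {within K, continuous (id : R -> R)}.
  by apply: continuous_subspaceT => x; exact: cvg_id.
have [b bK hb] := compact_EVT_max (ex_intro _ z Kz) cK cid.
move: bK; rewrite inE => bK.
have := KL _ bK; rewrite /= in_itv/= andbT => b0.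
exists (b + 1); first by rewrite addr_gt0.
split => //; exists K; split => // x Kx.
have := KL _ Kx; rewrite /= !in_itv/= andbT => ->/=.
by apply: le_lt_trans (hb x _) _; rewrite ?inE// ltrDl.
Qed.

Lemma int_half_line f (L : R) : (forall x, L <= x -> f x = 0) ->
  \int[mu]_(t in `]0, +oo[) f t = \int[mu]_(t in `]0, L[) f t.
Proof.
move=> h; rewrite Rintegral_mkcond [RHS]Rintegral_mkcond; congr Rintegral.
apply/funext => x; rewrite !patchE !mem_setE !in_itv/= andbT.
have [Lx|xL] := leP L x; last by rewrite andbT.
by rewrite andbF h//; case: ifP.
Qed.

Lemma test_derive0 (L : R) phi : 0 < L -> test_function `]0, L[ phi ->
  forall x, L <= x -> phi x = 0 /\ derive1 phi x = 0.
Proof.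
move=> L0 tp x Lx; have [a [b [a0 ab bL k]]] := test_supp L0 tp.
have bx : b < x by exact: lt_le_trans Lx.
split; first by apply: k; rewrite negb_and -!ltNge bx orbT.
rewrite derive1E -[RHS](@derive_cst R R R 0 x 1); apply: near_eq_derive.
near=> y; apply: k; rewrite negb_and -!ltNge; apply/orP; right; near: y; exact: lt_nbhsr.
Unshelve. all: by end_near. Qed.

(* The Steklov averages of u are C^1, which allows integrating by parts. *)
Lemma distr_derivative_le_intro u w : {within `[0, +oo[, continuous u} -> {within `[0, +oo[, continuous w} ->
  (forall t1 t2, 0 < t1 -> t1 <= t2 -> u t2 - u t1 <= \int[mu]_(t in `]t1, t2[) w t) ->
  distr_derivative_le u w.
Proof.
move=> cu cw huw; split => // phi tphi phi0.
have [L L0 tp] := test_half_line tphi.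
have z := test_derive0 L0 tp.
rewrite (@int_half_line _ L); last by move=> x Lx; have [_ ->] := z x Lx; rewrite mulr0.
rewrite (@int_half_line _ L); last by move=> x Lx; have [-> _] := z x Lx; rewrite mulr0.
have L0' := ltW L0; have L10 : 0 <= L + 1 by rewrite addr_ge0.
have [pphi phi00 phiL] := test_prim L0 tp.
have [sphi sphi'] := test_sqi L0 tp.
(* The windows have length at most 1, so bounds on [0, L + 1] dominate all the averages on
   [0, L]. *)
have [_ [Mu Mu0 hMu]] := cont_bound L10 (within_sub (L := L + 1) cu).
have [_ [Mw Mw0 hMw]] := cont_bound L10 (within_sub (L := L + 1) cw).
(* The derivative of the average of u is the difference quotient of u, which [huw] bounds by the
   average of w over the same window. *)
have key n : - (\int[mu]_(t in oo 0 L) (steklov n u t * derive1 phi t)) <=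
   \int[mu]_(t in oo 0 L) (steklov n w t * phi t).
  have pu := steklov_prim n L0' cu.
  have := prim_total L0' (primM L0' pu pphi).
  have su : sqi (oo 0 L) (steklov n u).
    apply: (@sqi_bounded _ _ _ Mu) => //; first exact: prim_meas pu.
    by move=> x /andP[x0 xL]; exact: steklov_bound hMu x0 xL.
  have sw : sqi (oo 0 L) (steklov n w).
    apply: (@sqi_bounded _ _ _ Mw) => //; first exact: prim_meas (steklov_prim n L0' cw).
    by move=> x /andP[x0 xL]; exact: steklov_bound hMw x0 xL.
  have sd : intg (oo 0 L) (fun t => n.+1%:R * (u (t + n.+1%:R^-1) - u t) * phi t).
    apply: (test_mul_intg L0 tp); exact: (proj1 pu).
  have i1 := sqi_mul (measurable_itv _) su sphi'.
  have i2 := sqi_mul (measurable_itv _) sw sphi.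
  rewrite phi00 phiL !mulr0 subrr intD// => /eqP; rewrite addr_eq0 => /eqP e.
  have h : (\int[mu]_(t in oo 0 L) (n.+1%:R * (u (t + n.+1%:R^-1) - u t) * phi t)) <=
      \int[mu]_(t in oo 0 L) (steklov n w t * phi t); last by move: h; rewrite e.
  apply: int_le_ae => //.
  apply: aeA => t; rewrite /= in_itv/= => /andP[t0 tL].
  apply: ler_wpM2r => //; rewrite /steklov; apply: ler_wpM2l => //.
  have tt : t <= t + n.+1%:R^-1 by rewrite lerDl.
  rewrite Pint_diff// ?(ltW t0)//; exact: huw.
have mder : measurable_fun (oo 0 L) (derive1 phi) by case: sphi'.
have mphi : measurable_fun (oo 0 L) phi by case: sphi.
have lim1 : \int[mu]_(t in oo 0 L) (steklov n u t * derive1 phi t) @[n --> \oo] -->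
    \int[mu]_(t in oo 0 L) (u t * derive1 phi t).
  apply: (@dct _ _ _ _ (fun t => Mu * `|derive1 phi t|)).
  - exact: measurable_itv.
  - by move=> n; apply: measurable_funM => //; exact: prim_meas (steklov_prim n L0' cu).
  - by apply: measurable_funM => //; exact: intg_meas (within_intg L cu (lexx 0)).
  - by apply: intgZ => //; apply: integrable_norm; exact: sqi_intg.
  - move=> n x; rewrite /= in_itv/= => /andP[x0 xL]; rewrite normrM; apply: ler_wpM2r => //.
    exact: steklov_bound hMu (ltW x0) (ltW xL).
  - move=> x; rewrite /= in_itv/= => /andP[x0 xL]; apply: cvgM; last exact: cvg_cst.
    exact: steklov_cvg.
have lim2 : \int[mu]_(t in oo 0 L) (steklov n w t * phi t) @[n --> \oo] -->
    \int[mu]_(t in oo 0 L) (w t * phi t).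
  apply: (@dct _ _ _ _ (fun t => Mw * `|phi t|)).
  - exact: measurable_itv.
  - by move=> n; apply: measurable_funM => //; exact: prim_meas (steklov_prim n L0' cw).
  - by apply: measurable_funM => //; exact: intg_meas (within_intg L cw (lexx 0)).
  - by apply: intgZ => //; apply: integrable_norm; exact: sqi_intg.
  - move=> n x; rewrite /= in_itv/= => /andP[x0 xL]; rewrite normrM; apply: ler_wpM2r => //.
    exact: steklov_bound hMw (ltW x0) (ltW xL).
  - move=> x; rewrite /= in_itv/= => /andP[x0 xL]; apply: cvgM; last exact: cvg_cst.
    exact: steklov_cvg.
exact: (ler_cvg_to (cvgN lim1) lim2 (nearW _ key)).
Qed.

(* Fatou's lemma, by dominated convergence of min (f_n, f). *)
Lemma int_liminf_le (b c : R) (f_ : nat -> R -> R) f (B : nat -> R) (B0 : R) :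
  (forall n, intg (oo b c) (f_ n)) -> intg (oo b c) f ->
  (forall n t, b < t < c -> 0 <= f_ n t) ->
  (forall t, b < t < c -> f_ n t @[n --> \oo] --> f t) ->
  (forall n, \int[mu]_(t in `]b, c[) f_ n t <= B n) -> B n @[n --> \oo] --> B0 ->
  \int[mu]_(t in `]b, c[) f t <= B0.
Proof.
move=> if_ if0 f0 cf hB cB.
have mo : measurable (oo b c) by exact: measurable_itv.
have f00 t : b < t < c -> 0 <= f t.
  by move=> h; apply: (ler_cvg_to (cvg_cst 0) (cf t h)); apply: nearW => n; exact: f0.
have mm n : measurable_fun (oo b c) (fun t => Num.min (f_ n t) (f t)).
  by apply: measurable_minr; exact: intg_meas.
have hm n t : b < t < c -> `|Num.min (f_ n t) (f t)| <= `|f t|.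
  move=> h; rewrite ger0_norm ?le_min ?f0 ?f00//.
  by rewrite [leRHS]ger0_norm ?f00// ge_min lexx orbT.
have im n : intg (oo b c) (fun t => Num.min (f_ n t) (f t)).
  apply: (intg_le_ae mo (mm n) _ if0); apply: aeA => t; rewrite /= in_itv/=; exact: hm.
have L : \int[mu]_(t in oo b c) Num.min (f_ n t) (f t) @[n --> \oo] --> \int[mu]_(t in oo b c) f t.
  apply: (@dct _ _ _ _ (fun t => `|f t|)) => //.
  - exact: intg_meas.
  - exact: integrable_norm.
  - move=> x; rewrite /= in_itv/= => h.
    have : (f_ n x + f x - `|f_ n x - f x|) / 2 @[n --> \oo] --> (f x + f x - `|f x - f x|) / 2.
      apply: cvgM; last exact: cvg_cst.
      have c1 : f_ n x @[n --> \oo] --> f x := cf x h.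
      have c2 : (fun=> f x) n @[n --> \oo] --> f x by exact: cvg_cst.
      by apply: cvgB; [apply: cvgD|apply: cvg_norm; apply: cvgB].
    have -> : (f x + f x - `|f x - f x|) / 2 = f x by rewrite subrr normr0; field.
    by apply: cvg_trans; apply: near_eq_cvg; apply: nearW => n; rewrite /= minr_absE.
apply: (ler_cvg_to L cB); apply: nearW => n; apply: le_trans (hB n).
apply: int_le_ae => //; apply: aeA => t _; rewrite ge_min lexx//.
Qed.

End time.

(** * Decay of the Lyapunov functional *)

Section functionals.
Variable R : realType.
Local Notation oo a b := (`]a, b[%classic : set (measurableTypeR R)).
Implicit Types (u v w z : R -> R -> R) (t s h : R).

Lemma nonincr (f f' : R -> R) t1 t2 : (forall t, 0 < t -> is_derive t (1 : R) f (f' t)) ->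
  (forall t, 0 < t -> f' t <= 0) -> 0 < t1 -> t1 <= t2 -> f t2 <= f t1.
Proof.
move=> df f'0 t10 t12.
have [||c] := @MVT_segment _ f f' t1 t2 t12.
- by move=> x; rewrite in_itv/= => /andP[x1 _]; apply: df; exact: lt_trans x1.
- apply: continuous_in_subspaceT => x; rewrite inE /= in_itv/= => /andP[x1 _].
  have [h _] := df x (lt_le_trans t10 x1).
  exact/differentiable_continuous/derivable1_diffP.
rewrite in_itv/= => /andP[c1 _] e.
by rewrite -subr_le0 e mulr_le0_ge0 ?subr_ge0// f'0// (lt_le_trans t10).
Qed.

Lemma is_derive_ext (f g : R -> R) t (a b : R) : is_derive t (1 : R) f a -> (forall s, g s = f s) ->
  b = a -> is_derive t (1 : R) g b.
Proof. by move=> d /funext -> ->. Qed.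

Variables (L : R) (p q : R -> R) (eps1 : R).
Hypotheses (L0 : 0 < L) (cp : {within `[0, L], continuous p}) (cq : {within `[0, L], continuous q}).
Local Notation D := (oo 0 L).
Let mD : measurable D. Proof. exact: measurable_itv. Qed.

Lemma ccontB u v : curve_cont L u -> curve_cont L v -> curve_cont L (fun s x => u s x - v s x).
Proof.
move=> [su cu] [sv cv]; split; first by move=> s s0; apply: sqiB => //; [exact: su|exact: sv].
move=> t t0.
have c0 : nrm D (fun x => u s x - u t x) + nrm D (fun x => v s x - v t x)
   @[s --> within `[0, +oo[ (nbhs t)] --> (0 : R).
  by rewrite -[X in _ --> X](addr0 0); apply: cvgD; [exact: cu|exact: cv].
apply: (squeeze_cvgr _ (cvg_cst 0) c0); apply: filterS (near_ge0 t0) => s s0.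
rewrite nrm_ge0 /=.
have -> : (fun x => u s x - v s x - (u t x - v t x)) =
  (fun x => (u s x - u t x) + (-1) * (v s x - v t x)) by apply/funext => x; ring.
have s1 : sqi D (fun x => u s x - u t x) by apply: sqiB => //; exact: su.
have s2 : sqi D (fun x => v s x - v t x) by apply: sqiB => //; exact: sv.
apply: (le_trans (nrmD mD s1 (sqiZ mD _ s2))).
by rewrite nrmZ// normrN normr1 mul1r.
Qed.

(** [half_sq] and [V1c] are the energy and V_1 along curves with the space derivative as an
    independent curve, so that they can be evaluated at difference quotients of [Dx]. *)
Definition half_sq u v s := (ip D (u s) (u s) + ip D (v s) (v s)) / 2.

Definition V1c w w1 z s := half_sq w1 z s +
  eps1 * (ip D (fun x => p x * w s x) (z s) + ip D (fun x => q x * z s x) (w1 s)).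

Lemma half_sq_ge0 u v s : 0 <= half_sq u v s.
Proof. by rewrite divr_ge0// addr_ge0// ip_ge0. Qed.

Lemma within_lin (k1 k2 : R) (f g : R -> R) : {within `[0, +oo[, continuous f} ->
  {within `[0, +oo[, continuous g} -> {within `[0, +oo[, continuous (fun s => k1 * f s + k2 * g s)}.
Proof.
move=> cf cg t; apply: cvgD; apply: cvgM; [exact: cvg_cst|exact: cf|exact: cvg_cst|exact: cg].
Qed.

Lemma half_sq_cont u v : curve_cont L u -> curve_cont L v ->
  {within `[0, +oo[, continuous (half_sq u v)}.
Proof.
move=> cu cv.
have -> : half_sq u v = (fun s => 2^-1 * ip D (u s) (u s) + 2^-1 * ip D (v s) (v s)).
  by apply/funext => s; rewrite /half_sq; ring.
by apply: within_lin; exact: ip_cont.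
Qed.

Let cm (m : R -> R) u : {within `[0, L], continuous m} -> curve_cont L u ->
  curve_cont L (fun s x => m x * u s x).
Proof. by move=> c cu; have [mm m0 h] := cont_Linfty L0 c; exact: ccont_mul h cu. Qed.

Let dm (m : R -> R) u u' : {within `[0, L], continuous m} ->
  (forall s, 0 <= s -> sqi D (u s)) -> (forall s, 0 <= s -> sqi D (u' s)) ->
  curve_der L u u' -> curve_der L (fun s x => m x * u s x) (fun s x => m x * u' s x).
Proof. by move=> c su su' du; have [mm m0 h] := cont_Linfty L0 c; exact: cder_mul h su su' du. Qed.

Let sm (m : R -> R) (f : R -> R) : {within `[0, L], continuous m} -> sqi D f -> sqi D (fun x => m x * f x).
Proof. by move=> c sf; have [mm m0 h] := cont_Linfty L0 c; exact: sqi_bdd h sf. Qed.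

Lemma V1c_cont w w1 z : curve_cont L w -> curve_cont L w1 -> curve_cont L z ->
  {within `[0, +oo[, continuous (V1c w w1 z)}.
Proof.
move=> cw cw1 cz.
have c1 := half_sq_cont cw1 cz.
have c2 := @within_lin 1 1 _ _ (ip_cont (cm cp cw) cz) (ip_cont (cm cq cz) cw1).
have -> : V1c w w1 z = (fun s => 1 * half_sq w1 z s + eps1 * (1 * ip D (fun x => p x * w s x) (z s) +
    1 * ip D (fun x => q x * z s x) (w1 s))).
  by apply/funext => s; rewrite /V1c !mul1r.
exact: within_lin.
Qed.

Lemma half_sq_der u v u' v' t : 0 < t ->
  (forall s, 0 <= s -> sqi D (u s)) -> (forall s, 0 <= s -> sqi D (v s)) ->
  sqi D (u' t) -> sqi D (v' t) -> curve_der L u u' -> curve_der L v v' ->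
  is_derive t (1 : R) (half_sq u v) (ip D (u t) (u' t) + ip D (v t) (v' t)).
Proof.
move=> t0 su sv su' sv' du dv.
have d1 := ip_der t0 su su su' su' du du.
have d2 := ip_der t0 sv sv sv' sv' dv dv.
have d := is_deriveZ (2^-1) (is_deriveD d1 d2).
apply: is_derive_ext d _ _ => [s|]; first by rewrite /half_sq /GRing.scale /= mulrC.
by rewrite (ipC _ (u' t)) (ipC _ (v' t)) /GRing.scale /=; field.
Qed.

Lemma V1c_der w w1 z w1' z' t : 0 < t ->
  (forall s, 0 <= s -> sqi D (w s)) -> (forall s, 0 <= s -> sqi D (w1 s)) ->
  (forall s, 0 <= s -> sqi D (z s)) -> (forall s, 0 <= s -> sqi D (w1' s)) ->
  (forall s, 0 <= s -> sqi D (z' s)) ->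
  curve_der L w z -> curve_der L w1 w1' -> curve_der L z z' ->
  is_derive t (1 : R) (V1c w w1 z) (dissipation L q p eps1 (w t) (w1 t) (z t) (w1' t) (z' t)).
Proof.
move=> t0 sw sw1 sz sw1' sz' dw dw1 dz; have t0' := ltW t0.
have d1 := half_sq_der t0 sw1 sz (sw1' _ t0') (sz' _ t0') dw1 dz.
have d2 := ip_der t0 (fun s ks => sm cp (sw s ks)) sz (sm cp (sz _ t0')) (sz' _ t0') (dm cp sw sz dw) dz.
have d3 := ip_der t0 (fun s ks => sm cq (sz s ks)) sw1 (sm cq (sz' _ t0')) (sw1' _ t0') (dm cq sz sz' dz) dw1.
have d := is_deriveD d1 (is_deriveZ eps1 (is_deriveD d2 d3)).
apply: is_derive_ext d _ _ => //.
by rewrite /dissipation /GRing.scale /= !addrA.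
Qed.

Section limits.
Variables (wn w1n zn : nat -> R -> R) (w w1 z : R -> R -> R) (t : R).
Hypotheses (swn : forall n, sqi D (wn n)) (sw1n : forall n, sqi D (w1n n)) (szn : forall n, sqi D (zn n))
  (sw : sqi D (w t)) (sw1 : sqi D (w1 t)) (sz : sqi D (z t))
  (cw : nrm D (fun x => wn n x - w t x) @[n --> \oo] --> (0 : R))
  (cw1 : nrm D (fun x => w1n n x - w1 t x) @[n --> \oo] --> (0 : R))
  (cz : nrm D (fun x => zn n x - z t x) @[n --> \oo] --> (0 : R)).

Let FF : Filter \oo. Proof. exact: eventually_filter. Qed.

Lemma half_sq_cvg : half_sq (fun=> w1n n) (fun=> zn n) t @[n --> \oo] --> half_sq w1 z t.
Proof.
apply: cvgM; last exact: cvg_cst.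
by apply: cvgD; apply: ip_cvg => //; apply: nearW.
Qed.

Let cmn (m : R -> R) (un : nat -> R -> R) (u : R -> R) : {within `[0, L], continuous m} ->
  (forall n, sqi D (un n)) -> sqi D u ->
  nrm D (fun x => un n x - u x) @[n --> \oo] --> (0 : R) ->
  nrm D (fun x => m x * un n x - m x * u x) @[n --> \oo] --> (0 : R).
Proof.
move=> c sun su cu; have [mm m0 h] := cont_Linfty L0 c.
have c0 : Linfty_norm L m * nrm D (fun x => un n x - u x) @[n --> \oo] --> (0 : R).
  by rewrite -[X in _ --> X](mulr0 (Linfty_norm L m)); apply: cvgM; [exact: cvg_cst|exact: cu].
apply: (squeeze_cvgr _ (cvg_cst 0) c0); apply: nearW => n.
rewrite nrm_ge0 /=.
have -> : (fun x => m x * un n x - m x * u x) = (fun x => m x * (un n x - u x)).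
  by apply/funext => x; ring.
by apply: nrm_bdd => //; apply: sqiB.
Qed.

Lemma V1c_cvg : V1c (fun=> wn n) (fun=> w1n n) (fun=> zn n) t @[n --> \oo] --> V1c w w1 z t.
Proof.
apply: cvgD; first exact: half_sq_cvg.
apply: cvgM; first exact: cvg_cst.
apply: cvgD.
  apply: ip_cvg => //; [by apply: nearW => n; exact: sm|by apply: nearW|exact: sm|exact: cmn].
apply: ip_cvg => //; [by apply: nearW => n; exact: sm|by apply: nearW|exact: sm|exact: cmn].
Qed.

End limits.

End functionals.

(** * Difference quotients in time and passage to the limit *)

Section decay.
Variable R : realType.
Local Notation mu := (@lebesgue_measure R).
Local Notation oo a b := (`]a, b[%classic : set (measurableTypeR R)).
Implicit Types (f g : R -> R) (t s h : R).
Variables (L : R) (a : R -> R) (x0 x1 amin : R)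
    (q q' q'' p p' p'' : R -> R) (deltaq deltap eps1 : R).
Hypotheses (L_gt0 : 0 < L)
    (a_bounded : Linfty L a)
    (a_ge0 : ae0L L (fun x => 0 <= a x))
    (x0_ge0 : 0 <= x0) (x1_le_L : x1 <= L)
    (amin_gt0 : 0 < amin)
    (a_damping : {ae lebesgue_measure, forall x : R,
                    x \in `]x0, x1[ -> amin <= a x})
    (q_C2 : C2 L q q' q'') (p_C2 : C2 L p p' p'')
    (hQ : condQ L x0 x1 q q' deltaq)
    (hP : condP L x0 x1 q' p deltaq deltap)
    (eps1_gt0 : 0 < eps1)
    (eps1_lt : eps1 < Num.min (1 / (2 * cstC3 L a p q q' amin deltap))
                              (Linfty_norm L q + L / pi * Linfty_norm L p)^-1).
Local Notation D := (oo 0 L).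
Let mD : measurable D. Proof. exact: measurable_itv. Qed.
Local Notation chi := (\1_(oo x0 x1) : R -> R).
Local Notation C1 := (cstC1 L p'').
Local Notation C0 := (cstC0 L p'' amin eps1).
Local Notation delta := (Num.min (cst_delta1 eps1 deltap) (cst_delta2 amin eps1 deltaq)).
(** These stand for y, y_x, y_xx, y_t and y_tx; K below is y_tt as given by the equation. No time
    derivative of K is assumed. *)
Variables (Y0 Y1 Y2 Z0 Z1 : R -> R -> R).
Local Notation K := (fun s x => Y2 s x - a x * Z0 s x).
Local Notation e := (half_sq L Y1 Z0).
Local Notation V1c := (V1c L p q eps1).
Hypotheses (cY1 : curve_cont L Y1) (cY2 : curve_cont L Y2) (cZ0 : curve_cont L Z0) (cZ1 : curve_cont L Z1)
  (cY0 : curve_cont L Y0)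
  (dY0 : curve_der L Y0 Z0) (dY1 : curve_der L Y1 Z1) (dZ0 : curve_der L Z0 K)
  (pY0 : forall s, 0 <= s -> H10pair L (Y0 s) (Y1 s))
  (pY1 : forall s, 0 <= s -> H1pair L (Y1 s) (Y2 s))
  (pZ0 : forall s, 0 <= s -> H10pair L (Z0 s) (Z1 s)).

Lemma cK : curve_cont L K.
Proof.
have [ma A0 ha] := Linfty_ae a_bounded.
by apply: ccontB; [exact: cY2|exact: ccont_mul ha cZ0].
Qed.

Let sY0 := proj1 cY0. Let sY1 := proj1 cY1. Let sY2 := proj1 cY2.
Let sZ0 := proj1 cZ0. Let sZ1 := proj1 cZ1. Let sK := proj1 cK.

(** The terms in y_x y_tx and y_t y_xx cancel by integration by parts, because y_t vanishes at both
    ends. *)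
Lemma energy_der t : 0 < t -> is_derive t (1 : R) e (- ip D (fun x => a x * Z0 t x) (Z0 t)).
Proof.
move=> t0; have t0' := ltW t0.
apply: is_derive_ext (half_sq_der t0 sY1 sZ0 (sZ1 t0') (sK t0') dY1 dZ0) _ _ => //.
rewrite ipBr//; [|exact: sY2|exact: sqi_a (sZ0 t0')|exact: sZ0].
rewrite (H10pair_ip L_gt0 (pZ0 t0') (pY1 t0')) (ipC _ (Z1 t)) (ipC _ (Z0 t)).
ring.
Qed.

Lemma chi_pos f : 0 <= ip D (fun x => chi x * f x) f.
Proof.
have -> : ip D (fun x => chi x * f x) f = ip D (fun x => chi x * f x) (fun x => chi x * f x).
  rewrite /ip; congr (\int[_]_(x in _) _); apply/funext => x.
  by rewrite indicE; case: (_ \in _); rewrite ?mul1r// !mul0r.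
exact: ip_ge0.
Qed.

Lemma chi_damping f : sqi D f -> amin * ip D (fun x => chi x * f x) f <= ip D (fun x => a x * f x) f.
Proof.
move=> sf; have i1 := sqi_mul mD (sqi_chi x0 x1 sf) sf.
have i2 := sqi_mul mD (sqi_a a_bounded sf) sf.
rewrite /ip -intZ//; apply: int_le_ae => //; first exact: intgZ.
apply: aeS (coef_ae L_gt0 a_bounded a_ge0 a_damping q_C2 p_C2) => x hx Dx.
have [[ax _ _ _] [_ hd _]] := hx Dx.
have -> : amin * (chi x * f x * f x) = amin * chi x * f x ^+ 2 by ring.
have -> : a x * f x * f x = a x * f x ^+ 2 by ring.
apply: ler_wpM2r; first exact: sqr_ge0.
rewrite indicE; case: (boolP (x \in _)) => [|_]; last by rewrite mulr0.
by rewrite inE /= in_itv/= mulr1.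
Qed.

(* The derivative of the left-hand side, minus the damping outside the support of chi,
   is the nonpositive quadratic form - amin * chi * (Z0 - w) ^ 2. *)
Lemma energy_increment h t : 0 < h -> 0 < t ->
  amin * (h * ip D (fun x => chi x * dq h Y0 t x) (dq h Y0 t)) + (e (t + h) - e t) <= 0.
Proof.
move=> h0 t0; have h0' := ltW h0; have t0' := ltW t0.
set w := dq h Y0 t.
have th0 : 0 <= t + h by rewrite addr_ge0.
have sw : sqi D w by exact: sqi_dq.
set B := ip D (fun x => chi x * w x) w.
(* With w frozen, G is affine in [Y0 s] up to the energy. As h w = Y0 (t + h) - Y0 t, its first part
   grows by amin (2 h B - h B) over [t, t + h], so G (t + h) - G t is the left-hand side of the
   claim. *)
pose G s := amin * (2 * ip D (fun x => chi x * Y0 s x) w - s * B) + e s.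
have schi s : 0 <= s -> sqi D (fun x => chi x * Y0 s x) by move=> s0; apply: sqi_chi; exact: sY0.
have cz : curve_der L (fun=> w) (fun _ _ => 0).
  move=> s s0; have -> : (fun s1 : R => nrm D (fun x => (s1 - s)^-1 * (w x - w x) - 0)) = fun=> 0.
    apply/funext => s1; rewrite /nrm /ip (int_eq (g := fun=> 0)) ?/Rintegral ?integral0 ?sqrtr0//.
    by move=> x _; rewrite subrr mulr0 subr0 mulr0.
  exact: cvg_cst.
have dG s : 0 < s -> is_derive s (1 : R) G
   (amin * (2 * ip D (fun x => chi x * Z0 s x) w - B) - ip D (fun x => a x * Z0 s x) (Z0 s)).
  move=> s0; have s0' := ltW s0.
  have dchi : curve_der L (fun s x => chi x * Y0 s x) (fun s x => chi x * Z0 s x).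
    by apply: (@cder_mul _ _ _ _ _ 1) => //; apply: aeA => x _; exact: chi_bound.
  have d1 := ip_der s0 schi (fun _ _ => sw) (sqi_chi x0 x1 (sZ0 s0')) (sqi0 mD) dchi cz.
  have d2 := is_deriveB (is_deriveZ 2 d1) (is_derive_affine B 0 s).
  apply: is_derive_ext (is_deriveD (is_deriveZ amin d2) (energy_der s0)) _ _.
    by move=> r; have -> : G r = amin * (2 * ip D (fun x => chi x * Y0 r x) w - (B * r + 0)) + e r by rewrite /G addr0 (mulrC r).
  rewrite /GRing.scale /=; congr (_ * (_ * _ - _) + _).
  rewrite [X in _ + X](_ : _ = 0) ?addr0// /ip (int_eq (g := fun=> 0)) ?/Rintegral ?integral0//.
  by move=> x _; rewrite mulr0.
have G'0 s : 0 < s -> amin * (2 * ip D (fun x => chi x * Z0 s x) w - B) - ip D (fun x => a x * Z0 s x) (Z0 s) <= 0.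
  move=> s0; have s0' := ltW s0; have sz := sZ0 s0'.
  have h1 := chi_damping sz.
  have := chi_pos (fun x => Z0 s x - w x).
  have -> : (fun x => chi x * (Z0 s x - w x)) = (fun x => chi x * Z0 s x - chi x * w x).
    by apply/funext => x; rewrite mulrBr.
  have sc1 := sqi_chi x0 x1 sz; have sc2 := sqi_chi x0 x1 sw.
  have sb := sqiB mD sz sw.
  rewrite ipBl// !ipBr// -/B.
  have -> : ip D (fun x => chi x * w x) (Z0 s) = ip D (fun x => chi x * Z0 s x) w.
    by rewrite /ip; congr (\int[_]_(x in _) _); apply/funext => x; ring.
  move: h1; set X := ip _ _ w; set Z := ip _ _ (Z0 s); set W := ip _ _ (Z0 s) => h1 h2.
  have := mulr_ge0 (ltW amin_gt0) h2; move: h1; rewrite !mulrBr; lra.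
have := nonincr dG G'0 t0 (_ : t <= t + h); rewrite lerDl => /(_ h0').
have hB : h * B = ip D (fun x => chi x * Y0 (t + h) x) w - ip D (fun x => chi x * Y0 t x) w.
  have -> : B = ip D (fun x => h^-1 * (chi x * Y0 (t + h) x) + (- h^-1) * (chi x * Y0 t x)) w.
    by rewrite /B; congr (ip _ _ _); apply/funext => x; rewrite /w /dq; ring.
  have q1 := schi _ th0; have q2 := schi _ t0'.
  rewrite ipDl ?ipZl//; [|exact: sqiZ|exact: sqiZ].
  by rewrite mulrDr mulNr mulrN !mulrA mulfV ?gt_eqF// !mul1r.
rewrite /G; move: hB; set X1 := ip _ _ w; set X2 := ip _ _ w => hB.
have -> : (t + h) * B = t * B + h * B by ring.
have e1 : amin * (2 * X1 - (t * B + h * B)) - amin * (2 * X2 - t * B) = amin * (h * B).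
  by rewrite hB; ring.
move: e1; set p1 := amin * (_ - (_ + _)); set p2 := amin * (_ - _); set p3 := amin * (h * B).
move=> e1 h2; lra.
Qed.

(* V_s with the time derivatives y_t, y_tx, y_tt replaced by difference quotients of step h, and the
   energy by its average over [s, s + h]. *)
Definition V_quot h s := V1c (dq h Y0) (dq h Y1) (dq h Z0) s + C0 * (h^-1 * (Pint e (s + h) - Pint e s)).

Lemma delta_ge0 : 0 <= delta.
Proof.
have [_ _ dq0 _] := hQ; have [_ /andP[dp0 _] _] := hP.
rewrite le_min /cst_delta1 /cst_delta2 le_min; apply/and3P; split.
- by rewrite divr_ge0// mulr_ge0// ltW.
- by rewrite divr_ge0// ltW.
- by rewrite divr_ge0// mulr_ge0// ltW.
Qed.

Let ce : {within `[0, +oo[, continuous e}. Proof. exact: half_sq_cont. Qed.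

Lemma V_quot_der h t : 0 < h -> 0 < t -> is_derive t (1 : R) (V_quot h)
  (dissipation L q p eps1 (dq h Y0 t) (dq h Y1 t) (dq h Z0 t) (dq h Z1 t) (dq h K t) +
   C0 * (h^-1 * (e (t + h) - e t))).
Proof.
move=> h0 t0; have h0' := ltW h0.
have [cp _ _ _] := p_C2; have [cq _ _ _] := q_C2.
have sdq (u : R -> R -> R) : (forall s, 0 <= s -> sqi D (u s)) -> forall s, 0 <= s -> sqi D (dq h u s).
  by move=> su s s0; exact: sqi_dq.
have d1 := V1c_der eps1 L_gt0 cp cq t0 (sdq _ sY0) (sdq _ sY1) (sdq _ sZ0) (sdq _ sZ1) (sdq _ sK)
  (cder_dq h0 sY0 sZ0 dY0) (cder_dq h0 sY1 sZ1 dY1) (cder_dq h0 sZ0 sK dZ0).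
have d2 : is_derive t (1 : R) (fun s => Pint e (s + h)) (e (t + h) * 1).
  apply: (@is_derive_comp _ (Pint e) (fun s => s + h)); first by apply: Pint_derive => //; rewrite addr_gt0.
  by apply: is_derive_ext (is_derive_affine 1 h t) _ _ => // s; rewrite mul1r.
have d3 := is_deriveZ C0 (is_deriveZ h^-1 (is_deriveB d2 (Pint_derive ce t0))).
apply: is_derive_ext (is_deriveD d1 d3) _ _ => //.
by rewrite /GRing.scale /= mulr1.
Qed.

(** [energy_increment] multiplied by eps1 C_1 / (amin h) is the remainder eps1 C_1 B of
    [static_ineq] plus the energy quotient with coefficient eps1 C_1 / amin: this is the reason for
    the value of C_0. *)
Lemma V_quot_dissipation h t : 0 < h -> 0 < t ->
  dissipation L q p eps1 (dq h Y0 t) (dq h Y1 t) (dq h Z0 t) (dq h Z1 t) (dq h K t) +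
   C0 * (h^-1 * (e (t + h) - e t)) <= - (2 * delta) * half_sq L (dq h Y1) (dq h Z0) t.
Proof.
move=> h0 t0; have h0' := ltW h0; have t0' := ltW t0.
have th0 : 0 <= t + h by rewrite addr_ge0.
have p1 : H10pair L (dq h Y0 t) (dq h Y1 t) by apply: H10pair_lin => //; exact: pY0.
have p2 : H1pair L (dq h Y1 t) (dq h Y2 t) by apply: H1pair_lin => //; exact: pY1.
have p3 : H10pair L (dq h Z0 t) (dq h Z1 t) by apply: H10pair_lin => //; exact: pZ0.
have eq0 : {ae mu, forall x, D x -> dq h K t x = dq h Y2 t x - a x * dq h Z0 t x}.
  by apply: aeA => x _; rewrite /dq; ring.
have := static_ineq L_gt0 a_bounded a_ge0 x0_ge0 x1_le_L amin_gt0 a_damping q_C2 p_C2 hQ hP eps1_gt0 eps1_lt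
   p1 p2 p3 (sqi_dq h0' t0' sK) eq0.
have en := energy_increment h0 t0.
have C1ge : 0 <= eps1 * C1 / amin / h.
  have [_ _ c2 _] := p_C2; have [_ P2 _] := cont_Linfty L_gt0 c2.
  by rewrite !divr_ge0// ?mulr_ge0// /cstC1 ?divr_ge0// ?addr_ge0// ltW.
have := mulr_ge0_le0 C1ge en.
rewrite /cst_delta1.
have n1 := ip_ge0 D (dq h Y1 t); have n2 := ip_ge0 D (dq h Z0 t).
rewrite /half_sq.
set B := ip D (fun x => chi x * _) _; set n1' := ip D (dq h Y1 t) _; set n2' := ip D (dq h Z0 t) _.
set dd := dissipation _ _ _ _ _ _ _ _ _.
rewrite (_ : eps1 * C1 / amin / h * (amin * (h * B) + (e (t + h) - e t)) =
  eps1 * C1 * B + C0 * (h^-1 * (e (t + h) - e t))); last first.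
  by rewrite /cstC0; field; rewrite !gt_eqF.
have m1 : delta * n1' <= cst_delta1 eps1 deltap * n1' by apply: ler_wpM2r => //; rewrite ge_min lexx.
have m2 : delta * n2' <= cst_delta2 amin eps1 deltaq * n2'.
  by apply: ler_wpM2r => //; rewrite ge_min lexx orbT.
move: m1 m2; rewrite /cst_delta1.
set k1 := eps1 * deltap / 2; set k2 := cst_delta2 _ _ _; set kk := Num.min _ _; set k3 := eps1 * C1 * B.
set k4 := C0 * _.
rewrite (_ : - (2 * kk) * ((n1' + n2') / 2) = - (kk * n1') - kk * n2'); last by field.
rewrite !mulNr.
set j1 := kk * n1'; set j2 := kk * n2'; set j3 := k1 * n1'; set j4 := k2 * n2'.
move: j1 j2 j3 j4 k3 k4 dd => j1 j2 j3 j4 k3 k4 dd; lra.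
Qed.

Lemma V_quot_decay h t1 t2 : 0 < h -> 0 < t1 -> t1 <= t2 ->
  \int[mu]_(t in oo t1 t2) (2 * delta * half_sq L (dq h Y1) (dq h Z0) t) <= V_quot h t1 - V_quot h t2.
Proof.
move=> h0 t10 t12.
have cE : {within `[0, +oo[, continuous (half_sq L (dq h Y1) (dq h Z0))}.
  by apply: half_sq_cont; exact: ccont_dq.
have d t : 0 < t -> is_derive t (1 : R) (fun s => V_quot h s + 2 * delta * Pint (half_sq L (dq h Y1) (dq h Z0)) s)
   (dissipation L q p eps1 (dq h Y0 t) (dq h Y1 t) (dq h Z0 t) (dq h Z1 t) (dq h K t) +
   C0 * (h^-1 * (e (t + h) - e t)) + 2 * delta * half_sq L (dq h Y1) (dq h Z0) t).
  move=> t0.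
  exact: is_derive_ext (is_deriveD (V_quot_der h0 t0) (is_deriveZ (2 * delta) (Pint_derive cE t0))) _ _.
have d' t : 0 < t -> dissipation L q p eps1 (dq h Y0 t) (dq h Y1 t) (dq h Z0 t) (dq h Z1 t) (dq h K t) +
   C0 * (h^-1 * (e (t + h) - e t)) + 2 * delta * half_sq L (dq h Y1) (dq h Z0) t <= 0.
  by move=> t0; have := V_quot_dissipation h0 t0; rewrite mulNr -subr_le0 opprK.
have := nonincr d d' t10 t12.
rewrite intZ//; last by apply: within_intg => //; exact: ltW.
rewrite -Pint_diff//; last exact: ltW.
rewrite mulrBr; set X1 := 2 * _ * Pint _ t2; set X2 := 2 * _ * Pint _ t1; lra.
Qed.

Definition V_curve s := V1c Z0 Z1 K s + C0 * e s.

Lemma V_curve_cont : {within `[0, +oo[, continuous V_curve}.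
Proof.
have [cp _ _ _] := p_C2; have [cq _ _ _] := q_C2.
have c1 := @V1c_cont _ _ _ _ eps1 L_gt0 cp cq _ _ _ cZ0 cZ1 cK.
have := within_lin (k1 := 1) (k2 := C0) c1 ce.
have -> // : (fun s => 1 * V1c Z0 Z1 K s + C0 * e s) = V_curve.
by apply/funext => s; rewrite mul1r.
Qed.

(** The quotients of y, y_x, y_t tend in L^2 to y_t, y_tx, y_tt, on which V_1 is continuous, and the
    averaged energy is a Steklov mean of [e]. *)
Lemma V_quot_cvg t : 0 < t -> V_quot n.+1%:R^-1 t @[n --> \oo] --> V_curve t.
Proof.
move=> t0; have t0' := ltW t0.
have [cp _ _ _] := p_C2; have [cq _ _ _] := q_C2.
have n0 n : (0 : R) <= n.+1%:R^-1 by rewrite invr_ge0.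
apply: cvgD.
  apply: (@V1c_cvg _ L p q eps1 L_gt0 cp cq (fun n => dq n.+1%:R^-1 Y0 t) (fun n => dq n.+1%:R^-1 Y1 t)
    (fun n => dq n.+1%:R^-1 Z0 t) Z0 Z1 K t) => //.
  - by move=> n; exact: sqi_dq.
  - by move=> n; exact: sqi_dq.
  - by move=> n; exact: sqi_dq.
  - exact: sZ0.
  - exact: sZ1.
  - exact: sK.
  - exact: (dq_lim t0 dY0).
  - exact: (dq_lim t0 dY1).
  - exact: (dq_lim t0 dZ0).
apply: cvgM; first exact: cvg_cst.
have := steklov_cvg ce t0; apply: cvg_trans; apply: near_eq_cvg; apply: nearW => n.
by rewrite /steklov invrK.
Qed.

Lemma V_curve_decay t1 t2 : 0 < t1 -> t1 <= t2 ->
  \int[mu]_(t in oo t1 t2) (2 * delta * half_sq L Z1 K t) <= V_curve t1 - V_curve t2.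
Proof.
move=> t10 t12; have t20 := lt_le_trans t10 t12.
have n0 n : (0 : R) < n.+1%:R^-1 by rewrite invr_gt0.
apply: (@int_liminf_le _ t1 t2 (fun n t => 2 * delta * half_sq L (dq n.+1%:R^-1 Y1) (dq n.+1%:R^-1 Z0) t) _
   (fun n => V_quot n.+1%:R^-1 t1 - V_quot n.+1%:R^-1 t2)).
- move=> n; apply: intgZ => //; apply: within_intg; last exact: ltW.
  by apply: half_sq_cont; exact: ccont_dq.
- by apply: intgZ => //; apply: within_intg; [apply: half_sq_cont; [exact: cZ1|exact: cK]|exact: ltW].
- by move=> n t _; rewrite mulr_ge0 ?half_sq_ge0// mulr_ge0// delta_ge0.
- move=> t /andP[tt _]; have t0 := lt_trans t10 tt; have t0' := ltW t0.
  apply: cvgM; first exact: cvg_cst.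
  apply: (@half_sq_cvg _ L (fun n => dq n.+1%:R^-1 Y1 t) (fun n => dq n.+1%:R^-1 Z0 t) Z1 K t).
  - by move=> n; apply: sqi_dq => //; exact: ltW.
  - by move=> n; apply: sqi_dq => //; exact: ltW.
  - exact: sZ1.
  - exact: sK.
  - exact: (dq_lim t0 dY1).
  - exact: (dq_lim t0 dZ0).
- by move=> n; exact: V_quot_decay.
- by apply: cvgB; exact: V_quot_cvg.
Qed.

End decay.

(** * Strong solutions *)

Section strong.
Variable R : realType.
Local Notation mu := (@lebesgue_measure R).
Local Notation oo a b := (`]a, b[%classic : set (measurableTypeR R)).
Implicit Types (f g k phi : R -> R) (t s c : R) (u v : R -> R -> R).
Variable L : R.
Hypothesis L0 : 0 < L.
Let L0' : 0 <= L. Proof. exact: ltW. Qed.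
Local Notation D := (oo 0 L).
Let mD : measurable D. Proof. exact: measurable_itv. Qed.

Lemma within_dnbhs (f : R -> R) t (l : R) : 0 < t ->
  f s @[s --> within `[0, +oo[ t^'] --> l -> f s @[s --> t^'] --> l.
Proof.
move=> t0 h; apply/cvgrPdist_lt => e e0; move/cvgrPdist_lt : h => /(_ e e0).
rewrite near_withinE => h; near=> s.
have hs : s \in `[0, +oo[ -> `|l - f s| < e by near: s.
by apply: hs; rewrite in_itv/= andbT ltW//; near: s; exact: near_gt0.
Unshelve. all: by end_near. Qed.

Lemma squeeze_cont u (N : R -> R -> R) : (forall s, 0 <= s -> sqi D (u s)) ->
  (forall s t, 0 <= s -> 0 <= t -> nrm D (fun x => u s x - u t x) <= N s t) ->
  (forall t, 0 <= t -> N s t @[s --> within `[0, +oo[ (nbhs t)] --> (0 : R)) -> curve_cont L u.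
Proof.
move=> su le_N cN; split => // t t0.
apply: (squeeze_cvgr _ (cvg_cst 0) (cN _ t0)); apply: filterS (near_ge0 t0) => s hs.
by rewrite nrm_ge0 /=; exact: le_N.
Qed.

Lemma squeeze_der u u' (N : R -> R -> R) :
  (forall s t, 0 < s -> 0 < t -> nrm D (fun x => (s - t)^-1 * (u s x - u t x) - u' t x) <= N s t) ->
  (forall t, 0 <= t -> N s t @[s --> within `[0, +oo[ t^'] --> (0 : R)) -> curve_der L u u'.
Proof.
move=> le_N cN t t0.
have c0 := within_dnbhs t0 (cN _ (ltW t0)).
apply: (squeeze_cvgr _ (cvg_cst 0) c0); apply: filterS (near_gt0 t0) => s hs.
by rewrite nrm_ge0 /=; exact: le_N.
Qed.

Lemma int0LE f g : int0L L (fun x => f x * g x) = ip D f g. Proof. by []. Qed.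

Lemma le_sqrt3 (x y z : R) : 0 <= x -> 0 <= y -> 0 <= z ->
  [/\ x <= Num.sqrt (x ^+ 2 + y ^+ 2 + z ^+ 2), y <= Num.sqrt (x ^+ 2 + y ^+ 2 + z ^+ 2)
    & z <= Num.sqrt (x ^+ 2 + y ^+ 2 + z ^+ 2)].
Proof.
move=> x0 y0 z0.
have [x2 y2 z2] : [/\ 0 <= x ^+ 2, 0 <= y ^+ 2 & 0 <= z ^+ 2] by rewrite !sqr_ge0.
have s0 : 0 <= x ^+ 2 + y ^+ 2 + z ^+ 2 by rewrite !addr_ge0.
split.
- by rewrite -[leLHS](ger0_norm x0) -sqrtr_sqr ler_sqrt// -addrA lerDl addr_ge0.
- by rewrite -[leLHS](ger0_norm y0) -sqrtr_sqr ler_sqrt// addrAC lerDr addr_ge0.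
- by rewrite -[leLHS](ger0_norm z0) -sqrtr_sqr ler_sqrt// lerDr addr_ge0.
Qed.

Lemma le_H2norm f : [/\ nrm D f <= H2norm L f, nrm D (Dx L f) <= H2norm L f &
  nrm D (Dx L (Dx L f)) <= H2norm L f].
Proof. by rewrite /H2norm !L2normE; apply: le_sqrt3; exact: nrm_ge0. Qed.

Lemma Dx_sub f g : H1 L f -> H1 L g ->
  {ae mu, forall x, D x -> Dx L (f - g) x = Dx L f x - Dx L g x}.
Proof.
move=> hf hg; have sf := H1_sqi hf; have sg := H1_sqi hg.
exact: (Dx_ae L0 (sqiB mD sf sg) (weakB L0 sf sg (H1_Dx hf) (H1_Dx hg))).
Qed.

Lemma nrm_Dx_sub f g : H1 L f -> H1 L g ->
  nrm D (fun x => Dx L f x - Dx L g x) = nrm D (Dx L (f - g)).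
Proof.
move=> hf hg; have sf := H1_sqi hf; have sg := H1_sqi hg.
exact/esym/(Dx_nrm L0 (sqiB mD sf sg) (weakB L0 sf sg (H1_Dx hf) (H1_Dx hg))).
Qed.

Lemma H1_sub f g : H1 L f -> H1 L g -> H1 L (f - g).
Proof.
move=> hf hg; have sf := H1_sqi hf; have sg := H1_sqi hg.
exact: (weak_H1 (sqiB mD sf sg) (weakB L0 sf sg (H1_Dx hf) (H1_Dx hg))).
Qed.

Lemma nrm_Dx_quot c f g k : H1 L f -> H1 L g -> H1 L k ->
  nrm D (fun x => c * (Dx L f x - Dx L g x) - Dx L k x) <= H1norm L (c *: (f - g) - k).
Proof.
move=> hf hg hk; have sf := H1_sqi hf; have sg := H1_sqi hg; have sk := H1_sqi hk.
have s1 := sqiB mD sf sg; have w1 := weakB L0 sf sg (H1_Dx hf) (H1_Dx hg).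
have s2 := sqiZ mD c s1; have w2 := weakZ L0 c s1 w1.
have := Dx_nrm L0 (sqiB mD s2 sk) (weakB L0 s2 sk w2 (H1_Dx hk)) => <-.
exact: nrm_Dx_le_H1norm.
Qed.

(** [Dx L (f - g)] is only almost everywhere the difference of the derivatives; [weak_eq_ae] carries
    the second derivative across this identity. *)
Lemma nrm_DDx_sub f g : H2 L f -> H2 L g ->
  nrm D (fun x => Dx L (Dx L f) x - Dx L (Dx L g) x) <= H2norm L (f - g).
Proof.
move=> [f1 f2] [g1 g2].
have sDf := H1_sqi f2; have sDg := H1_sqi g2.
have h1 := H1_sub f1 g1.
have w := weakB L0 sDf sDg (H1_Dx f2) (H1_Dx g2).
have w' := weak_eq_ae L0 (sqiB mD sDf sDg) (H1_Dx_sqi h1) (Dx_sub f1 g1) w.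
rewrite -(Dx_nrm L0 (H1_Dx_sqi h1) w').
by have [] := le_H2norm (f - g).
Qed.

Lemma H1normZ c f : H1 L f -> H1norm L (fun x => c * f x) = `|c| * H1norm L f.
Proof.
move=> hf; have sf := H1_sqi hf.
rewrite /H1norm !L2normE (nrmZ mD c sf).
rewrite (Dx_nrm L0 (sqiZ mD c sf) (weakZ L0 c sf (H1_Dx hf))) (nrmZ mD c (H1_Dx_sqi hf)).
move: (nrm D f) (nrm D (Dx L f)) => x y.
by rewrite !exprMn -mulrDr sqrtrM ?sqr_ge0// sqrtr_sqr normr_id.
Qed.

(** The bound C on the unit ball makes the set under [sup] bounded, so that its elements are indeed
    below [Hm1norm]. *)
Lemma le_Hm1norm (F : (R -> R) -> R) (C : R) (v : R -> R) : (forall w, H10 L w -> H1norm L w <= 1 -> `|F w| <= C) ->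
  H10 L v -> H1norm L v <= 1 -> `|F v| <= Hm1norm L F.
Proof.
move=> hC hv v1; apply: ub_le_sup; last by exists v.
by exists C => _ [w [hw w1] <-]; exact: hC.
Qed.

(** [Hm1norm] controls functionals on the unit ball only; the factor 1 / (1 + N), with N the H^1
    norm of phi, is also defined when N = 0. *)
Lemma test_unit phi : test_function `]0, L[ phi -> exists2 c, 0 < c &
  test_function `]0, L[ (fun x => c * phi x) /\ H1norm L (fun x => c * phi x) <= 1.
Proof.
move=> tphi; set N := H1norm L phi.
have N0 : 0 <= N by exact: H1norm_ge0.
have N1 : 0 < 1 + N by rewrite ltr_pwDl.
exists (1 + N)^-1; first by rewrite invr_gt0.
split.
  have -> : (fun x => (1 + N)^-1 * phi x) = (fun x => phi x - (1 - (1 + N)^-1) * phi x).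
    by apply/funext => x; ring.
  exact: testB.
have [h _] := test_H10 L0 tphi.
rewrite H1normZ// -/N ger0_norm ?invr_ge0 ?(ltW N1)// mulrC ler_pdivrMr// mul1r lerDr//.
Qed.

Variables (a y0 y1 : R -> R) (y yt : R -> R -> R).
Hypotheses (a_bounded : Linfty L a) (sol : strong_solution L a y0 y1 y yt).

Local Notation Y1 := (fun s => Dx L (y s)).
Local Notation Y2 := (fun s => Dx L (Dx L (y s))).
Local Notation Z1 := (fun s => Dx L (yt s)).
Local Notation K := (fun s x => Dx L (Dx L (y s)) x - a x * yt s x).

Lemma sol_H2 s : 0 <= s -> H2 L (y s) /\ H10 L (y s).
Proof. by case: sol => _ h _ _ s0; have [] := h s s0. Qed.

Lemma sol_H10 s : 0 <= s -> H10 L (yt s).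
Proof. by case: sol => _ _ [h _] _ s0; have [] := h s s0. Qed.

Lemma ccont_y : curve_cont L y.
Proof.
case: (sol) => _ h _ _; apply: (@squeeze_cont _ (fun s t => H2norm L (y s - y t))).
- by move=> s /sol_H2 [[/H1_sqi]].
- by move=> s t _ _; have [] := le_H2norm (y s - y t).
- by move=> t t0; have [] := h t t0.
Qed.

Lemma ccont_Dxy : curve_cont L Y1.
Proof.
case: (sol) => _ h _ _; apply: (@squeeze_cont _ (fun s t => H2norm L (y s - y t))).
- by move=> s /sol_H2 [[_ /H1_sqi]].
- move=> s t /sol_H2 [[hs _] _] /sol_H2 [[ht _] _]; rewrite nrm_Dx_sub//.
  by have [] := le_H2norm (y s - y t).
- by move=> t t0; have [] := h t t0.
Qed.

Lemma ccont_DDxy : curve_cont L Y2.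
Proof.
case: (sol) => _ h _ _; apply: (@squeeze_cont _ (fun s t => H2norm L (y s - y t))).
- by move=> s /sol_H2 [[_ /H1_Dx_sqi]].
- by move=> s t /sol_H2 [hs _] /sol_H2 [ht _]; exact: nrm_DDx_sub.
- by move=> t t0; have [] := h t t0.
Qed.

Lemma ccont_yt : curve_cont L yt.
Proof.
case: (sol) => _ _ [h _] _; apply: (@squeeze_cont _ (fun s t => H1norm L (yt s - yt t))).
- by move=> s /sol_H10 [/H1_sqi].
- by move=> s t _ _; exact: nrm_le_H1norm.
- by move=> t t0; have [] := h t t0.
Qed.

Lemma ccont_Dxyt : curve_cont L Z1.
Proof.
case: (sol) => _ _ [h _] _; apply: (@squeeze_cont _ (fun s t => H1norm L (yt s - yt t))).
- by move=> s /sol_H10 [/H1_Dx_sqi].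
- move=> s t /sol_H10 [hs _] /sol_H10 [ht _]; rewrite nrm_Dx_sub//; exact: nrm_Dx_le_H1norm.
- by move=> t t0; have [] := h t t0.
Qed.

Lemma cder_y : curve_der L y yt.
Proof.
case: (sol) => _ _ [_ h] _.
apply: (@squeeze_der _ _ (fun s t => H1norm L ((s - t)^-1 *: (y s - y t) - yt t))) => //.
by move=> s t _ _; exact: nrm_le_H1norm.
Qed.

Lemma cder_Dxy : curve_der L Y1 Z1.
Proof.
case: (sol) => _ _ [_ h] _.
apply: (@squeeze_der _ _ (fun s t => H1norm L ((s - t)^-1 *: (y s - y t) - yt t))) => //.
move=> s t s0 t0; have [[hs _] _] := sol_H2 (ltW s0); have [[ht _] _] := sol_H2 (ltW t0).
have [hyt _] := sol_H10 (ltW t0); exact: nrm_Dx_quot.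
Qed.

(* The weak formulation gives y_tt in H^{-1}; the difference quotients of y_t also
   converge in L^2, and testing identifies the two limits. *)
Lemma ytt_test (w : (R -> R) -> R) (T : R -> R) psi t : 0 < t -> Hm1 L w -> sqi D T ->
  Hm1norm L ((s - t)^-1 *: (L2_to_Hm1 L (yt s) - L2_to_Hm1 L (yt t)) - w)
    @[s --> within `[0, +oo[ t^'] --> (0 : R) ->
  nrm D (fun x => (s - t)^-1 * (yt s x - yt t x) - T x) @[s --> t^'] --> (0 : R) ->
  H10 L psi -> H1norm L psi <= 1 -> w psi = ip D T psi.
Proof.
move=> t0 [_ [Cw hCw]] sT /(within_dnbhs t0) cw cT hpsi psi1.
have spsi := H1_sqi (proj1 hpsi).
have st : sqi D (yt t) := proj1 ccont_yt _ (ltW t0).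
have d1 : is_derive t (1 : R) (fun s => ip D (yt s) psi) (w psi).
  apply: quot_is_derive; apply/cvgrPdist_le => e e0; move/cvgrPdist_le : cw => /(_ e e0) cw.
  near=> s.
  have s0 : 0 < s by near: s; exact: near_gt0.
  have ss : sqi D (yt s) := proj1 ccont_yt _ (ltW s0).
  have h : `|0 - Hm1norm L ((s - t)^-1 *: (L2_to_Hm1 L (yt s) - L2_to_Hm1 L (yt t)) - w)| <= e by near: s.
  apply: le_trans h; rewrite sub0r normrN; apply: le_trans (ler_norm _).
  have -> : `|w psi - (s - t)^-1 * (ip D (yt s) psi - ip D (yt t) psi)| =
    `|((s - t)^-1 *: (L2_to_Hm1 L (yt s) - L2_to_Hm1 L (yt t)) - w) psi| by rewrite distrC.
  (* The bound on the unit ball: Cauchy-Schwarz for the two L^2 functionals, continuity of w for the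
     third. *)
  apply: (@le_Hm1norm _ (`|(s - t)^-1| * (nrm D (yt s) + nrm D (yt t)) + `|Cw|)) => // v hv v1.
  have sv := H1_sqi (proj1 hv).
  have nv := le_trans (nrm_le_H1norm L v) v1.
  have b k : sqi D k -> `|ip D k v| <= nrm D k.
    move=> sk; apply: (le_trans (cauchy_schwarz mD sk sv)).
    by rewrite ler_piMr// nrm_ge0.
  apply: (le_trans (ler_normB _ _)); apply: lerD.
    rewrite normrM; apply: ler_wpM2l => //; apply: (le_trans (ler_normB _ _)).
    by apply: lerD; exact: b.
  apply: (le_trans (hCw _ hv)); apply: (le_trans (ler_norm _)).
  by rewrite normrM (ger0_norm (H1norm_ge0 L v)) ler_piMr.
have d2 : is_derive t (1 : R) (fun s => ip D (yt s) psi) (ip D T psi).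
  apply: quot_is_derive.
  have z : nrm D (fun x => psi x - psi x) @[s --> t^'] --> (0 : R).
    rewrite /nrm /ip (int_eq (g := fun=> 0)) ?/Rintegral ?integral0 ?sqrtr0; last first.
      by move=> x _; rewrite subrr mulr0.
    exact: cvg_cst.
  have n1 : \forall s \near t^', sqi D (fun x => (s - t)^-1 * (yt s x - yt t x)).
    near=> s; apply: sqiZ => //; apply: sqiB => //; apply: (proj1 ccont_yt); apply: ltW.
    by near: s; exact: near_gt0.
  have n2 : \forall s \near t^', sqi D psi by apply: nearW.
  have FF : Filter t^' by typeclasses eauto.
  have c := ip_cvg FF n1 n2 sT spsi cT z.
  apply: cvg_trans c; apply: near_eq_cvg; near=> s.
  have s0 : 0 < s by near: s; exact: near_gt0.
  have ss : sqi D (yt s) := proj1 ccont_yt _ (ltW s0).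
  by rewrite /= ipZl ?ipBl//; exact: sqiB.
by have [_ <-] := d1; have [_ <-] := d2.
Unshelve. all: by end_near. Qed.

(** In the weak equation the derivative is moved off the test function, which is possible because
    y_x is in H^1; then T - K is orthogonal to all test functions of norm at most 1, hence by
    scaling to all of them. *)
Lemma sol_eq (T : R -> R) t : 0 < t -> sqi D T ->
  nrm D (fun x => (s - t)^-1 * (yt s x - yt t x) - T x) @[s --> t^'] --> (0 : R) ->
  {ae mu, forall x, D x -> T x = K t x}.
Proof.
move=> t0 sT cT; have t0' := ltW t0.
case: (sol) => [[_ _ _ _ [w [hw dw weq]]] _ _ _].
have [[y1' y2'] y3] := sol_H2 t0'; have [yt1 _] := sol_H10 t0'.
have syt := H1_sqi yt1; have sY1 := H1_sqi y2'; have sY2 := H1_Dx_sqi y2'.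
have sayt := sqi_a a_bounded syt.
have sK := sqiB mD sY2 sayt; have sTK := sqiB mD sT sK.
have key phi : test_function `]0, L[ phi -> ip D (fun x => T x - K t x) phi = 0.
  move=> tphi; have [c c0 [tpsi psi1]] := test_unit tphi.
  set psi := (fun x => c * phi x) in tpsi psi1.
  have hpsi := test_H10 L0 tpsi; have spsi := H1_sqi (proj1 hpsi).
  have sphi := proj1 (test_sq L0 tphi).
  have e1 := ytt_test t0 (proj1 (hw t t0')) sT (dw t t0') cT hpsi psi1.
  have := weq psi hpsi t t0'; rewrite e1.
  have -> : int0L L (fun x => Dx L (y t) x * Dx L psi x) = - ip D (Dx L (Dx L (y t))) psi.
    rewrite int0LE ipC (ipC _ _ psi).
    by rewrite (H10pair_ip L0 (H10_pair L0 hpsi) (H1_pair L0 y2')) opprK.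
  rewrite (int0LE (fun x => a x * yt t x)) => e2.
  have : ip D (fun x => T x - K t x) psi = 0.
    by rewrite !ipBl// opprD opprK addrA.
  rewrite ipZr// => /eqP; rewrite mulf_eq0 gt_eqF//= => /eqP //.
have iTK : intg D (fun x => T x - K t x) by exact: sqi_intg L0' sTK.
by apply: aeS (fundamental_lemma L0 iTK key) => x hx Dx; apply/subr0_eq/hx.
Qed.

Lemma cder_yt : curve_der L yt K.
Proof.
move=> t t0; have t0' := ltW t0.
case: (sol) => [_ _ _ [T [hT dT]]].
have sT : sqi D (T t) by have [/L2P] := hT t t0'.
have cT : nrm D (fun x => (s - t)^-1 * (yt s x - yt t x) - T t x) @[s --> t^'] --> (0 : R).
  have := within_dnbhs t0 (dT t t0'); apply: cvg_trans; apply: near_eq_cvg; apply: nearW => s.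
  by rewrite L2normE.
have e := sol_eq t0 sT cT.
have [[_ y2'] _] := sol_H2 t0'; have [yt1 _] := sol_H10 t0'.
have sK := sqiB mD (H1_Dx_sqi y2') (sqi_a a_bounded (H1_sqi yt1)).
apply: cvg_trans cT; apply: near_eq_cvg; near=> s.
have s0 : 0 < s by near: s; exact: near_gt0.
have ss : sqi D (fun x => (s - t)^-1 * (yt s x - yt t x)).
  by apply: sqiZ => //; apply: sqiB => //; apply: (proj1 ccont_yt) => //; exact: ltW.
apply: nrm_eq_ae => //; [by case: (sqiB mD ss sT)|by case: (sqiB mD ss sK)|].
by apply: aeS e => x hx Dx; rewrite hx.
Unshelve. all: by end_near. Qed.

(** With k = f_xx - a g, the right-hand side a g + k is f_xx, so f solves the problem defining
    [Lop]. Testing the equation of the chosen solution h with h and with f gives h and f the same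
    Dirichlet integral. *)
Lemma Lop_energy f g : H2 L f -> H10 L f -> sqi D g ->
  energy L (Lop L a g (fun x => Dx L (Dx L f) x - a x * g x)) g = energy L f g.
Proof.
move=> [f1 f2] f10 sg.
set k := (fun x => _ - _).
have hr (v : R -> R) : H10 L v -> int0L L (fun x => (a x * g x + k x) * v x) = - int0L L (fun x => Dx L f x * Dx L v x).
  move=> hv; have -> : (fun x => (a x * g x + k x) * v x) = (fun x => v x * Dx L (Dx L f) x).
    by apply/funext => x; rewrite /k; ring.
  rewrite !int0LE (H10pair_ip L0 (H10_pair L0 hv) (H1_pair L0 f2)).
  by rewrite (ipC _ (Dx L v)).
have [hh hw] : [set h | H10 L h /\ forall v : R -> R, H10 L v ->
      - int0L L (fun x => Dx L h x * Dx L v x) =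
      int0L L (fun x => (a x * g x + k x) * v x)] (Lop L a g k).
  by apply: (xgetPex (fun=> 0)); exists f; split => // v /hr ->.
move: (Lop L a g k) hh hw => h hh hw.
have e (v : R -> R) : H10 L v -> ip D (Dx L h) (Dx L v) = ip D (Dx L f) (Dx L v).
  by move=> hv; apply: oppr_inj; have h1 := hw v hv; rewrite (hr v hv) in h1; exact: h1.
have sf := H1_Dx_sqi f1; have sh := H1_Dx_sqi (proj1 hh).
have eh : ip D (Dx L h) (Dx L h) = ip D (Dx L f) (Dx L f) by rewrite (e _ hh) ipC; exact: e.
rewrite (energyE sh sg).
rewrite (energyE sf sg).
by rewrite eh.
Qed.

End strong.

(** * Norm equivalence and exponential decay of V_s *)

Theorem mainTheorem2 (R : realType) (L : R) (a : R -> R) (x0 x1 amin : R)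
    (q q' q'' p p' p'' : R -> R) (deltaq deltap eps1 : R)
    (L_gt0 : 0 < L)
    (a_bounded : Linfty L a)
    (a_ge0 : ae0L L (fun x => 0 <= a x))
    (x0_ge0 : 0 <= x0) (x0_lt_x1 : x0 < x1) (x1_le_L : x1 <= L)
    (amin_gt0 : 0 < amin)
    (a_damping : {ae lebesgue_measure, forall x : R,
                    x \in `]x0, x1[ -> amin <= a x})
    (q_C2 : C2 L q q' q'') (p_C2 : C2 L p p' p'')
    (hQ : condQ L x0 x1 q q' deltaq)
    (hP : condP L x0 x1 q' p deltaq deltap)
    (eps1_gt0 : 0 < eps1)
    (eps1_lt : eps1 < Num.min (1 / (2 * cstC3 L a p q q' amin deltap))
                              (Linfty_norm L q + L / pi * Linfty_norm L p)^-1) :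
  let C0 := cstC0 L p'' amin eps1 in
  (exists2 C6 : R, 0 < C6 &
     forall f g : R -> R, H2 L f -> H10 L f -> H10 L g ->
       C6^-1 * (H2norm L f ^+ 2 + H1norm L g ^+ 2) <= Vs L a p q eps1 C0 f g
         <= C6 * (H2norm L f ^+ 2 + H1norm L g ^+ 2)) /\
  (forall C5 : R, 0 < C5 ->
     (forall f g : R -> R, H10 L f -> L2 L g ->
        V L a p q eps1 C0 f g <= C5 * energy L f g) ->
     forall y0 y1 : R -> R, H2 L y0 -> H10 L y0 -> H10 L y1 ->
     forall y yt : R -> (R -> R), strong_solution L a y0 y1 y yt ->
       let Vst := fun t : R => Vs L a p q eps1 C0 (y t) (yt t) in
       distr_derivative_le Vst
         (fun t => - cst_gamma amin eps1 deltap deltaq C5 * Vst t)).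
Proof.
move=> C0.
have mD : measurable (`]0, L[%classic : set (measurableTypeR R)) by exact: measurable_itv.
have C0_gt0 : 0 < C0.
  have [_ _ c2 _] := p_C2; have [_ P2 _] := cont_Linfty L_gt0 c2.
  by rewrite divr_gt0// mulr_gt0// divr_gt0// ltr_pwDl.
split.
  exact: (Vs_equiv L_gt0 a_bounded q_C2 p_C2 C0_gt0 eps1_gt0 (eps_QP eps1_gt0 eps1_lt)).
move=> C5 C5_gt0 hC5 y0 y1 _ _ _ y yt sol Vst.
pose Y1 s := Dx L (y s); pose Y2 s := Dx L (Dx L (y s)); pose Z1 s := Dx L (yt s).
pose K s x := Y2 s x - a x * yt s x.
have cY1 : curve_cont L Y1 := ccont_Dxy L_gt0 sol.
have cY2 : curve_cont L Y2 := ccont_DDxy L_gt0 sol.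
have cZ0 : curve_cont L yt := ccont_yt sol.
have cZ1 : curve_cont L Z1 := ccont_Dxyt L_gt0 sol.
have cKc : curve_cont L K := cK a_bounded cY2 cZ0.
have energyZ t : 0 <= t -> energy L (yt t) (K t) = half_sq L Z1 K t.
  by move=> t0; exact: (energyE (proj1 cZ1 t t0) (proj1 cKc t t0)).
have energyY t : 0 <= t -> energy L (y t) (yt t) = half_sq L Y1 yt t.
  by move=> t0; exact: (energyE (proj1 cY1 t t0) (proj1 cZ0 t t0)).
have VstE t : 0 <= t -> Vst t = V_curve L a amin q p p'' eps1 Y1 Y2 yt Z1 t.
  move=> t0; rewrite /Vst /Vs /V1 -/(K t) (energyZ t t0) (energyY t t0) MfunE.
  by [].
have cVst : {within `[0, +oo[, continuous Vst}.
  have cV := V_curve_cont (amin := amin) (eps1 := eps1) L_gt0 a_bounded q_C2 p_C2 cY1 cY2 cZ0 cZ1.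
  apply: (subspace_eq_continuous _ cV) => t; rewrite inE /= in_itv/= andbT => t0.
  exact/esym/VstE.
set g := cst_gamma _ _ _ _ _.
have cw : {within `[0, +oo[, continuous (fun t => - g * Vst t)}.
  have -> : (fun t => - g * Vst t) = (fun t => - g * Vst t + 0 * Vst t).
    by apply/funext => t; rewrite mul0r addr0.
  exact: within_lin.
have Vle t : 0 <= t -> Vst t <= C5 * half_sq L Z1 K t.
  move=> t0; rewrite -(energyZ t t0).
  have [h2 h10] := sol_H2 sol t0.
  have hK : L2 L (K t) by apply/L2P; exact: (proj1 cKc t t0).
  have := hC5 (yt t) (K t) (sol_H10 sol t0) hK.
  by rewrite /V /E0 (Lop_energy L_gt0 a h2 h10 (proj1 cZ0 t t0)).
apply: distr_derivative_le_intro => // t1 t2 t10 t12.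
have t10' := ltW t10; have t20' := le_trans t10' t12.
rewrite (VstE _ t10') (VstE _ t20').
have dec := V_curve_decay L_gt0 a_bounded a_ge0 x0_ge0 x1_le_L amin_gt0 a_damping q_C2 p_C2
  hQ hP eps1_gt0 eps1_lt cY1 cY2 cZ0 cZ1 (ccont_y sol) (cder_y sol) (cder_Dxy L_gt0 sol) (cder_yt L_gt0 a_bounded sol)
  (fun s hs => H10_pair L_gt0 (proj2 (sol_H2 sol hs)))
  (fun s hs => H1_pair L_gt0 (proj2 (proj1 (sol_H2 sol hs))))
  (fun s hs => H10_pair L_gt0 (sol_H10 sol hs)) t10 t12.
have delta0 := delta_ge0 (amin := amin) (eps1 := eps1) amin_gt0 hQ hP eps1_gt0.
set d := Num.min _ _ in dec delta0.
have mt : measurable (`]t1, t2[%classic : set (measurableTypeR R)) by exact: measurable_itv.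
have iE : intg (`]t1, t2[%classic : set (measurableTypeR R)) (fun t => 2 * d * half_sq L Z1 K t).
  by apply: intgZ => //; apply: within_intg => //; exact: half_sq_cont.
have iV : intg (`]t1, t2[%classic : set (measurableTypeR R)) (fun t => - g * Vst t).
  exact: within_intg.
rewrite -lerN2 opprB; apply: le_trans dec; rewrite -intN//; apply: int_le_ae => //; first exact: intgN.
apply: aeA => t; rewrite /= in_itv/= => /andP[tt _].
have t0 := le_trans t10' (ltW tt).
(* By the definition of gamma, what remains is Vst / C5 <= [half_sq], multiplied by 2 d. *)
have -> : - (- g * Vst t) = 2 * d / C5 * Vst t by rewrite mulNr opprK.
rewrite -mulrA; apply: ler_wpM2l; first exact: mulr_ge0.
by rewrite ler_pdivrMl//; exact: Vle.
Qed.
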